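(* Let $p$ be a prime and let $R$ be a ring with $\mathbb{Z}_{(p)}[X]\subseteq R\subseteq\mathbb{Q}[X]$. Then $R$ is a UFD if and only if either $R=\mathbb{Q}[X]$ or $R=W\cap\mathbb{Q}[X]$ for some DVR $W$ of $\mathbb{Q}(X)$ with $W\cap\mathbb{Q}=\mathbb{Z}_{(p)}$ which is unramified over $\mathbb{Z}_{(p)}$. Moreover, the latter case holds if and only if there is an admissible pair $(\alpha,\delta)\in\mathbb{O}_p^{\mathrm{br}}\times(\mathbb{Z}_{\ge0}\cup\{\infty\})$ with $\alpha$ unramified over $\mathbb{Q}_p$ such that $R=\mathrm{Int}_{\mathbb{Q}}(\bar B_p(\alpha,\delta),\mathbb{O}_p)$.
   Context: Fix a prime $p$. $\overline{\mathbb{Q}_p}$ is an algebraic closure of $\mathbb{Q}_p$, $v_p$ the unique extension of the $p$-adic valuation, $\mathbb{C}_p$ the completion of $\overline{\mathbb{Q}_p}$, $\mathbb{O}_p=\{x\in\mathbb{C}_p:v_p(x)\ge0\}$. $\mathbb{C}_p^{\mathrm{br}}$ is the set of $\alpha\in\mathbb{C}_p$ such that the ramification index of $\mathbb{Q}_p(\alpha)/\mathbb{Q}_p$ (index of $\mathbb{Z}$ in $v_p(\mathbb{Q}_p(\alpha)^* )$) is finite; $\alpha$ is unramified over $\mathbb{Q}_p$ if this index is $1$; $\mathbb{O}_p^{\mathrm{br}}=\mathbb{O}_p\cap\mathbb{C}_p^{\mathrm{br}}$. A pair $(\alpha,\delta)\in\mathbb{C}_p\times(\mathbb{Q}\cup\{\infty\})$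 is admissible if: when $\delta\in\mathbb{Q}$, $\alpha\in\overline{\mathbb{Q}_p}$; when $\delta=\infty$, $\alpha$ is transcendental over $\mathbb{Q}$. $\bar B_p(\alpha,\delta)=\{x\in\mathbb{C}_p:v_p(x-\alpha)\ge\delta\}$ (equal to $\{\alpha\}$ if $\delta=\infty$). For $E\subseteq\mathbb{C}_p$, $\mathrm{Int}_{\mathbb{Q}}(E,\mathbb{O}_p)=\{f\in\mathbb{Q}[X]:f(x)\in\mathbb{O}_p\ \forall x\in E\}$. A DVR $W$ over $\mathbb{Z}_{(p)}$ is unramified if the value group of $\mathbb{Z}_{(p)}$ equals that of $W$. *)

(* Defs.v *)
From HB Require Import structures.
From mathcomp Require Import all_boot all_order all_algebra.
Set Implicit Arguments. Unset Strict Implicit. Unset Printing Implicit Defensive.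
Import Order.TTheory GRing.Theory Num.Theory.
Local Open Scope ring_scope.

Definition padicv (p : nat) (q : rat) : rat :=
  (logn p (absz (numq q)))%:R - (logn p (absz (denq q)))%:R.

Definition inZploc (p : nat) (q : rat) : Prop := ~~ (p %| absz (denq q))%N.

Definition polyZp (p : nat) (f : {poly rat}) : Prop := forall i, inZploc p f`_i.

Definition is_subring (R : {poly rat} -> Prop) : Prop :=
  R 1 /\ (forall f g, R f -> R g -> R (f - g)) /\ (forall f g, R f -> R g -> R (f * g)).

Definition unitR (R : {poly rat} -> Prop) (u : {poly rat}) : Prop :=
  R u /\ exists w, R w /\ u * w = 1.

Definition irredR (R : {poly rat} -> Prop) (x : {poly rat}) : Prop :=
  R x /\ x != 0 /\ ~ unitR R x /\
  forall a b, R a -> R b -> x = a * b -> unitR R a \/ unitR R b.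

Definition assocR (R : {poly rat} -> Prop) (x y : {poly rat}) : Prop :=
  exists u, unitR R u /\ x = u * y.

Definition is_UFD (R : {poly rat} -> Prop) : Prop :=
  (forall x, R x -> x != 0 -> ~ unitR R x ->
     exists n (a : 'I_n -> {poly rat}),
       (forall i, irredR R (a i)) /\ x = \prod_(i < n) a i) /\
  (forall n m (a : 'I_n -> {poly rat}) (b : 'I_m -> {poly rat}),
     (forall i, irredR R (a i)) -> (forall j, irredR R (b j)) ->
     \prod_(i < n) a i = \prod_(j < m) b j ->
     n = m /\ exists s : 'I_n -> 'I_m, bijective s /\
                forall i, assocR R (a i) (b (s i))).

Notation QX := {fraction {poly rat}}.

Definition ratF (q : rat) : QX := tofrac (q%:P).
Definition polyF (f : {poly rat}) : QX := tofrac f.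

Definition is_dvaluation (w : QX -> int) : Prop :=
  (forall x y, x != 0 -> y != 0 -> w (x * y) = w x + w y) /\
  (forall x y, x != 0 -> y != 0 -> x + y != 0 ->
      (w x <= w (x + y)) \/ (w y <= w (x + y))) /\
  (forall z : int, exists x, x != 0 /\ w x = z).

Definition is_DVR (W : QX -> Prop) : Prop :=
  exists w, is_dvaluation w /\ forall x, W x <-> (x = 0 \/ 0 <= w x).

Definition unitW (W : QX -> Prop) (u : QX) : Prop :=
  W u /\ exists t, W t /\ u * t = 1.

(* W unramified over Z_(p) = W ∩ Q: the natural map of value groups
   Q^*/Z_(p)^*  ->  Q(X)^*/W^*  is onto (they are equal). *)
Definition unramifiedW (W : QX -> Prop) : Prop :=
  forall x : QX, x != 0 -> exists q : rat, q != 0 /\ unitW W (x / ratF q).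

Section Cp.
Variables (K : closedFieldType) (v : K -> rat).

(* v_p(x) >= d, with v_p(0) = +oo *)
Definition vge (x : K) (d : rat) : Prop := x = 0 \/ d <= v x.

Definition cauchy (u : nat -> K) : Prop :=
  forall n : rat, exists N, forall i j, (N <= i)%N -> (N <= j)%N -> vge (u i - u j) n.

Definition converges (u : nat -> K) (l : K) : Prop :=
  forall n : rat, exists N, forall i, (N <= i)%N -> vge (u i - l) n.

Definition algQ (x : K) : Prop :=
  exists f : {poly rat}, f != 0 /\ root (map_poly (@ratr K) f) x.

(* membership in Q_p = closure of Q in K *)
Definition inQp (x : K) : Prop := forall n : rat, exists q : rat, vge (x - ratr q) n.

Definition inQpbar (x : K) : Prop :=
  exists f : {poly K}, f != 0 /\ (forall i, inQp f`_i) /\ root f x.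

Definition inQpa (a y : K) : Prop :=
  exists f g : {poly K}, (forall i, inQp f`_i) /\ (forall i, inQp g`_i) /\
    g.[a] != 0 /\ y = f.[a] / g.[a].

Definition valgrp (a : K) (z : rat) : Prop :=
  exists y, inQpa a y /\ y != 0 /\ v y = z.

Definition isInt (z : rat) : Prop := denq z = 1.

(* ramification index (index of Z in the value group) finite *)
Definition ram_finite (a : K) : Prop :=
  exists s : seq rat, forall z, valgrp a z -> exists r, r \in s /\ isInt (z - r).

Definition unramified (a : K) : Prop := forall z, valgrp a z -> isInt z.

Definition inCbr (a : K) : Prop := ram_finite a.
Definition inObr (a : K) : Prop := vge a 0 /\ inCbr a.

(* delta : option nat encodes Z_{>=0} ∪ {oo} (None = oo) *)
Definition admissible (a : K) (d : option nat) : Prop :=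
  match d with Some _ => inQpbar a | None => ~ algQ a end.

Definition ball (a : K) (d : option nat) (x : K) : Prop :=
  match d with Some n => vge (x - a) n%:R | None => x = a end.

Definition IntQ (E : K -> Prop) (f : {poly rat}) : Prop :=
  forall x, E x -> vge (map_poly (@ratr K) f).[x] 0.

End Cp.

(* (K, v) is (a model of) C_p: an algebraically closed field with a
   valuation extending v_p on Q, complete, in which the algebraic numbers
   are dense (i.e. K is the completion of an algebraic closure of Q_p). *)
Definition is_Cp (p : nat) (K : closedFieldType) (v : K -> rat) : Prop :=
  (forall x y : K, x != 0 -> y != 0 -> v (x * y) = v x + v y) /\
  (forall x y : K, x != 0 -> y != 0 -> x + y != 0 ->
      (v x <= v (x + y)) || (v y <= v (x + y))) /\
  (forall q : rat, q != 0 -> ratr q != 0 :> K /\ v (ratr q) = padicv p q) /\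
  (forall u : nat -> K, cauchy v u -> exists l, converges v u l) /\
  (forall (x : K) (n : rat), exists y, algQ y /\ vge v (x - y) n).

(* Main.v *)
(* The pivot is the property that R = {f in Q[X] : w f >= 0} for a valuation w of Q[X]
   extending v_p with integer values; passing to Q(X), this says that R = W n Q[X] with W
   as in the statement.

   If R is a UFD and 1/p is not in R, then R n Q = Z_(p), so p is irreducible, hence prime,
   and w f is the largest n with p^-n f in R. Conversely, if R is given by w, then p and the
   irreducible polynomials of Q[X], scaled to have w = 0, are primes of R, and every nonzero
   element is a unit times a product of such primes.

   A pair (a, d) gives w f = v (f a) if d = oo, and otherwise the Gauss valuation of
   f (a + p^d Y), which by the maximum modulus principle is the infimum of v o f on the ball.

   For the converse construction of (a, d) from w, Zorn's lemma gives a maximal isomorphism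
   between a subring of the residue ring of w and a subring of the residue field of C_p; since
   the latter is algebraically closed, the subring consists of all elements of the residue
   ring that are algebraic over it. Expand X in Teichmueller digits, X = sum T_i p^i modulo
   p^N, where T_i is a power of the i-th remainder x_i and corresponds to an exact root of
   unity (or zero) tau_i of C_p. If all digits are residually algebraic, then a = sum tau_i p^i
   satisfies v (f a) = w f. If x_n is the first residually transcendental one, then w is the
   Gauss valuation of the ball of centre a = sum_(i < n) tau_i p^i and radius n. *)
Require Import Defs.
From HB Require Import structures.
From mathcomp Require Import all_boot all_order all_algebra.
From mathcomp Require Import ring lra zify.
From mathcomp Require boolp classical_sets cyclic perm generic_quotient.
Import Order.TTheory GRing.Theory Num.Theory.
Local Open Scope ring_scope.
Set Implicit Arguments.
Unset Strict Implicit.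
Unset Printing Implicit Defensive.

(** * Valuations *)

(** The expansion of X has to be compared with one in C_p, although Q[X] is not complete and has no
    roots of unity except 1 and -1, so that Teichmueller representatives do not exist on the side of
    w. The proof therefore computes with pairs in Q[X] x C_p: the first component is controlled only
    modulo p^N, for N arbitrary, while the second is exact and must not depend on N. Residue rings
    are never formed; their subrings appear as subrings of the product that are saturated under
    elements of positive value, and one polynomial over the product carries both evaluations. Two
    facts drive the comparison. The residue field of C_p is algebraic over F_p, so every residue is
    fixed by some power q of p. And in the ring generated by pairs of Teichmueller representatives,
    a - a^q is, up to p^N, p times an element r of the same ring: for residually zero a,
    divisibility of a by p^(n+1) means divisibility of r by p^n, for w and v simultaneously. The
    same descent shows that the values in C_p are integers, whence a is unramified. *)

Definition is_val (D : idomainType) (v : D -> rat) : Prop :=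
  (forall x y, x != 0 -> y != 0 -> v (x * y) = v x + v y) /\
  (forall x y, x != 0 -> y != 0 -> x + y != 0 ->
     (v x <= v (x + y)) || (v y <= v (x + y))).

Section Valuation.
Variables (D : idomainType) (v : D -> rat) (hv : is_val v).

(* v x >= r, resp. v x > r, with the convention v 0 = +oo. *)
Definition vg (x : D) (r : rat) : Prop := x = 0 \/ r <= v x.
Definition vgt (x : D) (r : rat) : Prop := x = 0 \/ r < v x.

Lemma val_mul x y : x != 0 -> y != 0 -> v (x * y) = v x + v y.
Proof. by case: hv => h _; apply: h. Qed.

Lemma val_one : v 1 = 0.
Proof.
have := val_mul (oner_neq0 D) (oner_neq0 D); rewrite mulr1 => h.
by apply: (addrI (v 1)); rewrite -h addr0.
Qed.

Lemma val_opp x : v (- x) = v x.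
Proof.
have [->|x0] := eqVneq x 0; first by rewrite oppr0.
have n1 : (-1 : D) != 0 by rewrite oppr_eq0 oner_eq0.
have h : v (-1) + v (-1) = 0 by rewrite -val_mul // mulrNN mulr1 val_one.
rewrite -mulN1r val_mul //; suff -> : v (-1) = 0 by rewrite add0r.
by lra.
Qed.

Lemma val_exp x n : x != 0 -> v (x ^+ n) = n%:R * v x.
Proof.
move=> x0; elim: n => [|n IHn]; first by rewrite expr0 val_one mul0r.
by rewrite exprS val_mul ?expf_neq0 // IHn -natr1 mulrDl mul1r addrC.
Qed.

Lemma vg_le x r s : s <= r -> vg x r -> vg x s.
Proof. by move=> h [->|h']; [left|right; apply: le_trans h']. Qed.

Lemma vgt_le x r s : s <= r -> vgt x r -> vgt x s.
Proof. by move=> h [->|h']; [left|right; apply: le_lt_trans h']. Qed.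

Lemma vgtW x r : vgt x r -> vg x r.
Proof. by case=> [->|/ltW]; [left|right]. Qed.

Lemma vg_vgt x r s : s < r -> vg x r -> vgt x s.
Proof. by move=> h [->|h']; [left|right; apply: lt_le_trans h']. Qed.

Lemma vgE x r : x != 0 -> vg x r -> r <= v x.
Proof. by move=> x0 [x00|//]; rewrite x00 eqxx in x0. Qed.

Lemma vgtE x r : x != 0 -> vgt x r -> r < v x.
Proof. by move=> x0 [x00|//]; rewrite x00 eqxx in x0. Qed.

Lemma vgN x r : vg x r -> vg (- x) r.
Proof. by case=> [->|h]; [left; rewrite oppr0|right; rewrite val_opp]. Qed.

Lemma vgtN x r : vgt x r -> vgt (- x) r.
Proof. by case=> [->|h]; [left; rewrite oppr0|right; rewrite val_opp]. Qed.

Lemma vgD x y r : vg x r -> vg y r -> vg (x + y) r.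
Proof.
have [->|x0] := eqVneq x 0; first by rewrite add0r.
have [->|y0] := eqVneq y 0; first by rewrite addr0.
have [->|s0] := eqVneq (x + y) 0; first by left.
move=> /(vgE x0) hx /(vgE y0) hy; right.
by case/orP: (hv.2 _ _ x0 y0 s0); apply: le_trans.
Qed.

Lemma vgtD x y r : vgt x r -> vgt y r -> vgt (x + y) r.
Proof.
have [->|x0] := eqVneq x 0; first by rewrite add0r.
have [->|y0] := eqVneq y 0; first by rewrite addr0.
have [->|s0] := eqVneq (x + y) 0; first by left.
move=> /(vgtE x0) hx /(vgtE y0) hy; right.
by case/orP: (hv.2 _ _ x0 y0 s0); apply: lt_le_trans.
Qed.

Lemma vgB x y r : vg x r -> vg y r -> vg (x - y) r.
Proof. by move=> hx /vgN; apply: vgD. Qed.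

Lemma vgtB x y r : vgt x r -> vgt y r -> vgt (x - y) r.
Proof. by move=> hx /vgtN; apply: vgtD. Qed.

Lemma vgBC x y r : vg (x - y) r -> vg (y - x) r.
Proof. by move/vgN; rewrite opprB. Qed.

Lemma vgtBC x y r : vgt (x - y) r -> vgt (y - x) r.
Proof. by move/vgtN; rewrite opprB. Qed.

Lemma vg_trans x y z r : vg (x - y) r -> vg (y - z) r -> vg (x - z) r.
Proof. by move=> h1 h2; have := vgD h1 h2; rewrite addrA subrK. Qed.

Lemma vgt_trans x y z r : vgt (x - y) r -> vgt (y - z) r -> vgt (x - z) r.
Proof. by move=> h1 h2; have := vgtD h1 h2; rewrite addrA subrK. Qed.

Lemma vg_cong x y r : vg (x - y) r -> vg y r -> vg x r.
Proof. by move=> h1 h2; have := vgD h1 h2; rewrite subrK. Qed.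

Lemma vgt_cong x y r : vgt (x - y) r -> vgt y r -> vgt x r.
Proof. by move=> h1 h2; have := vgtD h1 h2; rewrite subrK. Qed.

Lemma vgM x y r s : vg x r -> vg y s -> vg (x * y) (r + s).
Proof.
have [->|x0] := eqVneq x 0; first by rewrite mul0r; left.
have [->|y0] := eqVneq y 0; first by rewrite mulr0; left.
by move=> /(vgE x0) hx /(vgE y0) hy; right; rewrite val_mul // lerD.
Qed.

Lemma vgMl x y r : vg x 0 -> vg y r -> vg (x * y) r.
Proof. by move=> hx hy; have := vgM hx hy; rewrite add0r. Qed.

Lemma vgMr x y r : vg x r -> vg y 0 -> vg (x * y) r.
Proof. by move=> hx hy; have := vgM hx hy; rewrite addr0. Qed.

Lemma vgtM x y r s : vgt x r -> vg y s -> vgt (x * y) (r + s).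
Proof.
have [->|x0] := eqVneq x 0; first by rewrite mul0r; left.
have [->|y0] := eqVneq y 0; first by rewrite mulr0; left.
by move=> /(vgtE x0) hx /(vgE y0) hy; right; rewrite val_mul // ltr_leD.
Qed.

Lemma vgtMr x y r : vgt x r -> vg y 0 -> vgt (x * y) r.
Proof. by move=> hx hy; have := vgtM hx hy; rewrite addr0. Qed.

Lemma vgtMl x y r : vg x 0 -> vgt y r -> vgt (x * y) r.
Proof. by rewrite mulrC => hx hy; apply: vgtMr. Qed.

Lemma vgtMl0 x y r : x != 0 -> vgt y r -> vgt (x * y) (v x + r).
Proof.
move=> x0; have [->|y0] := eqVneq y 0; first by rewrite mulr0; left.
by move=> /(vgtE y0) hy; right; rewrite val_mul // ltrD2l.
Qed.

Lemma vg1 : vg 1 0.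
Proof. by right; rewrite val_one. Qed.

Lemma vgt1 : ~ vgt 1 0.
Proof. by case=> [/eqP|]; rewrite ?oner_eq0 // val_one ltxx. Qed.

Lemma vg_nat n : vg n%:R 0.
Proof. by elim: n => [|n IH]; [by left|]; rewrite -natr1; exact: (vgD IH vg1). Qed.

Lemma vg_int n : vg n%:~R 0.
Proof. by case: n => n; [exact: vg_nat|rewrite NegzE mulrNz; exact/vgN/vg_nat]. Qed.

Lemma vgX x n : vg x 0 -> vg (x ^+ n) 0.
Proof. by move=> h; elim: n => [|n IH]; [exact: vg1|rewrite exprS; apply: vgMl]. Qed.

Lemma vgtX x n : (0 < n)%N -> vgt x 0 -> vgt (x ^+ n) 0.
Proof.
case: n => // n _ h; rewrite exprS; apply: (vgtMr h); apply: vgX; exact: vgtW.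
Qed.

Lemma vg_sum I (s : seq I) (P : pred I) (F : I -> D) r :
  (forall i, P i -> vg (F i) r) -> vg (\sum_(i <- s | P i) F i) r.
Proof. by move=> h; apply: (big_ind (fun x => vg x r)) => //; [by left|move=> x y hx hy; exact: vgD]. Qed.

Lemma vgt_sum I (s : seq I) (P : pred I) (F : I -> D) r :
  (forall i, P i -> vgt (F i) r) -> vgt (\sum_(i <- s | P i) F i) r.
Proof. by move=> h; apply: (big_ind (fun x => vgt x r)) => //; [by left|move=> x y hx hy; exact: vgtD]. Qed.

Lemma vgt_prime x y : vg x 0 -> vg y 0 -> vgt (x * y) 0 -> vgt x 0 \/ vgt y 0.
Proof.
have [->|x0] := eqVneq x 0; first by left; left.
have [->|y0] := eqVneq y 0; first by right; left.
move=> /(vgE x0) hx /(vgE y0) hy /(vgtE (mulf_neq0 x0 y0)); rewrite val_mul // => h.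
by case: (ltrP 0 (v x)) => h1; [left|right]; right => //; lra.
Qed.

Lemma vgt_primeX x n : vg x 0 -> vgt (x ^+ n) 0 -> vgt x 0.
Proof.
move=> hx; elim: n => [/vgt1 //|n IH]; rewrite exprS => /vgt_prime [] //.
exact: vgX.
Qed.

Lemma vNgt x : vg x 0 -> ~ vgt x 0 -> x != 0 /\ v x = 0.
Proof.
move=> hx h; have x0 : x != 0 by apply/eqP => x0; apply: h; left.
split=> //; apply/eqP; rewrite eq_le (vgE x0 hx) andbT leNgt.
by apply/negP => h'; apply: h; right.
Qed.

Lemma val_dom x y : x != 0 -> vgt y (v x) -> x + y != 0 /\ v (x + y) = v x.
Proof.
move=> x0 hy.
have s0 : x + y != 0.
  apply/eqP => /eqP; rewrite addr_eq0 => /eqP e.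
  by have := vgtN hy; rewrite -e => /(vgtE x0); rewrite ltxx.
split=> //; apply/eqP; rewrite eq_le; apply/andP; split; last first.
  by apply: vgE s0 _; apply: vgD; [right|exact: vgtW].
rewrite leNgt; apply/negP => h.
have : vgt (x + y - y) (v x) by apply: vgtB => //; right.
by rewrite addrK => /(vgtE x0); rewrite ltxx.
Qed.

Lemma vg_unitM x y r : vg x 0 -> ~ vgt x 0 -> vg (x * y) r -> vg y r.
Proof.
move=> h1 h2; have [x0 vx] := vNgt h1 h2.
have [->|y0] := eqVneq y 0; first by left.
by move/(vgE (mulf_neq0 x0 y0)); rewrite val_mul // vx add0r; right.
Qed.

Lemma vg_cancel x y r s : x != 0 -> vg (x * y) (r + s) -> v x = r -> vg y s.
Proof.
move=> x0 + vx; have [->|y0] := eqVneq y 0; first by left.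
by move/(vgE (mulf_neq0 x0 y0)); rewrite val_mul // vx lerD2l; right.
Qed.

Lemma vg_horner (F : {poly D}) x : (forall i, vg F`_i 0) -> vg x 0 -> vg F.[x] 0.
Proof.
move=> hF hx; rewrite horner_coef; apply: vg_sum => i _.
by apply: vgMl (hF i) (vgX _ hx).
Qed.

Lemma vgt_horner (F : {poly D}) x : (forall i, vgt F`_i 0) -> vg x 0 -> vgt F.[x] 0.
Proof.
move=> hF hx; rewrite horner_coef; apply: vgt_sum => i _.
by apply: vgtMr (hF i) (vgX _ hx).
Qed.

Lemma vg_hornerB (F : {poly int}) x y r : vg x 0 -> vg y 0 -> vg (x - y) r ->
  vg ((map_poly intr F).[x] - (map_poly intr F).[y]) r.
Proof.
move=> hx hy hxy; rewrite !(horner_coef_wide _ (leqnn (size (map_poly intr F)))) -sumrB.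
apply: vg_sum => i _; rewrite -mulrBr subrXX.
apply: vgMl; first by rewrite coef_map; exact: vg_int.
by apply: vgMr hxy _; apply: vg_sum => j _; apply: vgMl; apply: vgX.
Qed.

(* An element of negative value cannot cancel its own leading power. *)
Lemma monic_root_integral (F : {poly D}) x :
  F \is monic -> (forall i, vg F`_i 0) -> root F x -> vg x 0.
Proof.
move=> mF hF rx; have [->|x0] := eqVneq x 0; first by left.
right; rewrite leNgt; apply/negP => hx.
have : F.[x] = 0 by apply/eqP.
rewrite horner_coef; case E : (size F) => [|d].
  by move/eqP: E mF; rewrite size_poly_eq0 => /eqP ->; rewrite monicE lead_coef0 eq_sym oner_eq0.
rewrite big_ord_recr /=.
have -> : F`_d = 1 by have := monicP mF; rewrite lead_coefE E.
rewrite mul1r addrC => h.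
have xd : x ^+ d != 0 by rewrite expf_neq0.
have [] := @val_dom _ (\sum_(i < d) F`_i * x ^+ i) xd.
  apply: vgt_sum => i _; apply: (vg_vgt _ (vgMl (hF i) (or_intror (lexx _)))).
  rewrite !val_exp // -subr_gt0 -mulrBl; have : ((i%:R : rat) < d%:R) by rewrite ltr_nat.
  by move=> hi; rewrite nmulr_rgt0 // subr_lt0.
by rewrite h eqxx.
Qed.

End Valuation.

Lemma classic_min (P : nat -> Prop) :
  (exists n, P n) -> exists n, P n /\ forall m, (m < n)%N -> ~ P m.
Proof.
case=> n; have [k] := ubnP n; elim: k n => // k IH n hn Pn.
have [[m [hm Pm]]|h] := boolp.EM (exists m, (m < n)%N /\ P m).
  by apply: (IH m) => //; lia.
by exists n; split=> // m hm Pm; apply: h; exists m.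
Qed.

(** * Subrings and Frobenius *)

Section SubringPred.
Variables (A : comNzRingType) (P : A -> Prop).
Definition subring_pred : Prop :=
  [/\ P 1, forall a b, P a -> P b -> P (a - b) & forall a b, P a -> P b -> P (a * b)].
Hypothesis hP : subring_pred.

Lemma sr1 : P 1. Proof. by case: hP. Qed.
Lemma srB a b : P a -> P b -> P (a - b). Proof. by case: hP => _ h _; apply: h. Qed.
Lemma srM a b : P a -> P b -> P (a * b). Proof. by case: hP => _ _ h; apply: h. Qed.
Lemma sr0 : P 0. Proof. by rewrite -(subrr 1); apply: srB sr1 sr1. Qed.
Lemma srN a : P a -> P (- a). Proof. by rewrite -sub0r => /(srB sr0). Qed.
Lemma srD a b : P a -> P b -> P (a + b).
Proof. by move=> ha /srN hb; rewrite -[b]opprK; apply: srB. Qed.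
Lemma srX a n : P a -> P (a ^+ n).
Proof. by move=> ha; elim: n => [|n IH]; rewrite ?expr0 ?exprS; [exact: sr1|exact: srM]. Qed.
Lemma sr_nat n : P n%:R.
Proof. by elim: n => [|n IH]; [exact: sr0|rewrite -natr1; exact: srD IH sr1]. Qed.
Lemma sr_int n : P n%:~R.
Proof. by case: n => n; [exact: sr_nat|rewrite NegzE mulrNz; exact/srN/sr_nat]. Qed.
Lemma sr_sum I (s : seq I) (Q : pred I) (F : I -> A) :
  (forall i, Q i -> P (F i)) -> P (\sum_(i <- s | Q i) F i).
Proof. by move=> h; apply: big_ind h; [exact: sr0|exact: srD]. Qed.

(** The correction term is required to lie in P: when P is the ring generated by Teichmueller pairs,
    this keeps the division by p inside that ring. *)
Lemma sr_freshman p a b : prime p -> P a -> P b ->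
  exists s, P s /\ (a + b) ^+ p = a ^+ p + b ^+ p + p%:R * s.
Proof.
move=> pp ha hb; have := prime_gt0 pp; case: p pp => // p pp _.
exists (\sum_(i < p) (a ^+ (p - i) * b ^+ i.+1) *+ ('C(p.+1, i.+1) %/ p.+1)); split.
  by apply: sr_sum => i _; rewrite -mulr_natr; apply/srM/sr_nat/srM; apply: srX.
rewrite exprDn big_ord_recl big_ord_recr /= subn0 expr0 mulr1 bin0 mulr1n.
rewrite subnn expr0 mul1r binn mulr1n -[RHS]addrA; congr (_ + _).
rewrite addrC; congr (_ + _).
rewrite mulr_sumr; apply: eq_bigr => i _; rewrite /bump /= add1n subSS.
rewrite mulr_natl -mulrnA; congr (_ *+ _); rewrite divnK //.
by apply: prime_dvd_bin => //=; rewrite ltnS ltn_ord.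
Qed.

Lemma sr_frobeniusB p m a b : prime p -> P a -> P b ->
  exists s, P s /\ (a - b) ^+ (p ^ m) = a ^+ (p ^ m) - b ^+ (p ^ m) + p%:R * s.
Proof.
move=> pp ha hb; elim: m => [|m [s [hs IH]]].
  by exists 0; split; [exact: sr0|rewrite mulr0 addr0].
rewrite expnSr !exprM IH.
set a' := a ^+ _; set b' := b ^+ _.
have ha' : P a' by apply: srX.
have hb' : P b' by apply: srX.
have hps : P (p%:R * s) by apply: srM => //; apply: sr_nat.
have [s1 [h1 e1]] := sr_freshman pp (srB ha' hb') hps.
(* Expanding [a' ^+ p] as the power of [(a' - b') + b'] yields [(a' - b') ^+ p] without the sign
   [(-1) ^+ p], which would single out p = 2. *)
have [s2 [h2 e2]] := sr_freshman pp (srB ha' hb') hb'.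
move: e2; rewrite subrK => e2.
exists (s1 + s * (p%:R * s) ^+ p.-1 - s2); split.
  by apply: srB h2; apply: srD h1 _; apply: srM => //; apply: srX.
rewrite e1 {1}e2; have -> : (p%:R * s) ^+ p = (p%:R * s) * (p%:R * s) ^+ p.-1.
  by rewrite -exprS prednK ?prime_gt0.
by ring.
Qed.

Definition polyP_in (F : {poly A}) := forall i, P F`_i.

Lemma srpC c : P c -> polyP_in c%:P.
Proof. by move=> hc i; rewrite coefC; case: eqP => // _; apply: sr0. Qed.
Lemma srpX : polyP_in 'X.
Proof. by move=> i; rewrite coefX; exact: sr_nat. Qed.
Lemma srpXn n : polyP_in 'X^n.
Proof. by move=> i; rewrite coefXn; exact: sr_nat. Qed.
Lemma srpB F G : polyP_in F -> polyP_in G -> polyP_in (F - G).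
Proof. by move=> hF hG i; rewrite coefB; apply: srB. Qed.
Lemma srpD F G : polyP_in F -> polyP_in G -> polyP_in (F + G).
Proof. by move=> hF hG i; rewrite coefD; apply: srD. Qed.
Lemma srpM F G : polyP_in F -> polyP_in G -> polyP_in (F * G).
Proof. by move=> hF hG i; rewrite coefM; apply: sr_sum => j _; apply: srM. Qed.
Lemma srp_horner F x : polyP_in F -> P x -> P F.[x].
Proof. by move=> hF hx; rewrite horner_coef; apply: sr_sum => i _; apply: srM => //; apply: srX. Qed.
End SubringPred.

Lemma sr_comp_poly (A : comNzRingType) (P : A -> Prop) (hP : subring_pred P) F G :
  polyP_in P F -> polyP_in P G -> polyP_in P (F \Po G).
Proof.
move=> hF hG; rewrite comp_polyE => i; rewrite coef_sum; apply: (sr_sum hP) => j _.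
rewrite coefZ; apply: (srM hP) => //.
have : polyP_in P (G ^+ j); last by apply.
elim: (nat_of_ord j) => [|k IH]; first by rewrite expr0; apply: srpC => //; exact: sr1.
by rewrite exprS; apply: srpM.
Qed.

(** * Extensions of the p-adic valuation *)

Section Padic.
Variables (p : nat) (hp : prime p).

(** The condition bears on integers, which map to every ring, so that one notion serves both Q[X]
    and C_p. *)
Definition extends_padic (D : idomainType) (v : D -> rat) : Prop :=
  is_val v /\ forall n : int, n != 0 ->
    (n%:~R : D) != 0 /\ v n%:~R = (logn p (absz n))%:R.

Section Ext.
Variables (D : idomainType) (v : D -> rat) (ext : extends_padic v).
Let hv : is_val v := proj1 ext.

Lemma vg_subring : subring_pred (fun x => vg v x 0).
Proof.
by split; [exact: vg1|move=> a b; exact: vgB|move=> a b; exact: vgMl].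
Qed.

Lemma natp_neq0 : (p%:R : D) != 0.
Proof. by have [] := ext.2 p (lt0n_neq0 (prime_gt0 hp)). Qed.

Lemma valp : v p%:R = 1.
Proof.
have [_] := ext.2 p (lt0n_neq0 (prime_gt0 hp)).
by rewrite absz_nat lognE hp prime_gt0 // dvdnn divnn prime_gt0 // logn1.
Qed.

Lemma valpX n : v (p%:R ^+ n) = n%:R.
Proof. by rewrite (val_exp hv) ?natp_neq0 // valp mulr1. Qed.

Lemma vg_p : vg v p%:R 1. Proof. by right; rewrite valp. Qed.
Lemma vg_pX n : vg v (p%:R ^+ n) n%:R. Proof. by right; rewrite valpX. Qed.
Lemma vgt_p : vgt v p%:R 0. Proof. by right; rewrite valp. Qed.
Lemma vg_pM x r : vg v x r -> vg v (p%:R * x) (1 + r).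
Proof. exact: (vgM hv vg_p). Qed.
Lemma vg_pXM n x r : vg v x r -> vg v (p%:R ^+ n * x) (n%:R + r).
Proof. exact: (vgM hv (vg_pX n)). Qed.
Lemma vgt_pM x : vg v x 0 -> vgt v (p%:R * x) 0.
Proof. exact: (vgtMr hv vgt_p). Qed.
Lemma vg_pXdiv n x r : vg v (p%:R ^+ n * x) (n%:R + r) -> vg v x r.
Proof. by move=> h; apply: vg_cancel h _ => //; rewrite ?expf_neq0 ?natp_neq0 ?valpX. Qed.
Lemma vg_pdiv x r : vg v (p%:R * x) (1 + r) -> vg v x r.
Proof. by move=> h; apply: vg_cancel h _ => //; rewrite ?natp_neq0 ?valp. Qed.

Lemma vgt_int n : vgt v n%:~R 0 <-> (p %| absz n)%N.
Proof.
have [->|n0] := eqVneq n 0; first by rewrite absz0 dvdn0; split=> // _; left.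
have [n1 vn] := ext.2 n n0; split.
  by move/(vgtE n1); rewrite vn ltr0n logn_gt0 mem_primes => /and3P[].
move=> h; right; rewrite vn ltr0n logn_gt0 mem_primes hp h absz_gt0 n0 //.
Qed.

Lemma vg_frobenius x y m : vg v x 0 -> vg v y 0 ->
  vgt v ((x - y) ^+ (p ^ m) - (x ^+ (p ^ m) - y ^+ (p ^ m))) 0.
Proof.
move=> hx hy; have [s [hs ->]] := sr_frobeniusB vg_subring m hp hx hy.
by rewrite addrAC subrr add0r; apply: vgt_pM.
Qed.
End Ext.
End Padic.

Lemma ratr_frac (F : fieldType) (q : rat) (a b : int) :
  (forall n : int, n != 0 -> n%:~R != 0 :> F) ->
  b != 0 -> q = a%:~R / b%:~R -> ratr q = a%:~R / b%:~R :> F.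
Proof.
move=> char0 b0 eq; have b1 : (b%:~R : rat) != 0 by rewrite intr_eq0.
apply/eqP; rewrite /ratr eqr_div ?char0 ?denq_neq0 // -!rmorphM; apply/eqP.
congr _%:~R; apply: (@intr_inj rat).
by rewrite !rmorphM /= numqE mulrAC [X in X * _ * _]eq divfK.
Qed.

(** K carries no order, so the morphism property of [ratr] is derived from characteristic 0
    alone. *)
Lemma ratr_rmorphism (F : fieldType) :
  (forall n : int, n != 0 -> n%:~R != 0 :> F) ->
  exists phi : {rmorphism rat -> F}, forall q, phi q = ratr q.
Proof.
move=> char0; have fracE (q : rat) (a b : int) : b != 0 ->
    q = a%:~R / b%:~R -> ratr q = a%:~R / b%:~R :> F by exact: ratr_frac.
have dF q : (denq q)%:~R != 0 :> F by rewrite char0 ?denq_neq0.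
have dQ q : (denq q)%:~R != 0 :> rat by rewrite intr_eq0 denq_neq0.
have fB : zmod_morphism (@ratr F).
  move=> x y.
  rewrite (fracE _ (numq x * denq y - numq y * denq x) (denq x * denq y)).
  - by rewrite !rmorphB !rmorphM /= /ratr; field; rewrite !dF.
  - by rewrite mulf_neq0 ?denq_neq0.
  - rewrite !rmorphB !rmorphM /= -{1}[x]divq_num_den -{1}[y]divq_num_den.
    by field; rewrite !dQ.
have fM : monoid_morphism (@ratr F).
  split=> [|x y]; first by rewrite /ratr divr1.
  rewrite (fracE _ (numq x * numq y) (denq x * denq y)).
  - by rewrite !rmorphM /= /ratr; field; rewrite !dF.
  - by rewrite mulf_neq0 ?denq_neq0.
  - rewrite !rmorphM /= -{1}[x]divq_num_den -{1}[y]divq_num_den.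
    by field; rewrite !dQ.
pose aM := GRing.isZmodMorphism.Build rat F (@ratr F) fB.
pose mM := GRing.isMonoidMorphism.Build rat F (@ratr F) fM.
pose phi : {rmorphism rat -> F} := HB.pack (@ratr F) aM mM.
by exists phi.
Qed.

(** Primitivity guarantees that an annihilating polynomial does not vanish after reduction modulo
    p. *)
Lemma primitive_int_poly (f : {poly rat}) : f != 0 ->
  exists (c : rat) (F : {poly int}), [/\ c != 0, f = c *: map_poly intr F, F != 0
    & forall a : int, (forall i, (a %| F`_i)%Z) -> (a %| 1)%Z].
Proof.
move=> f0; have [q [a a0 e]] := rat_poly_scale f.
have q0 : q != 0 by apply: contraNneq f0 => q0; rewrite e q0 map_poly0 scaler0.
exists (a%:~R^-1 * (zcontents q)%:~R), (zprimitive q); split.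
- by rewrite mulf_neq0 ?invr_eq0 ?intr_eq0 ?zcontents_eq0.
- by rewrite e -scalerA {1}(zpolyEprim q) map_polyZ.
- by rewrite zprimitive_eq0.
move=> b hb; have := zcontents_primitive q; rewrite q0 => <-.
by rewrite dvdz_contents; apply/polyOverP.
Qed.

Section Padic.
Variables (p : nat) (hp : prime p).

Lemma inZploc_frac (a b : int) : ~~ (p %| absz b)%N -> inZploc p (a%:~R / b%:~R).
Proof.
move=> hb; have b0 : b != 0 by apply: contraNneq hb => ->; rewrite absz0 dvdn0.
set x := _ / _; rewrite /inZploc; apply: contra hb => /dvdn_trans; apply.
rewrite -(Gauss_dvdr _ (m := absz (denq x)) (n := absz (numq x))); last first.
  by rewrite coprime_sym coprime_num_den.
rewrite -abszM; have -> : numq x * b = a * denq x.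
  apply: (@intr_inj rat); rewrite !rmorphM /= numqE /x.
  by field; rewrite intr_eq0.
by rewrite abszM dvdn_mull.
Qed.

Lemma padicv_int (n : int) : padicv p n%:~R = (logn p (absz n))%:R.
Proof. by rewrite /padicv numq_int denq_int logn1 subr0. Qed.

Lemma int_pdec (n : int) : n != 0 -> exists (m : int),
  n = (p ^ (logn p (absz n)))%N%:Z * m /\ ~~ (p %| absz m)%N.
Proof.
move=> n0; have n1 : (0 < absz n)%N by rewrite absz_gt0.
have [m cm e] := pfactor_coprime hp n1.
exists ((-1) ^+ (n < 0)%R * m%:Z); split; last first.
  by rewrite abszMsign -prime_coprime.
by rewrite {1}[n]intEsign {1}e PoszM [m%:Z * _]mulrC mulrCA.
Qed.

Lemma padic_dec (q : rat) : q != 0 -> exists (k : int) (u : rat),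
  [/\ q = p%:R ^ k * u, u != 0, inZploc p u, inZploc p u^-1 & padicv p q = k%:~R].
Proof.
move=> q0; have p0 : (p%:R : rat) != 0 by rewrite pnatr_eq0 -lt0n prime_gt0.
have nq0 : numq q != 0 by rewrite numq_eq0.
have [a [ea ha]] := int_pdec nq0.
have [b [eb hb]] := int_pdec (denq_neq0 q).
set i := logn p _ in ea; set j := logn p _ in eb.
have a0 : (a%:~R : rat) != 0 by rewrite intr_eq0; apply: contraNneq ha => ->; rewrite absz0 dvdn0.
have b0 : (b%:~R : rat) != 0 by rewrite intr_eq0; apply: contraNneq hb => ->; rewrite absz0 dvdn0.
exists (i%:Z - j%:Z), (a%:~R / b%:~R); split.
- rewrite -{1}(divq_num_den q) ea eb !rmorphM /= expfzDr // -exprnP -exprnN.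
  rewrite -!natrX; set x := (p ^ i)%:R; set y := (p ^ j)%:R.
  rewrite -[(_%:Z)%:~R]/(x) -[((p ^ j)%N%:Z)%:~R]/(y).
  by field; rewrite b0 /y natrX expf_neq0.
- by rewrite mulf_neq0 ?invr_eq0.
- exact: inZploc_frac.
- by rewrite invf_div; exact: inZploc_frac.
by rewrite /padicv rmorphB.
Qed.
End Padic.

(** * Valued algebraically closed fields *)

Section ClosedValued.
Variables (p : nat) (hp : prime p) (K : closedFieldType) (v : K -> rat).
Hypothesis ext : extends_padic p v.
Let hv : is_val v := proj1 ext.

Lemma closed_root (F : {poly K}) : (1 < size F)%N -> exists x, root F x.
Proof. by move=> h; apply/closed_rootP; rewrite neq_ltn h orbT. Qed.

Lemma closed_monic_split (F : {poly K}) : F \is monic ->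
  exists s : seq K, F = \prod_(z <- s) ('X - z%:P).
Proof.
by move=> /monicP mF; have [s] := closed_field_poly_normal F; rewrite mF scale1r; exists s.
Qed.

Lemma prod_vgt (s : seq K) (f : K -> K) : {in s, forall z, vg v (f z) 0} ->
  vgt v (\prod_(z <- s) f z) 0 -> exists2 z, z \in s & vgt v (f z) 0.
Proof.
elim: s => [|z s IH] hs; first by rewrite big_nil => /(vgt1 hv).
have hs' : {in s, forall z, vg v (f z) 0} by move=> y hy; apply: hs; rewrite inE hy orbT.
have hz : vg v (f z) 0 by apply: hs; rewrite mem_head.
have hP : vg v (\prod_(y <- s) f y) 0.
  rewrite big_seq; apply: (big_ind (fun y => vg v y 0)) => //; first exact: vg1.
  by move=> a b ha hb; exact: (vgMl hv).
rewrite big_cons => /(vgt_prime hv hz hP) [] h; first by exists z; rewrite ?mem_head.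
by have [y hy hy'] := IH hs' h; exists y => //; rewrite inE hy orbT.
Qed.

(** Takes the place of Hensel's lemma: F(x) is the product of the integral elements x - z over the
    roots z of F, and a residually zero product has a residually zero factor. *)
Lemma root_of_near_root (F : {poly K}) x : F \is monic -> (forall i, vg v F`_i 0) ->
  vg v x 0 -> vgt v F.[x] 0 -> exists2 z, root F z & vgt v (x - z) 0.
Proof.
move=> mF hF hx hFx; have [s e] := closed_monic_split mF.
have rs z : z \in s -> root F z by rewrite e root_prod_XsubC.
have [z zs hz] : exists2 z, z \in s & vgt v (x - z) 0.
  apply: (@prod_vgt s (fun z => x - z)) => [z /rs hz|].
    exact: (vgB hv hx (monic_root_integral hv mF hF hz)).
  move: hFx; rewrite e horner_prod; congr (vgt v _ 0).
  by apply: eq_bigr => z _; rewrite hornerXsubC.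
by exists z => //; apply: rs.
Qed.

Lemma teichmuller_lift x q : (1 < q)%N -> vg v x 0 -> vgt v (x ^+ q - x) 0 ->
  exists t, t ^+ q = t /\ vgt v (x - t) 0.
Proof.
move=> q1 hx hq.
have sX : (size (- 'X : {poly K}) < size ('X^q : {poly K}))%N by rewrite size_polyN size_polyX size_polyXn.
have [||||z] := @root_of_near_root ('X^q - 'X) x.
- by rewrite monicE lead_coefDl // lead_coefXn.
- move=> i; rewrite coefB coefXn coefX; apply: vgB => //; exact: vg_nat.
- by [].
- by rewrite !hornerE.
by rewrite /root !hornerE subr_eq0 => /eqP hz hz'; exists z.
Qed.

Lemma min_coef (F : {poly K}) : F != 0 ->
  exists i, F`_i != 0 /\ forall j, vg v F`_j (v F`_i).
Proof.
move=> F0; have sF : (0 < size F)%N by rewrite size_poly_gt0.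
have lF : ((size F).-1 < size F)%N by rewrite ltn_predL.
pose i0 : 'I_(size F) := Ordinal lF.
have hi0 : F`_i0 != 0 by rewrite /= -lead_coefE lead_coef_eq0.
have [i hi hm] := @Order.TotalTheory.arg_minP _ rat _ i0 (fun i => F`_i != 0)
  (fun i => v F`_i) hi0.
exists i; split=> // j; have [jF|jF] := ltnP j (size F); last by left; rewrite nth_default.
have [->|h] := eqVneq F`_j 0; first by left.
by right; apply: (hm (Ordinal jF)).
Qed.

(** A fragment of the Newton polygon. A factor X - z with v z < 0 lowers the value of the constant
    coefficient by exactly -v z; every other coefficient stays strictly above the new minimum. *)
Lemma no_integral_root_coef (s : seq K) (c : K) : c != 0 ->
  {in s, forall z, z != 0 /\ v z < 0} ->
  let F := c *: \prod_(z <- s) ('X - z%:P) in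
  F`_0 != 0 /\ forall i, vgt v F`_i.+1 (v F`_0).
Proof.
move=> c0 hs F; rewrite /F {F}; elim: s hs => [|z s IH] hs.
  rewrite big_nil alg_polyC coefC eqxx; split=> // i; rewrite coefC; by left.
have hs' : {in s, forall z, z != 0 /\ v z < 0}.
  by move=> y hy; apply: hs; rewrite inE hy orbT.
have [z0 vz] : z != 0 /\ v z < 0 by apply: hs; rewrite mem_head.
have {IH} := IH hs'; rewrite big_cons scalerAr.
set G := c *: _ => -[G0 hG].
have E0 : (('X - z%:P) * G)`_0 = - (z * G`_0).
  by rewrite mulrBl coefB coefXM eqxx sub0r coefCM.
rewrite E0 oppr_eq0 mulf_eq0 (negbTE z0) (negbTE G0); split=> // i.
rewrite (val_opp hv) (val_mul hv) // mulrBl coefB coefXM coefCM /=.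
apply: (vgtB hv); last by apply: (vgtMl0 hv); [exact: z0|exact: hG].
case: i => [|i]; first by right; lra.
by apply: (vgt_le _ (hG i)); lra.
Qed.

(** If all roots had negative value, the constant coefficient would have a strictly smaller value
    than all others, so no other coefficient could be a unit. *)
Lemma exists_integral_root (F : {poly K}) i : (forall j, vg v F`_j 0) ->
  ~ vgt v F`_0 0 -> ~ vgt v F`_i.+1 0 -> exists x, vg v x 0 /\ root F x.
Proof.
move=> hF h0 hi; have [s e] := closed_field_poly_normal F.
have [[z [zs hz]]|hn] := boolp.EM (exists z, z \in s /\ vg v z 0).
  exists z; split=> //; rewrite e rootE hornerZ.
  by have : root (\prod_(z <- s) ('X - z%:P)) z; [rewrite root_prod_XsubC|move/eqP->; rewrite mulr0].
have lc0 : lead_coef F != 0.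
  by apply/negP; rewrite lead_coef_eq0 => /eqP F0; apply: h0; rewrite F0 coef0; left.
have [] := @no_integral_root_coef s _ lc0.
  move=> z zs; have h : ~ vg v z 0 by move=> h; apply: hn; exists z.
  split; first by apply/eqP => z0; apply: h; left.
  by rewrite ltNge; apply/negP => h'; apply: h; right.
rewrite -e => _ /(_ i) h; have [_ v0] := vNgt (hF 0%N) h0.
by case: hi; rewrite -v0.
Qed.

(* Otherwise, after scaling, F is residually nonconstant and vanishes residually
   on all of the valuation ring, whereas F - 1 has an integral root. *)
Lemma max_modulus (F : {poly K}) r :
  (forall u, vg v u 0 -> vg v F.[u] r) -> forall i, vg v F`_i r.
Proof.
move=> hF; have [->|F0] := eqVneq F 0; first by move=> i; rewrite coef0; left.
have [i0 [c0 hm]] := min_coef F0; set c := F`_i0 in c0 hm.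
suff h : r <= v c by move=> i; apply: vg_le h (hm i).
rewrite leNgt; apply/negP => hr.
have vci : v c^-1 = - v c.
  by apply/eqP; rewrite -addr_eq0 -(val_mul hv) ?invr_eq0 // mulVf // (val_one hv).
have hci (x : K) s : vg v x s -> vg v (c^-1 * x) (- v c + s).
  by apply: (vgM hv); right; rewrite vci.
pose G := c^-1 *: F.
have hG j : vg v G`_j 0 by rewrite coefZ -(addNr (v c)); apply: hci.
have hGu u : vg v u 0 -> vgt v G.[u] 0.
  by move=> hu; rewrite hornerZ; apply: (vg_vgt _ (hci _ _ (hF u hu))); lra.
have Gi0 : G`_i0 = 1 by rewrite coefZ mulVf.
have G0 : vgt v G`_0 0 by rewrite -horner_coef0; apply: hGu; left.
case: i0 @c c0 hm hr vci hci @G hG hGu Gi0 G0 => [|i] c c0 hm hr vci hci G hG hGu Gi0 G0.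
  by apply: (vgt1 hv); rewrite -Gi0.
have [|||u [hu]] := @exists_integral_root (G - 1) i.
- by move=> j; rewrite coefB coef1; apply: (vgB hv) => //; exact: vg_nat.
- rewrite coefB coef1 eqxx /= => h; apply: (vgt1 hv).
  by have := vgtB hv G0 h; rewrite opprB addrC subrK.
- by rewrite coefB coef1 subr0 Gi0; exact: (vgt1 hv).
rewrite rootE !hornerE subr_eq0 => /eqP h; apply: (vgt1 hv).
by rewrite -h -hornerZ; apply: hGu.
Qed.

Lemma ratr_K_rmorphism : exists phi : {rmorphism rat -> K}, forall q, phi q = ratr q.
Proof. by apply: ratr_rmorphism => n n0; have [] := ext.2 n n0. Qed.

Lemma algQ_primitive_root (y : K) : algQ y -> exists F : {poly int},
  [/\ F != 0, forall a : int, (forall i, (a %| F`_i)%Z) -> (a %| 1)%Z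
    & root (map_poly intr F) y].
Proof.
have [phi ephi] := ratr_K_rmorphism; case=> f [f0].
rewrite -(eq_map_poly ephi) => ry; have [c [F [c0 e F0 hF]]] := primitive_int_poly f0.
exists F; split=> //; move: ry; rewrite e map_polyZ -map_poly_comp.
rewrite (eq_map_poly (g := intr)); last by move=> n /=; rewrite rmorph_int.
by rewrite rootZ // fmorph_eq0.
Qed.

Lemma int_Fp_eq0 (n : int) : (n%:~R == 0 :> 'F_p) = (p %| absz n)%N.
Proof.
rewrite (dvdn_pcharf (pchar_Fp hp)); case: n => n //.
by rewrite NegzE mulrNz oppr_eq0.
Qed.

(* Powers of y are eventually periodic modulo the maximal ideal, since the powers
   of X are so modulo the reduction of F to the finite field 'F_p. *)
Lemma powers_periodic (F : {poly int}) (y : K) : vg v y 0 -> root (map_poly intr F) y ->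
  (forall a : int, (forall i, (a %| F`_i)%Z) -> (a %| 1)%Z) ->
  exists k e, (0 < e)%N /\ vgt v (y ^+ (k + e) - y ^+ k) 0.
Proof.
move=> hy ry hF; pose red := map_poly (intr : int -> 'F_p).
have redE (H : {poly int}) : red H = 0 -> vgt v (map_poly intr H).[y] 0.
  move=> H0; apply: (vgt_horner hv) => // i; rewrite coef_map; apply/(vgt_int hp ext).
  have : (red H)`_i = 0 by rewrite H0 coef0.
  by rewrite coef_map -int_Fp_eq0 /= => ->.
have g0 : red F != 0.
  apply/eqP => h; have /hF : forall i, (p%:Z %| F`_i)%Z.
    move=> i; have : (red F)`_i = 0 by rewrite h coef0.
    by rewrite dvdzE absz_nat coef_map -int_Fp_eq0 /= => ->.
  by rewrite dvdzE !absz_nat dvdn1 => /eqP p1; move: hp; rewrite p1.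
set g := red F in g0; set d := size g.
pose N := #|{: 'rV['F_p]_d}|.
pose f (k : 'I_N.+1) : 'rV['F_p]_d := poly_rV ('X^k %% g).
have /injectivePn [k [l kl efkl]] : ~~ injectiveb f.
  apply/negP => /injectiveP /leq_card; rewrite card_ord; by rewrite ltnn.
wlog kl' : k l kl efkl / (k < l)%N.
  move=> H; have [h|h|h] := ltngtP k l; first exact: (H k l).
    by apply: (H l k) => //; rewrite eq_sym.
  by move: kl; rewrite (val_inj h) eqxx.
have dvd : g %| 'X^l - 'X^k.
  apply/modp_eq0P; rewrite modpD modpN; apply/eqP; rewrite subr_eq0; apply/eqP.
  have sz (i : 'I_N.+1) : (size ('X^i %% g)%R <= d)%N by rewrite ltnW // ltn_modp.
  by rewrite -(poly_rV_K (sz l)) -(poly_rV_K (sz k)) -/(f l) -/(f k) efkl.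
have lift (u : {poly 'F_p}) : exists U : {poly int}, red U = u.
  exists (map_poly (fun a : 'F_p => (nat_of_ord a)%:Z) u).
  by apply/polyP => i; rewrite /red coef_map coef_map_id0 //= -pmulrn natr_Zp.
have /dvdpP [u eu] := dvd; have [U eU] := lift u.
exists k, (l - k)%N; split; first by rewrite subn_gt0.
rewrite subnKC ?(ltnW kl') //.
have := redE ('X^l - 'X^k - U * F); rewrite /red !rmorphB !rmorphM /= !map_polyXn.
rewrite -/(red U) -/(red F) eU -/g eu subrr => /(_ erefl).
by rewrite !hornerE (eqP ry) mulr0 subr0; apply.
Qed.

(** By density the residues of C_p are those of algebraic numbers y. The powers of y are residually
    periodic, and the period is converted into a power of p that fixes the residue. *)
Lemma residue_finite (z : K) : (forall x n, exists y : K, algQ y /\ vg v (x - y) n) ->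
  vg v z 0 -> exists m, (0 < m)%N /\ vgt v (z ^+ (p ^ m) - z) 0.
Proof.
move=> dense hz; have [y [ay hzy]] := dense z 1.
have hzy' : vgt v (z - y) 0 by apply: vg_vgt hzy.
have hy : vg v y 0 by apply: (vg_cong hv _ hz); apply: (vgBC hv); exact: vgtW.
suff [m [m0 hm]] : exists m, (0 < m)%N /\ vgt v (y ^+ (p ^ m) - y) 0.
  exists m; split=> //; apply: (vgt_trans hv) (vgtBC hv hzy').
  apply: (vgt_trans hv) hm; rewrite subrXX; apply: (vgtMr hv hzy').
  by apply: (vg_sum hv) => i _; apply: (vgMl hv); apply: (vgX hv).
have [F [F0 hF ry]] := algQ_primitive_root ay.
have [k [e [e0 he]]] := powers_periodic hy ry hF.
have [hy0|hy0] := boolp.EM (vgt v y 0).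
  exists 1%N; split=> //; apply: (vgtB hv) => //; apply: (vgtX hv) => //.
  by rewrite expn_gt0 prime_gt0.
have [y0 vy] := vNgt hy hy0.
have ye1 : vgt v (y ^+ e - 1) 0.
  move: he; rewrite exprD -{2}[y ^+ k]mulr1 -mulrBr => /(vgt_prime hv) [||h|//].
  - exact: (vgX hv).
  - by apply: (vgB hv); [exact: (vgX hv)|exact: (vg1 hv)].
  by case: hy0; exact: (vgt_primeX hv hy h).
have [e' pe' ee] := pfactor_coprime hp e0; set s := logn p e in ee.
have e'0 : (0 < e')%N by move: e0; rewrite ee muln_gt0 => /andP[].
have yM c : vgt v (y ^+ (e * c) - 1) 0.
  rewrite exprM; elim: c => [|c IH]; first by rewrite expr0 subrr; left.
  rewrite exprS; apply: (vgt_trans hv (y := y ^+ e)); last exact: ye1.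
  rewrite -{3}[y ^+ e]mulr1 -mulrBr; apply: (vgtMl hv) IH; exact: (vgX hv).
(* Write e = e' p^s with e' prime to p. Euler's theorem gives
   [p ^ (s + totient e') = p ^ s + e * c], and y^e is residually 1. So [y ^+ (p ^ totient e') - y]
   is killed residually by its [p ^ s]-th power, hence is residually zero. *)
exists (totient e'); split; first by rewrite totient_gt0.
apply: (vgt_primeX hv (n := p ^ s)).
  by apply: (vgB hv) => //; apply: (vgX hv).
have hq : vg v (y ^+ (p ^ totient e')) 0 by apply: (vgX hv).
apply: (vgt_cong hv (vg_frobenius hp ext s hq hy)).
rewrite -exprM -expnD addnC.
have /eqP := cyclic.Euler_exp_totient pe'; rewrite eqn_mod_dvd; last by rewrite expn_gt0 prime_gt0.
move=> /dvdnP [c ec].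
have -> : (p ^ (s + totient e') = p ^ s + e * c)%N.
  rewrite expnD ee -[(p ^ totient e')%N](@subnK 1) ?expn_gt0 ?prime_gt0 // ec; lia.
rewrite exprD -{2}[y ^+ (p ^ s)]mulr1 -mulrBr; apply: (vgtMl hv) (yM c).
exact: (vgX hv).
Qed.

End ClosedValued.

(** * Embedding residue rings *)

(** Quotient and remainder must keep their coefficients in P, and A will be the product D * K, which
    has zero divisors; a monic divisor makes both possible. *)
Lemma div_monic (A : comNzRingType) (P : A -> Prop) (hP : subring_pred P) (F M : {poly A}) :
  polyP_in P F -> polyP_in P M -> M \is monic ->
  exists U S, [/\ polyP_in P U, polyP_in P S, F = U * M + S & (size S < size M)%N].
Proof.
move=> + hM mM; have [n] := ubnP (size F); elim: n F => // n IH F hn hF.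
have [h|h] := ltnP (size F) (size M).
  exists 0, F; split=> //; last by rewrite mul0r add0r.
  by move=> i; rewrite coef0; exact: sr0.
have sM : (0 < size M)%N by rewrite size_poly_gt0 monic_neq0.
pose Q := (lead_coef F)%:P * 'X^(size F - size M).
have hQ : polyP_in P Q.
  by apply: srpM => //; [apply: srpC => //; apply: hF|exact: srpXn].
have [||U [S [hU hS e sS]]] := IH (F - Q * M).
- apply: leq_trans (_ : (size F).-1.+1 <= n)%N; last by rewrite prednK //; exact: leq_trans h.
  rewrite ltnS; apply/leq_sizeP => j hj; rewrite coefB -mulrA coefCM coefXnM.
  case: ltnP => hj'; first by rewrite mulr0 subr0 nth_default //; lia.
  have [e|ne] := eqVneq j (size F).-1; last first.
    have hj1 : (size F <= j)%N by lia.
    have hj2 : (size M <= j - (size F - size M))%N by lia.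
    by rewrite (nth_default _ hj1) (nth_default _ hj2) mulr0 subr0.
  have -> : (j - (size F - size M) = (size M).-1)%N by lia.
  by rewrite e -!lead_coefE (monicP mM) mulr1 subrr.
- by apply: srpB => //; apply: srpM.
exists (U + Q), S; split=> //; first by apply: srpD.
by rewrite mulrDl addrAC -e subrK.
Qed.

Section Correspondence.
Variables (p : nat) (hp : prime p).
Variables (D : idomainType) (w : D -> rat) (extw : extends_padic p w).
Variables (K : closedFieldType) (v : K -> rat) (extv : extends_padic p v).
Hypothesis resfin : forall z, vg v z 0 -> exists m, (0 < m)%N /\ vgt v (z ^+ (p ^ m) - z) 0.
Let hw : is_val w := proj1 extw.
Let hv : is_val v := proj1 extv.

Notation B := (D * K)%type.
Implicit Types (G : B -> Prop) (a b : B) (F H : {poly B}).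

Definition integral2 b := vg w b.1 0 /\ vg v b.2 0.
Definition small2 b := vgt w b.1 0 /\ vgt v b.2 0.

(* Graph of an isomorphism between a subring of the residue ring of w and a
   subring of the residue field of v. *)
Definition residue_graph G : Prop :=
  [/\ subring_pred G, forall a, G a -> integral2 a,
      forall a b, G a -> small2 (a - b) -> G b
    & forall a, G a -> (vgt w a.1 0 <-> vgt v a.2 0)].

Definition ev1 F x : D := (map_poly fst F).[x].
Definition ev2 F t : K := (map_poly snd F).[t].

Lemma horner_pair1 F x t : (F.[(x, t)]).1 = ev1 F x.
Proof. by rewrite /ev1 -[x in RHS]/((x, t).1) horner_map. Qed.
Lemma horner_pair2 F x t : (F.[(x, t)]).2 = ev2 F t.
Proof. by rewrite /ev2 -[t in RHS]/((x, t).2) horner_map. Qed.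

Lemma ev1B F H x : ev1 (F - H) x = ev1 F x - ev1 H x.
Proof. by rewrite /ev1 rmorphB hornerD hornerN. Qed.
Lemma ev1D F H x : ev1 (F + H) x = ev1 F x + ev1 H x.
Proof. by rewrite /ev1 rmorphD hornerD. Qed.
Lemma ev1M F H x : ev1 (F * H) x = ev1 F x * ev1 H x.
Proof. by rewrite /ev1 rmorphM hornerM. Qed.
Lemma ev1C b x : ev1 b%:P x = b.1.
Proof. by rewrite /ev1 map_polyC hornerC. Qed.
Lemma ev2B F H t : ev2 (F - H) t = ev2 F t - ev2 H t.
Proof. by rewrite /ev2 rmorphB hornerD hornerN. Qed.
Lemma ev2D F H t : ev2 (F + H) t = ev2 F t + ev2 H t.
Proof. by rewrite /ev2 rmorphD hornerD. Qed.
Lemma ev2M F H t : ev2 (F * H) t = ev2 F t * ev2 H t.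
Proof. by rewrite /ev2 rmorphM hornerM. Qed.
Lemma ev2C b t : ev2 b%:P t = b.2.
Proof. by rewrite /ev2 map_polyC hornerC. Qed.

Section Graph.
Variables (G : B -> Prop) (hG : residue_graph G).
Let sG : subring_pred G := let: And4 h _ _ _ := hG in h.
Let iG a : G a -> integral2 a. Proof. by case: hG => _ h _ _; apply: h. Qed.
Let cG a b : G a -> small2 (a - b) -> G b. Proof. by case: hG => _ _ h _; apply: h. Qed.
Let rG a : G a -> (vgt w a.1 0 <-> vgt v a.2 0). Proof. by case: hG => _ _ _ h; apply: h. Qed.

Lemma ev1_int F x : polyP_in G F -> vg w x 0 -> vg w (ev1 F x) 0.
Proof. by move=> hF; apply: vg_horner => // i; rewrite coef_map; apply: (iG (hF i)).1. Qed.
Lemma ev2_int F t : polyP_in G F -> vg v t 0 -> vg v (ev2 F t) 0.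
Proof. by move=> hF; apply: vg_horner => // i; rewrite coef_map; apply: (iG (hF i)).2. Qed.
Lemma ev1_small F x : (forall i, small2 F`_i) -> vg w x 0 -> vgt w (ev1 F x) 0.
Proof. by move=> hF; apply: vgt_horner => // i; rewrite coef_map; apply: (hF i).1. Qed.
Lemma ev2_small F t : (forall i, small2 F`_i) -> vg v t 0 -> vgt v (ev2 F t) 0.
Proof. by move=> hF; apply: vgt_horner => // i; rewrite coef_map; apply: (hF i).2. Qed.

Lemma graph_small a : G a -> vgt w a.1 0 -> small2 a.
Proof. by move=> ha h; split=> //; apply/(rG ha). Qed.

Lemma graph_frobenius a : G a -> exists m, (0 < m)%N /\ small2 (a ^+ (p ^ m) - a).
Proof.
move=> ha; have [m [m0 hm]] := resfin (iG ha).2; exists m; split=> //.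
have hG' : G (a ^+ (p ^ m) - a) by apply: srB => //; apply: srX.
have h2 : vgt v (a ^+ (p ^ m) - a).2 0 by rewrite /= -[snd _]/(snd (a ^+ _)) rmorphXn.
by split=> //; apply/(rG hG').
Qed.

(** As in a finite field: a^q = a holds residually for some power q of p, so that a^(q-2) is an
    inverse. The subring described by G is thus a field, although Q[X] has few units. *)
Lemma graph_inv a : G a -> ~ vgt w a.1 0 -> exists b, G b /\ small2 (1 - b * a).
Proof.
move=> ha na; have [m [m0 [h1 h2]]] := graph_frobenius ha.
have q1 : (1 < p ^ m)%N by rewrite -{1}(expn0 p) ltn_exp2l // prime_gt1.
exists (a ^+ (p ^ m - 2)); split; first exact: srX.
have hb : G (1 - a ^+ (p ^ m - 2) * a).
  by apply: srB => //; [exact: sr1|apply: srM => //; exact: srX].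
apply: (graph_small hb); have /(vgt_prime hw (iG ha).1) [|//|//] :
  vgt w (a.1 * (1 - a ^+ (p ^ m - 2) * a).1) 0; last exact: (iG hb).1.
have e : a * (1 - a ^+ (p ^ m - 2) * a) = - (a ^+ (p ^ m) - a).
  have {2}-> : (p ^ m = (p ^ m - 2).+2)%N by lia.
  by rewrite !exprS; ring.
rewrite -[X in vgt w X]/((a * (1 - a ^+ (p ^ m - 2) * a)).1) e.
exact: (vgtN hw).
Qed.

(* Dividing by the last residually nonzero coefficient. *)
Lemma monicize F : polyP_in G F -> ~ (forall i, vgt w (F`_i).1 0) ->
  exists M b, [/\ polyP_in G M, M \is monic, (size M <= size F)%N,
     G b /\ ~ vgt w b.1 0 & forall i, small2 (M - b%:P * F)`_i].
Proof.
move=> hF nF.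
have [d [hd md]] : exists d, ~ vgt w (F`_d).1 0 /\ forall i, (d < i)%N -> vgt w (F`_i).1 0.
  have [|n [hn mn]] := @classic_min (fun n => forall i, (n <= i)%N -> vgt w (F`_i).1 0).
    by exists (size F) => i hi; rewrite nth_default //; left.
  case: n hn mn => [|n] hn mn; first by case: nF => i; apply: hn.
  exists n; split=> // h; apply: (mn n) => // i; rewrite leq_eqVlt => /predU1P [<- //|].
  exact: hn.
have [b [hb sb]] := graph_inv (hF d) hd.
have dF : (d < size F)%N.
  by rewrite ltnNge; apply/negP => h; apply: hd; rewrite nth_default //; left.
pose L := \poly_(i < d) (b * F`_i); have sL : (size L < size ('X^d : {poly B}))%N.
  by rewrite size_polyXn ltnS size_poly.
exists ('X^d + L), b; split=> //.
- apply: srpD => //; first exact: srpXn.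
  by move=> i; rewrite coef_poly; case: ifP => _; [apply: srM|apply: sr0].
- by rewrite monicE lead_coefDl // lead_coefXn.
- by rewrite size_polyDl // size_polyXn.
- split=> // h; apply: (vgt1 hw).
  have := vgtD hw sb.1 (vgtMr hw h (iG (hF d)).1).
  by rewrite -[_ + _]/((1 - b * F`_d + b * F`_d).1) subrK.
move=> i; rewrite coefB coefD coefXn coefCM coef_poly.
have [h|h|->] := ltngtP i d.
- by rewrite add0r subrr; split; left.
- rewrite addr0 sub0r.
  have hi : G (- (b * F`_i)) by apply: srN => //; apply: srM.
  apply: (graph_small hi); apply: (vgtN hw); apply: (vgtMl hw (iG hb).1); exact: md.
by rewrite addr0.
Qed.

(** F witnesses that the residue of x is algebraic over the subring described by G. *)
Definition residual_relation x F :=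
  [/\ polyP_in G F, ~ (forall i, vgt w (F`_i).1 0) & vgt w (ev1 F x) 0].

(** Small errors are allowed in order to keep the extended graph saturated under residual
    congruence. *)
Definition adjoin x t b := exists H, polyP_in G H /\ small2 (H.[(x, t)] - b).

Lemma small2B a b : small2 a -> small2 b -> small2 (a - b).
Proof. by move=> [h1 h2] [h3 h4]; split; [apply: (vgtB hw)|apply: (vgtB hv)]. Qed.
Lemma small2N a : small2 a -> small2 (- a).
Proof. by move=> [h1 h2]; split; [apply: (vgtN hw)|apply: (vgtN hv)]. Qed.
Lemma small2D a b : small2 a -> small2 b -> small2 (a + b).
Proof. by move=> h1 /small2N h2; rewrite -[b]opprK; apply: small2B. Qed.
Lemma small2M a b : integral2 a -> small2 b -> small2 (a * b).
Proof. by move=> [h1 h2] [h3 h4]; split; [apply: (vgtMl hw)|apply: (vgtMl hv)]. Qed.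
Lemma small2_0 : small2 0. Proof. by split; left. Qed.

Lemma adjoin_const x t b : G b -> adjoin x t b.
Proof.
move=> hb; exists b%:P; split; first exact: srpC.
by rewrite hornerC subrr; exact: small2_0.
Qed.

Lemma adjoin_gen x t : adjoin x t (x, t).
Proof.
by exists 'X; split; [exact: srpX|rewrite hornerX subrr; exact: small2_0].
Qed.

Lemma integral2_adjoin x t b : vg w x 0 -> vg v t 0 -> adjoin x t b -> integral2 b.
Proof.
move=> hx ht [H [hH [h1 h2]]]; split.
  apply: (vg_cong hw (vgtW (vgtBC hw h1))).
  by rewrite horner_pair1; apply: ev1_int.
apply: (vg_cong hv (vgtW (vgtBC hv h2))).
by rewrite horner_pair2; apply: ev2_int.
Qed.

(** Equality of the residual kernels of the two evaluations makes the extended correspondence well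
    defined in one direction and injective in the other. *)
Lemma adjoin_graph x t : vg w x 0 -> vg v t 0 ->
  (forall H, polyP_in G H -> (vgt w (ev1 H x) 0 <-> vgt v (ev2 H t) 0)) ->
  residue_graph (adjoin x t).
Proof.
move=> hx ht hr; split.
- split; first by apply: adjoin_const; apply: sr1.
    move=> a b [H1 [h1 s1]] [H2 [h2 s2]]; exists (H1 - H2); split; first exact: srpB.
    rewrite hornerD hornerN.
    have -> : H1.[(x, t)] - H2.[(x, t)] - (a - b) =
      (H1.[(x, t)] - a) - (H2.[(x, t)] - b) by ring.
    exact: small2B.
  move=> a b ha hb; have [_ ib] := (integral2_adjoin hx ht ha, integral2_adjoin hx ht hb).
  case: ha hb => [H1 [h1 s1]] [H2 [h2 s2]]; exists (H1 * H2); split; first exact: srpM.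
  rewrite hornerM.
  have -> : H1.[(x, t)] * H2.[(x, t)] - a * b =
     H1.[(x, t)] * (H2.[(x, t)] - b) + b * (H1.[(x, t)] - a) by ring.
  apply: small2D; apply: small2M => //; split; rewrite ?horner_pair1 ?horner_pair2.
    exact: ev1_int.
  exact: ev2_int.
- by move=> a; apply: integral2_adjoin.
- move=> a b [H [hH s]] s'; exists H; split=> //.
  by have := small2D s s'; rewrite addrA subrK.
move=> a [H [hH [s1 s2]]]; rewrite /= in s1 s2.
have e1 : vgt w a.1 0 <-> vgt w (ev1 H x) 0.
  rewrite -(horner_pair1 H x t); split; first exact: (vgt_cong hw).
  by apply: (vgt_cong hw); apply: (vgtBC hw).
have e2 : vgt v a.2 0 <-> vgt v (ev2 H t) 0.
  rewrite -(horner_pair2 H x t); split; first exact: (vgt_cong hv).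
  by apply: (vgt_cong hv); apply: (vgtBC hv).
by rewrite e1 e2; apply: hr.
Qed.

Lemma residual_monicize1 F M b x : vg w x 0 -> (forall i, small2 (M - b%:P * F)`_i) ->
  vgt w (ev1 M x - b.1 * ev1 F x) 0.
Proof. by move=> hx /ev1_small /(_ hx); rewrite ev1B ev1M ev1C. Qed.
Lemma residual_monicize2 F M b t : vg v t 0 -> (forall i, small2 (M - b%:P * F)`_i) ->
  vgt v (ev2 M t - b.2 * ev2 F t) 0.
Proof. by move=> ht /ev2_small /(_ ht); rewrite ev2B ev2M ev2C. Qed.

(* Take a residual monic relation of minimal degree satisfied by x, and let t be a root
   in K of its second component: both components then have the same residual kernel. *)
Lemma graph_extend x F : vg w x 0 -> residual_relation x F ->
  exists t, vg v t 0 /\ residue_graph (adjoin x t).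
Proof.
move=> hx rF.
have [|d [[P [hP nP zP] sP] md]] := @classic_min (fun n => exists2 F, residual_relation x F & size F = n).
  by exists (size F), F.
have {}md H : residual_relation x H -> (d <= size H)%N.
  by move=> h; rewrite leqNgt; apply/negP => /md; apply; exists H.
have [M [b [hM mM sM [hb nb] small]]] := monicize hP nP.
have zM : vgt w (ev1 M x) 0.
  apply: (vgt_cong hw (residual_monicize1 hx small)).
  by apply: (vgtMl hw (iG hb).1).
have monicN H : H \is monic -> ~ (forall i, vgt w (H`_i).1 0).
  by move=> /monicP mH /(_ (size H).-1); rewrite -lead_coefE mH => /(vgt1 hw).
have sMd : size M = d.
  apply/eqP; rewrite eqn_leq -{1}sP sM /=; apply: md; split=> //; exact: monicN.
have mM2 : map_poly snd M \is monic by exact: monic_map.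
have sM2 : size (map_poly snd M) = d by rewrite size_map_poly_id0 // (monicP mM) oner_eq0.
have d1 : (1 < d)%N.
  rewrite -sMd ltn_neqAle size_poly_gt0 monic_neq0 // andbT eq_sym.
  apply/negP => /size_poly1P [c _ ec].
  have c1 : c = 1 by rewrite -(monicP mM) ec lead_coefC.
  by move: zM; rewrite ec c1 ev1C => /(vgt1 hw).
have [t rt] : exists t, root (map_poly snd M) t by apply: closed_root; rewrite sM2.
have ht : vg v t 0.
  by apply: (monic_root_integral hv mM2 _ rt) => i; rewrite coef_map; apply: (iG (hM i)).2.
have zM2 : ev2 M t = 0 by apply/eqP.
have small_coefs H : polyP_in G H -> (size H < d)%N -> vgt w (ev1 H x) 0 ->
    forall i, small2 H`_i.
  move=> hH sH zH i; apply: (graph_small (hH i)); apply: boolp.contrapT => ni.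
  have : residual_relation x H by split=> // h; apply: ni.
  by move/md; rewrite leqNgt sH.
exists t; split=> //; apply: adjoin_graph => // H hH; split.
  move=> zH; have [U [S [hU hS e sS]]] := div_monic sG hH hM mM.
  rewrite e ev2D ev2M zM2 mulr0 add0r; apply: ev2_small => //.
  apply: small_coefs; rewrite -?sMd //.
  have := vgtB hw zH (vgtMl hw (ev1_int hU hx) zM).
  by rewrite {1}e ev1D ev1M addrAC subrr add0r.
(* Conversely, let Q of least size n kill t residually but not x; division by M gives n < d. Make Q
   monic as N and write M = U N + S. Then S kills t and is shorter than Q, so it kills x; since N
   does not kill x, U does. But U is monic and shorter than M, against the choice of d. *)
move=> zH; apply: boolp.contrapT => nzH.
have [|n [[Q [hQ zQ nzQ] sQ] mn]] := @classic_min (fun n => exists2 H,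
    [/\ polyP_in G H, vgt v (ev2 H t) 0 & ~ vgt w (ev1 H x) 0] & size H = n).
  by exists (size H), H.
have {}mn C : polyP_in G C -> vgt v (ev2 C t) 0 -> (size C < n)%N -> vgt w (ev1 C x) 0.
  by move=> h1 h2 h3; apply: boolp.contrapT => h4; apply: (mn _ h3); exists C.
have sQd : (n < d)%N.
  rewrite ltnNge; apply/negP => hnd.
  have [U [S [hU hS e sS]]] := div_monic sG hQ hM mM.
  apply: nzQ; rewrite e ev1D ev1M; apply: (vgtD hw).
    by apply: (vgtMl hw) zM; exact: ev1_int.
  apply: mn => //; last by apply: leq_trans sS _; rewrite sMd.
  by move: zQ; rewrite e ev2D ev2M zM2 mulr0 add0r.
have nQ : ~ (forall i, vgt w (Q`_i).1 0).
  move=> h; apply: nzQ; apply: ev1_small => // i; exact: (graph_small (hQ i)).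
have [N [c [hN mN sN [hc nc] smallN]]] := monicize hQ nQ.
have zN : vgt v (ev2 N t) 0.
  apply: (vgt_cong hv (residual_monicize2 ht smallN)).
  by apply: (vgtMl hv (iG hc).2).
have nzN : ~ vgt w (ev1 N x) 0.
  move=> h; have := vgt_cong hw (vgtBC hw (residual_monicize1 hx smallN)) h.
  by case/(vgt_prime hw (iG hc).1 (ev1_int hQ hx)).
have [U [S [hU hS e sS]]] := div_monic sG hM hN mN.
have zS : vgt w (ev1 S x) 0.
  apply: mn => //; last by rewrite -sQ; exact: leq_trans sS sN.
  have := vgtMl hv (ev2_int hU ht) zN.
  have : ev2 M t = ev2 U t * ev2 N t + ev2 S t by rewrite e ev2D ev2M.
  rewrite zM2 => /esym/eqP; rewrite addrC addr_eq0 => /eqP -> h; exact: (vgtN hv).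
have zU : vgt w (ev1 U x) 0.
  have : vgt w (ev1 U x * ev1 N x) 0.
    by have := vgtB hw zM zS; rewrite {1}e ev1D ev1M addrK.
  by case/(vgt_prime hw (ev1_int hU hx) (ev1_int hN hx)).
have sN1 : (1 < size N)%N.
  rewrite ltn_neqAle size_poly_gt0 monic_neq0 // andbT eq_sym.
  apply/negP => /size_poly1P [k _ ek].
  have k1 : k = 1 by rewrite -(monicP mN) ek lead_coefC.
  by move: zN; rewrite ek k1 ev2C => /(vgt1 hv).
have U0 : U != 0.
  apply: contraTneq (leqnn (size M)) => U0; rewrite -ltnNge {1}e U0 mul0r add0r.
  by rewrite (leq_trans sS) // (leq_trans sN) // sQ sMd ltnW.
have sUN : (size (U * N)%R = (size U + size N).-1)%N by rewrite size_Mmonic.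
have U0' : (0 < size U)%N by rewrite size_poly_gt0.
have sSU : (size S < size (U * N)%R)%N by rewrite sUN; lia.
have mU : U \is monic.
  by move: mM; rewrite e !monicE lead_coefDl // lead_coef_Mmonic.
have : residual_relation x U by split=> //; exact: monicN.
move/md; rewrite leqNgt; case/negP.
by rewrite -sMd e size_polyDl // sUN ltn_predRL -addn1 ltn_add2l.
Qed.
End Graph.
End Correspondence.

Section Maximal.
Variables (p : nat) (hp : prime p).
Variables (D : idomainType) (w : D -> rat) (extw : extends_padic p w).
Variables (K : closedFieldType) (v : K -> rat) (extv : extends_padic p v).
Hypothesis resfin : forall z, vg v z 0 -> exists m, (0 < m)%N /\ vgt v (z ^+ (p ^ m) - z) 0.
Let hw : is_val w := proj1 extw.
Let hv : is_val v := proj1 extv.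
Notation B := (D * K)%type.

(** The identity of the prime field F_p: on either side an integer is residually zero exactly when p
    divides it. It excludes that the maximal graph is empty. *)
Lemma prime_graph : residue_graph w v (fun b => exists n : int, small2 w v (b - n%:~R)).
Proof.
have i1 (n : int) : (n%:~R : B).1 = n%:~R by rewrite -[LHS]/(fst _) rmorph_int.
have i2 (n : int) : (n%:~R : B).2 = n%:~R by rewrite -[LHS]/(snd _) rmorph_int.
have si (n : int) : integral2 w v n%:~R.
  by split; rewrite ?i1 ?i2; [exact: (vg_int hw)|exact: (vg_int hv)].
have int a (n : int) : small2 w v (a - n%:~R) -> integral2 w v a.
  move=> [s1 s2]; split.
    exact: (vg_cong hw (vgtW s1) (si n).1).
  exact: (vg_cong hv (vgtW s2) (si n).2).
split.
- split; first by exists 1; rewrite subrr; exact: small2_0.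
    move=> a b [m sm] [n sn]; exists (m - n).
    have -> : a - b - (m - n)%:~R = (a - m%:~R) - (b - n%:~R) by rewrite rmorphB; ring.
    exact: (small2B extw extv).
  move=> a b [m sm] [n sn]; exists (m * n).
  have -> : a * b - (m * n)%:~R = a * (b - n%:~R) + n%:~R * (a - m%:~R).
    by rewrite rmorphM; ring.
  apply: (small2D extw extv); apply: (small2M extw extv) => //; exact: int sm.
- by move=> a [n /int].
- move=> a b [n sn] sab; exists n.
  have -> : b - n%:~R = (a - n%:~R) - (a - b) by ring.
  exact: (small2B extw extv).
move=> a [n [s1 s2]].
have e1 : vgt w a.1 0 <-> vgt w (n%:~R : D) 0.
  rewrite -i1; split; last exact: (vgt_cong hw).
  by apply: (vgt_cong hw); apply: (vgtBC hw).
have e2 : vgt v a.2 0 <-> vgt v (n%:~R : K) 0.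
  rewrite -i2; split; last exact: (vgt_cong hv).
  by apply: (vgt_cong hv); apply: (vgtBC hv).
by rewrite e1 e2 (vgt_int hp extw) (vgt_int hp extv).
Qed.

Lemma maximal_graph : exists G : B -> Prop, residue_graph w v G /\
  forall x F, vg w x 0 -> residual_relation w G x F -> exists t, G (x, t).
Proof.
(* The empty set must satisfy P, because it is the union of the empty chain. *)
pose P (A : classical_sets.set B) := (exists b, A b) -> residue_graph w v A.
have [F FP Ftot|G [PG mG]] := @classical_sets.Zorn_bigcup B P.
  move=> [b0 [A0 FA0 A0b0]].
  have good A b : F A -> A b -> residue_graph w v A by move=> FA Ab; apply: (FP A FA); exists b.
  split.
  - split.
    + by exists A0 => //; case: (good _ _ FA0 A0b0) => -[].
    + move=> a b [A FA Aa] [C FC Cb]; case: (Ftot A C FA FC) => AC.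
        by exists C => //; case: (good _ _ FC Cb) => -[_ h _] _ _ _; apply: h => //; apply: AC.
      by exists A => //; case: (good _ _ FA Aa) => -[_ h _] _ _ _; apply: h => //; apply: AC.
    move=> a b [A FA Aa] [C FC Cb]; case: (Ftot A C FA FC) => AC.
      by exists C => //; case: (good _ _ FC Cb) => -[_ _ h] _ _ _; apply: h => //; apply: AC.
    by exists A => //; case: (good _ _ FA Aa) => -[_ _ h] _ _ _; apply: h => //; apply: AC.
  - by move=> a [A FA Aa]; case: (good _ _ FA Aa) => _ h _ _; apply: h.
  - move=> a b [A FA Aa] s; exists A => //.
    by case: (good _ _ FA Aa) => _ _ h _; apply: h s.
  by move=> a [A FA Aa]; case: (good _ _ FA Aa) => _ _ _; apply.
have ne : exists b, G b.
  apply: boolp.contrapT => hne; apply: (mG _ _ (fun _ => prime_graph)); split.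
    by move=> b Gb; case: hne; exists b.
  move=> h; apply: hne; exists 1; apply: h; exists 1; rewrite subrr; exact: small2_0.
have hG := PG ne; exists G; split=> // x F hx rF.
have [t [ht hadj]] := graph_extend hp extw extv resfin hG hx rF.
exists t; apply: boolp.contrapT => nt; apply: (mG _ _ (fun _ => hadj)); split.
  by move=> b; apply: adjoin_const.
by move=> h; apply: nt; apply: h; exact: adjoin_gen.
Qed.
End Maximal.

(** * Teichmueller expansions *)

Section FrobStep.
Variables (p : nat) (hp : prime p) (D : idomainType) (w : D -> rat).
Hypothesis ext : extends_padic p w.
Let hw : is_val w := proj1 ext.

Lemma frobenius_unit x q : (1 < q)%N -> vgt w x 0 ->
  vg w (1 - x ^+ q.-1) 0 /\ ~ vgt w (1 - x ^+ q.-1) 0.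
Proof.
move=> q1 hx; have hxq : vgt w (x ^+ q.-1) 0 by apply: (vgtX hw) => //; lia.
split; first by apply: (vgB hw); [exact: (vg1 hw)|exact: vgtW].
by move=> h; apply: (vgt1 hw); have := vgtD hw h hxq; rewrite subrK.
Qed.

(* x - x ^+ q is the product of x and a unit. *)
Lemma frobenius_step x r q n : (1 < q)%N -> vgt w x 0 ->
  vg w (x - x ^+ q - p%:R * r) n.+1%:R -> (vg w x n.+1%:R <-> vg w r n%:R).
Proof.
move=> q1 hx hj; have [hu nu] := frobenius_unit q1 hx.
have e : (1 - x ^+ q.-1) * x = x - x ^+ q.
  by rewrite mulrBl mul1r -exprSr prednK //; lia.
split=> h.
  apply: (vg_pdiv hp ext); rewrite nat1r.
  apply: (vg_cong hw (vgBC hw hj)); rewrite -e; exact: (vgMl hw).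
apply: (vg_unitM hw hu nu); rewrite e; apply: (vg_cong hw hj).
by rewrite -nat1r; apply: (vg_pM hp ext).
Qed.

(** Each p-th power gains a factor p: the cofactor of a - b in a^p - b^p is congruent to p b^(p-1)
    modulo a - b, hence divisible by p. *)
Lemma vg_frobenius_lift a b k : vg w a 0 -> vg w b 0 -> vg w (a - b) 1 ->
  vg w (a ^+ (p ^ k) - b ^+ (p ^ k)) k.+1%:R.
Proof.
move=> ha hb hab; elim: k => [|k IH]; first by rewrite expn0 !expr1.
rewrite expnSr !exprM; set a' := a ^+ _ in IH *; set b' := b ^+ _ in IH *.
have ha' : vg w a' 0 by exact: (vgX hw).
have hb' : vg w b' 0 by exact: (vgX hw).
rewrite subrXX -(natr1 k.+1); apply: (vgM hw IH).
have -> : \sum_(i < p) a' ^+ (p.-1 - i) * b' ^+ i =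
   \sum_(i < p) (a' ^+ (p.-1 - i) - b' ^+ (p.-1 - i)) * b' ^+ i + p%:R * b' ^+ p.-1.
  have -> : p%:R * b' ^+ p.-1 = \sum_(i < p) b' ^+ (p.-1 - i) * b' ^+ i.
    transitivity (\sum_(i < p) b' ^+ p.-1); first by rewrite sumr_const card_ord mulr_natl.
    apply: eq_bigr => i _; rewrite -exprD subnK //.
    by rewrite -ltnS prednK ?prime_gt0 ?ltn_ord.
  by rewrite -big_split /=; apply: eq_bigr => i _; rewrite -mulrDl subrK.
apply: (vgD hw); last by apply: (vgMr hw (vg_p hp ext)); exact: (vgX hw).
apply: (vg_sum hw) => i _; apply: (vgMr hw); last exact: (vgX hw).
rewrite subrXX; apply: (vgMr hw).
  by apply: vg_le IH; rewrite (ler_nat _ 1).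
by apply: (vg_sum hw) => j _; apply: (vgMl hw); exact: (vgX hw).
Qed.
End FrobStep.

Section Digits.
Variables (p : nat) (hp : prime p).
Variables (D : idomainType) (w : D -> rat) (extw : extends_padic p w).
Variables (K : closedFieldType) (v : K -> rat) (extv : extends_padic p v).
Hypothesis resfin : forall z, vg v z 0 -> exists m, (0 < m)%N /\ vgt v (z ^+ (p ^ m) - z) 0.
Hypothesis wint : forall x, x != 0 -> exists k : int, w x = k%:~R.
Variables (ip : D) (ipE : p%:R * ip = 1).
Let hw : is_val w := proj1 extw.
Let hv : is_val v := proj1 extv.
Notation B := (D * K)%type.
Variables (G : B -> Prop) (hG : residue_graph w v G).
Hypothesis maxG : forall x F, vg w x 0 -> residual_relation w G x F -> exists t, G (x, t).
Let sG : subring_pred G := let: And4 h _ _ _ := hG in h.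
Let iG a : G a -> integral2 w v a. Proof. by case: hG => _ h _ _; apply: h. Qed.
Let cG a b : G a -> small2 w v (a - b) -> G b. Proof. by case: hG => _ _ h _; apply: h. Qed.
Let rG a : G a -> (vgt w a.1 0 <-> vgt v a.2 0). Proof. by case: hG => _ _ _ h; apply: h. Qed.

(** Integer values make p a uniformizer of w: residual congruence is congruence modulo p. *)
Lemma vgt_vg1 x : vgt w x 0 -> vg w x 1.
Proof.
have [->|x0] := eqVneq x 0; first by left.
move=> /(vgtE x0); have [k ek] := wint x0; rewrite ek ltr0z => h.
by right; rewrite ek (ler_int rat 1) -gtz0_ge1.
Qed.

(* Generated by pairs of Teichmueller representatives, which are only required to be
   such modulo p^N on the side of w, but exactly on the side of K. *)
Inductive witt_ring (N q : nat) : B -> Prop :=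
| witt_one : witt_ring N q 1
| witt_teichmuller T t : G (T, t) -> vg w (T ^+ q - T) N%:R -> t ^+ q = t ->
    witt_ring N q (T, t)
| witt_sub a b : witt_ring N q a -> witt_ring N q b -> witt_ring N q (a - b)
| witt_mul a b : witt_ring N q a -> witt_ring N q b -> witt_ring N q (a * b).

Lemma witt_subring N q : subring_pred (witt_ring N q).
Proof. by split; [exact: witt_one|exact: witt_sub|exact: witt_mul]. Qed.

Lemma witt_graph N q a : witt_ring N q a -> G a.
Proof.
elim=> {a} [||a b _ ha _ hb|a b _ ha _ hb] //; [exact: (sr1 sG)|exact: (srB sG)|exact: (srM sG)].
Qed.

Lemma witt_le N N' q a : (N' <= N)%N -> witt_ring N q a -> witt_ring N' q a.
Proof.
move=> h; elim=> {a} [|T t hT h1 h2|a b _ ha _ hb|a b _ ha _ hb].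
- exact: witt_one.
- by apply: witt_teichmuller => //; apply: vg_le h1; rewrite ler_nat.
- exact: witt_sub.
exact: witt_mul.
Qed.

Lemma witt_exp N q c a : witt_ring N q a -> witt_ring N (q ^ c) a.
Proof.
elim=> {a} [|T t hT h1 h2|a b _ ha _ hb|a b _ ha _ hb].
- exact: witt_one.
- apply: witt_teichmuller => //; elim: c => [|c IH].
  + by rewrite expn0 expr1 subrr; left.
  + rewrite expnSr exprM; apply: (vg_trans hw (y := T ^+ q)) => //.
    rewrite subrXX; apply: (vgMr hw IH); have hT1 := (iG hT).1.
    by apply: (vg_sum hw) => i _; apply: (vgMl hw); do ?apply: (vgX hw).
  + by rewrite expn0 expr1.
  + by rewrite expnSr exprM IH.
- exact: witt_sub.
exact: witt_mul.
Qed.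

(** Errors occur on the side of w alone, since [t ^+ q = t] holds exactly in K. *)
Definition negligible (N : nat) (a : B) := vg w a.1 N%:R /\ a.2 = 0.

Lemma negligible0 N : negligible N 0. Proof. by split; [left|]. Qed.
Lemma negligibleB N a b : negligible N a -> negligible N b -> negligible N (a - b).
Proof.
move=> [h1 h2] [h3 h4]; split; first exact: (vgB hw).
by rewrite -[LHS]/(a.2 - b.2) h2 h4 subrr.
Qed.
Lemma negligibleN N a : negligible N a -> negligible N (- a).
Proof. by rewrite -sub0r; apply: negligibleB; exact: negligible0. Qed.
Lemma negligibleD N a b : negligible N a -> negligible N b -> negligible N (a + b).
Proof. by move=> h1 /negligibleN; rewrite -{2}[b]opprK; apply: negligibleB. Qed.
Lemma negligibleM N a b : integral2 w v a -> negligible N b -> negligible N (a * b).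
Proof.
move=> [h1 h2] [h3 h4]; split; first exact: (vgMl hw).
by rewrite -[LHS]/(a.2 * b.2) h4 mulr0.
Qed.

Lemma exp_pair (a : B) n : (a ^+ n).1 = a.1 ^+ n /\ (a ^+ n).2 = a.2 ^+ n.
Proof. by split; [rewrite -[LHS]/(fst _)|rewrite -[LHS]/(snd _)]; rewrite rmorphXn. Qed.
Lemma nat_pair n : (n%:R : B).1 = n%:R /\ (n%:R : B).2 = n%:R.
Proof. by split; [rewrite -[LHS]/(fst _)|rewrite -[LHS]/(snd _)]; rewrite rmorph_nat. Qed.

(** The power a^q acts as a lift of Frobenius: up to a negligible error it fixes the generators, and
    it respects products exactly and differences modulo p, with corrections in the ring itself.
    Hence a - a^q is divisible by p inside the ring. *)
Lemma witt_frobenius N m a : witt_ring N (p ^ m) a ->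
  exists r, witt_ring N (p ^ m) r /\ negligible N (a - a ^+ (p ^ m) - p%:R * r).
Proof.
set q := (p ^ m)%N; have sW := witt_subring N q.
elim=> {a} [|T t hT h1 h2|a b wa [r [wr ha]] wb [s [ws hb]]|a b wa [r [wr ha]] wb [s [ws hb]]].
- exists 0; split; first exact: sr0.
  by rewrite expr1n mulr0 subr0 subrr; exact: negligible0.
- exists 0; split; first exact: sr0.
  rewrite mulr0 subr0; split.
    by rewrite -[X in vg w X]/(T - ((T, t) ^+ q).1) (exp_pair _ _).1; apply: (vgBC hw).
  by rewrite -[LHS]/(t - ((T, t) ^+ q).2) (exp_pair _ _).2 /= h2 subrr.
- have [c [wc ec]] := sr_frobeniusB sW m hp wa wb.
  exists (r - s - c); split; first by do !apply: witt_sub.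
  rewrite ec -/q; have := negligibleB ha hb; congr negligible; ring.
exists (a ^+ q * s + r * b); split.
  by apply: (srD sW); apply: witt_mul => //; apply: (srX sW).
have -> : a * b - (a * b) ^+ q - p%:R * (a ^+ q * s + r * b) =
   b * (a - a ^+ q - p%:R * r) + a ^+ q * (b - b ^+ q - p%:R * s).
  by rewrite exprMn; ring.
apply: negligibleD; apply: negligibleM => //; apply: iG; first exact: witt_graph wb.
by apply: (srX sG); exact: witt_graph wa.
Qed.

Lemma q_gt1 m : (0 < m)%N -> (1 < p ^ m)%N.
Proof. by move=> m0; rewrite -{1}(expn0 p) ltn_exp2l // prime_gt1. Qed.

Lemma witt_frobenius_pair N m a : witt_ring N (p ^ m) a ->
  exists r, [/\ witt_ring N (p ^ m) r, vg w (a.1 - a.1 ^+ (p ^ m) - p%:R * r.1) N%:R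
   & a.2 - a.2 ^+ (p ^ m) - p%:R * r.2 = 0].
Proof.
move=> /witt_frobenius [r [wr [h1 h2]]]; exists r; split=> //.
  by move: h1; rewrite -[X in vg w X]/(a.1 - (a ^+ _).1 - (p%:R : B).1 * r.1) (exp_pair _ _).1 (nat_pair _).1.
by move: h2; rewrite -[LHS]/(a.2 - (a ^+ _).2 - (p%:R : B).2 * r.2) (exp_pair _ _).2 (nat_pair _).2.
Qed.

(** G decides on both sides at once whether a is residually zero. If it is, a equals a unit times a
    - a^q, that is, a unit times p r up to p^N, and level n + 1 for a becomes level n for r on both
    sides. *)
Lemma witt_val N m a n : (0 < m)%N -> witt_ring N (p ^ m) a -> (n <= N)%N ->
  (vg w a.1 n%:R <-> vg v a.2 n%:R).
Proof.
move=> m0; elim: n a => [|n IH] a wa hn.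
  by have [h1 h2] := iG (witt_graph wa); split.
have [r [wr h1 h2]] := witt_frobenius_pair wa.
have [hs|ns] := boolp.EM (vgt w a.1 0); last first.
  split=> h; case: ns; first by apply: vg_vgt h; rewrite ltr0n.
  by apply/(rG (witt_graph wa)); apply: vg_vgt h; rewrite ltr0n.
have hs2 : vgt v a.2 0 by apply/(rG (witt_graph wa)).
rewrite (frobenius_step hp extw (q_gt1 m0) hs (r := r.1)); last first.
  by apply: vg_le h1; rewrite ler_nat.
rewrite (frobenius_step hp extv (q_gt1 m0) hs2 (r := r.2)); last by left.
by apply: IH => //; exact: ltnW.
Qed.

Lemma witt_divp N m a n : (0 < m)%N -> witt_ring N (p ^ m) a -> (n < N)%N ->
  vg w a.1 n%:R -> exists r, witt_ring N (p ^ m) r /\ vg w (a.1 - p%:R ^+ n * r.1) n.+1%:R.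
Proof.
move=> m0; elim: n a => [|n IH] a wa hn ha.
  by exists a; split=> //; rewrite expr0 mul1r subrr; left.
have [r [wr h1 _]] := witt_frobenius_pair wa.
have hs : vgt w a.1 0 by apply: vg_vgt ha; rewrite ltr0n.
have hr : vg w r.1 n%:R.
  apply/(frobenius_step hp extw (q_gt1 m0) hs (r := r.1)) => //.
  by apply: vg_le h1; rewrite ler_nat ltnW.
have [s [ws hs']] := IH r wr (ltnW hn) hr.
exists s; split=> //.
have -> : a.1 - p%:R ^+ n.+1 * s.1 = (a.1 - a.1 ^+ (p ^ m) - p%:R * r.1) +
  (p%:R * (r.1 - p%:R ^+ n * s.1) + a.1 ^+ (p ^ m)) by rewrite exprS; ring.
apply: (vgD hw); first by apply: vg_le h1; rewrite ler_nat.
apply: (vgD hw); first by rewrite -nat1r; apply: (vg_pM hp extw).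
(* The term a^q is harmless because q is at least 2 and 2 (n + 1) is at least n + 2. *)
have -> : (p ^ m = 2 + (p ^ m - 2))%N by rewrite subnKC // q_gt1.
rewrite exprD; apply: (vgMr hw); last exact: (vgX hw _ (iG (witt_graph wa)).1).
rewrite expr2; apply: (vg_le _ (vgM hw ha ha)).
by rewrite -natrD ler_nat; lia.
Qed.

(** Descent on a bound of the value: it is 0 if the element is residually nonzero, and otherwise
    exceeds by exactly 1 the value of the quotient r of a - a^q by p. *)
Lemma witt_val_int N m a : (0 < m)%N -> witt_ring N (p ^ m) a -> a.2 != 0 ->
  exists k : int, v a.2 = k%:~R.
Proof.
move=> m0; have [M hM] : exists M : nat, v a.2 < M%:R.
  by exists (Num.bound `|v a.2|); apply: le_lt_trans (ler_norm _) (archi_boundP (normr_ge0 _)).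
elim: M a hM => [|M IH] a hM wa a0.
  by have := vgE a0 (iG (witt_graph wa)).2; rewrite leNgt hM.
have [r [wr _ h2]] := witt_frobenius_pair wa.
have [hs|ns] := boolp.EM (vgt v a.2 0); last first.
  by exists 0; have [] := vNgt (iG (witt_graph wa)).2 ns.
have [hu nu] := frobenius_unit hp extv (q_gt1 m0) hs.
have [u0 vu] := vNgt hu nu.
have e : (1 - a.2 ^+ (p ^ m).-1) * a.2 = p%:R * r.2.
  rewrite mulrBl mul1r -exprSr prednK; last by have := q_gt1 m0; lia.
  by apply/eqP; rewrite -subr_eq0; apply/eqP.
have r0 : r.2 != 0.
  apply/eqP => r0; move/eqP: e; rewrite r0 mulr0 mulf_eq0.
  by rewrite (negbTE u0) (negbTE a0).
have ve : v a.2 = 1 + v r.2.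
  have := congr1 v e; rewrite (val_mul hv) // vu add0r (val_mul hv) ?(natp_neq0 hp extv) //.
  by rewrite (valp hp extv).
have [|k hk] := IH r _ wr r0.
  by move: hM; rewrite ve -nat1r ltrD2l.
by exists (1 + k); rewrite ve hk rmorphD.
Qed.

Lemma witt_algebraic N m a : (0 < m)%N -> witt_ring N (p ^ m) a -> algQ a.2.
Proof.
move=> m0; have [phi ephi] := ratr_K_rmorphism extv.
suff h b : witt_ring N (p ^ m) b -> algebraicOver phi b.2.
  by move=> /h [f f0 rf]; exists f; split=> //; rewrite -(eq_map_poly ephi).
elim=> {b} [|T t _ _ ht|b c _ hb _ hc|b c _ hb _ hc].
- exact: algebraic1.
- exists ('X^(p ^ m) - 'X).
    rewrite -size_poly_eq0 size_polyDl ?size_polyXn // size_polyN size_polyX.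
    by rewrite ltnS q_gt1.
  by rewrite rmorphB /= map_polyXn map_polyX /root !hornerE ht subrr.
- exact: algebraic_sub.
exact: algebraic_mul.
Qed.

(** The exponent is left free because successive digits may generate larger and larger finite
    fields; [witt_exp] brings two exponents to a common one. *)
Definition wittU N a := exists m, (0 < m)%N /\ witt_ring N (p ^ m) a.

Lemma wittU_subring N : subring_pred (wittU N).
Proof.
have common a b : wittU N a -> wittU N b ->
    exists m, [/\ (0 < m)%N, witt_ring N (p ^ m) a & witt_ring N (p ^ m) b].
  move=> [m [m0 wa]] [n [n0 wb]]; exists (m * n)%N; split; first by rewrite muln_gt0 m0.
    by rewrite expnM; apply: witt_exp.
  by rewrite mulnC expnM; apply: witt_exp.
split; first by exists 1%N; split=> //; exact: witt_one.
  by move=> a b ha hb; have [m [m0 wa wb]] := common a b ha hb; exists m; split=> //; apply: witt_sub.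
by move=> a b ha hb; have [m [m0 wa wb]] := common a b ha hb; exists m; split=> //; apply: witt_mul.
Qed.

Lemma wittU_graph N a : wittU N a -> G a.
Proof. by case=> m [_ /witt_graph]. Qed.
Lemma wittU_le N N' a : (N' <= N)%N -> wittU N a -> wittU N' a.
Proof. by move=> h [m [m0 wa]]; exists m; split=> //; apply: witt_le wa. Qed.
Lemma wittU_val N a n : wittU N a -> (n <= N)%N -> (vg w a.1 n%:R <-> vg v a.2 n%:R).
Proof. by case=> m [m0 wa] hn; apply: witt_val wa hn. Qed.

Lemma ipXE n : p%:R ^+ n * ip ^+ n = 1.
Proof. by rewrite -exprMn ipE expr1n. Qed.

Lemma vg_ipX n x r : vg w x (n%:R + r) -> vg w (ip ^+ n * x) r.
Proof. by move=> h; apply: (vg_pXdiv hp extw (n := n)); rewrite mulrA ipXE mul1r. Qed.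

Variables (X : D) (hX : vg w X 0).

(* z approximates, up to p^n, the image of X under the sought embedding. *)
Definition approx n z := forall N, exists y, wittU N (y, z) /\ vg w (X - y) n%:R.

Lemma approx0 : approx 0 0.
Proof.
move=> N; exists 0; split; last by rewrite subr0.
exact: (sr0 (wittU_subring N)).
Qed.

Lemma teichmuller_digit x t : G (x, t) ->
  exists m tau, [/\ (0 < m)%N, tau ^+ (p ^ m) = tau & G (x, tau)].
Proof.
move=> hxt; have [_ ht] := iG hxt; have [m [m0 hm]] := resfin ht.
have [tau [h1 h2]] := teichmuller_lift extv (q_gt1 m0) ht hm.
exists m, tau; split=> //; apply: (cG hxt); split=> //=.
by rewrite subrr; left.
Qed.

(** The representative modulo p^N is x raised to [p ^ (m * N)]: x^(p^m) and x agree modulo p, and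
    this power improves the agreement to p^(m N + 1). *)
Lemma teichmuller_witt N m x tau : (0 < m)%N -> tau ^+ (p ^ m) = tau -> G (x, tau) ->
  exists T, wittU N (T, tau) /\ vg w (x - T) 1.
Proof.
move=> m0 htau hx; have tauX k : tau ^+ (p ^ (m * k)) = tau.
  by elim: k => [|k IH]; rewrite ?muln0 ?expn0 ?expr1 // mulnS expnD exprM htau.
have small k : vg w (x - x ^+ (p ^ (m * k))) 1.
  apply: vgt_vg1; have h : G (x - x ^+ (p ^ (m * k)), 0).
    have -> : (x - x ^+ (p ^ (m * k)), 0) = (x, tau) - (x, tau) ^+ (p ^ (m * k)).
      by apply: injective_projections; rewrite /= ?(exp_pair _ _).1 ?(exp_pair _ _).2 /= ?tauX ?subrr.
    by apply: (srB sG) => //; apply: (srX sG).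
  by apply/(rG h); left.
exists (x ^+ (p ^ (m * N))); split; last exact: small.
exists m; split=> //; apply: witt_teichmuller => //.
  have -> : (x ^+ (p ^ (m * N)), tau) = (x, tau) ^+ (p ^ (m * N)).
    by apply: injective_projections; rewrite ?(exp_pair _ _).1 ?(exp_pair _ _).2 /= ?tauX.
  exact: (srX sG).
have hx1 := (iG hx).1; rewrite -exprM mulnC exprM.
have := small 1%N; rewrite muln1 => /(vgBC hw) h.
apply: (vg_le _ (vg_frobenius_lift hp extw (m * N) (vgX hw _ hx1) hx1 h)).
by rewrite ler_nat; apply: leq_trans (leq_pmull N m0) _.
Qed.

(** The pair [(y' - y, 0)] lies in the Witt ring, and divisibility of its zero component passes to
    [y' - y]. So the n-th digit modulo p depends only on z, not on the precision. *)
Lemma approx_same_digit n z N y N' y' : (n < N)%N -> (n < N')%N ->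
  wittU N (y, z) -> wittU N' (y', z) -> vg w (ip ^+ n * (X - y) - ip ^+ n * (X - y')) 1.
Proof.
move=> hN hN' hy hy'; rewrite -mulrBr; apply: vg_ipX.
have h : wittU n.+1 (y' - y, 0).
  have -> : (y' - y, 0) = (y', z) - (y, z).
    by apply: injective_projections; rewrite //= subrr.
  by apply: (srB (wittU_subring _)); [apply: wittU_le hy'|apply: wittU_le hy].
have -> : X - y - (X - y') = y' - y by ring.
by rewrite natr1; apply/(wittU_val h (leqnn _)); left.
Qed.

Lemma approx_next n z y t : approx n z -> wittU n.+1 (y, z) -> G (ip ^+ n * (X - y), t) ->
  exists z', approx n.+1 z' /\ vg v (z' - z) n%:R.
Proof.
move=> az hy hyt; have [m [tau [m0 htau hG']]] := teichmuller_digit hyt.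
have htau0 : vg v tau 0 by exact: (iG hG').2.
exists (z + p%:R ^+ n * tau); split; last first.
  rewrite addrAC subrr add0r -[n%:R]addr0; exact: (vg_pXM hp extv).
(* [tau] was fixed before N, since the new centre may not depend on the precision. Precision n + 1
   at least is what makes the digits computed from y and y' agree modulo p. *)
move=> N; have [y' [hy' hXy']] := az (maxn N n.+1).
set x' := ip ^+ n * (X - y'); set x := ip ^+ n * (X - y) in hG'.
have hxx' : vg w (x - x') 1.
  by apply: approx_same_digit hy hy' => //; rewrite leq_maxr.
have hG'' : G (x', tau).
  apply: (cG hG'); split => /=; last by rewrite subrr; left.
  by apply: vg_vgt hxx'.
have [T [hT hxT]] := teichmuller_witt (maxn N n.+1) m0 htau hG''.
exists (y' + p%:R ^+ n * T); split.
  apply: (wittU_le (leq_maxl N n.+1)).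
  have -> : (y' + p%:R ^+ n * T, z + p%:R ^+ n * tau) = (y', z) + p%:R ^+ n * (T, tau).
    apply: injective_projections.
      by rewrite -[RHS]/(y' + ((p%:R : B) ^+ n).1 * T) (exp_pair _ _).1 (nat_pair _).1.
    by rewrite -[RHS]/(z + ((p%:R : B) ^+ n).2 * tau) (exp_pair _ _).2 (nat_pair _).2.
  apply: (srD (wittU_subring _)) => //; apply: (srM (wittU_subring _)) => //.
  by apply: (srX (wittU_subring _)); apply: (sr_nat (wittU_subring _)).
have -> : X - (y' + p%:R ^+ n * T) = p%:R ^+ n * (x' - T).
  by rewrite mulrBr /x' mulrA ipXE mul1r; ring.
by rewrite -natr1; apply: (vg_pXM hp extw).
Qed.

Lemma horner_int_pair (f : {poly int}) (a : B) :
  ((map_poly intr f).[a]).1 = (map_poly intr f).[a.1] /\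
  ((map_poly intr f).[a]).2 = (map_poly intr f).[a.2].
Proof.
have h (R : comNzRingType) (g : {rmorphism B -> R}) :
    g ((map_poly intr f).[a]) = (map_poly intr f).[g a].
  rewrite -horner_map -map_poly_comp; congr (_.[_]).
  by apply: eq_map_poly => n /=; rewrite rmorph_int.
by split; [exact: (h D fst)|exact: (h K snd)].
Qed.

Lemma sr_horner_int (P : B -> Prop) (hP : subring_pred P) (f : {poly int}) a :
  P a -> P (map_poly intr f).[a].
Proof. by move=> ha; apply: srp_horner => // i; rewrite coef_map; apply: sr_int. Qed.

(** Modulo p^n, f(X) agrees with f(y) and f(a) with f(z), and the pair (f(y), f(z)) belongs to the
    Witt ring. *)
Lemma approx_val n z a (f : {poly int}) : approx n z -> vg v (a - z) n%:R -> vg v a 0 ->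
  (vg w (map_poly intr f).[X] n%:R <-> vg v (map_poly intr f).[a] n%:R).
Proof.
move=> az haz ha; have [y [hy hXy]] := az n.
have [iy iz] := iG (wittU_graph hy).
have h := sr_horner_int (wittU_subring n) f hy.
have [e1 e2] := horner_int_pair f (y, z).
have := wittU_val h (leqnn n); rewrite e1 e2 /= => hval.
have h1 := vg_hornerB hw f hX iy hXy.
have h2 := vg_hornerB hv f ha iz haz.
split=> h'.
  by apply: (vg_cong hv h2); apply/hval; exact: (vg_cong hw (vgBC hw h1)).
by apply: (vg_cong hw h1); apply/hval; exact: (vg_cong hv (vgBC hv h2)).
Qed.

Lemma approx_int n z : approx n z -> vg v z 0.
Proof. by move=> /(_ 0%N) [y [/wittU_graph /iG [_]]]. Qed.

Lemma approx_unramified n z (f : {poly int}) : approx n z ->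
  (map_poly intr f).[z] != 0 -> exists k : int, v (map_poly intr f).[z] = k%:~R.
Proof.
move=> /(_ 0%N) [y [hy _]]; have [_ e2] := horner_int_pair f (y, z).
have [m [m0 wf]] := sr_horner_int (wittU_subring 0) f hy.
by rewrite -[z]/((y, z).2) -e2; apply: witt_val_int wf.
Qed.

Lemma approx_algebraic n z : approx n z -> algQ z.
Proof. by move=> /(_ 0%N) [y [[m [m0 wy]] _]]; have := witt_algebraic m0 wy. Qed.

Section Stuck.
Variables (n : nat) (z : K) (az : approx n z).
Hypothesis stuck : forall z', approx n.+1 z' -> ~ vg v (z' - z) n%:R.

(* At a stuck step, the next digit (X - y) / p^n is residually transcendental over the
   domain of G, so w is the Gauss valuation of the ball of centre z and radius n. *)
Lemma stuck_val (f : {poly int}) (M : nat) :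
  vg w (map_poly intr f).[X] M%:R <->
  (forall x, vg v (x - z) n%:R -> vg v (map_poly intr f).[x] M%:R).
Proof.
(* Precision M serves to compare the coefficients below, precision n + 1 to form the next digit. *)
set N := maxn M n.+1; have [y [hy hXy]] := az N.
have iy := iG (wittU_graph hy); have sU := wittU_subring N.
set x := ip ^+ n * (X - y).
have hx : vg w x 0 by apply: vg_ipX; rewrite addr0.
have nx t : ~ G (x, t).
  move=> hxt; have hy1 := wittU_le (leq_maxr M n.+1) hy.
  by have [z' [h1 h2]] := approx_next az hy1 hxt; apply: stuck h1 h2.
have trans F : polyP_in G F -> vgt w (ev1 F x) 0 -> forall i, vgt w (F`_i).1 0.
  move=> hF zF; apply: boolp.contrapT => nF.
  by have [|t] := maxG hx (F := F); [split|exact: nx].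
(* The first component of Q takes the value f(X) at x; the second takes at u the value f(z + p^n u),
   so that integral u run through the ball. *)
pose Q : {poly B} := map_poly intr f \Po ((y, z)%:P + (p%:R ^+ n)%:P * 'X).
have hQ : polyP_in (wittU N) Q.
  apply: sr_comp_poly => //; first by move=> i; rewrite coef_map; apply: sr_int.
  apply: srpD => //; first exact: srpC.
  apply: srpM => //; last exact: srpX.
  by apply: srpC => //; apply: srX => //; apply: sr_nat.
have Qeval u : Q.[(x, u)] = (map_poly intr f).[((y, z) : B) + p%:R ^+ n * (x, u)].
  by rewrite horner_comp !hornerE.
have pe (a : D) (b : K) : (p%:R : B) ^+ n * (a, b) = (p%:R ^+ n * a, p%:R ^+ n * b).
  apply: injective_projections.
    by rewrite -[LHS]/(((p%:R : B) ^+ n).1 * a) (exp_pair _ _).1 (nat_pair _).1.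
  by rewrite -[LHS]/(((p%:R : B) ^+ n).2 * b) (exp_pair _ _).2 (nat_pair _).2.
have Q1 : ev1 Q x = (map_poly intr f).[X].
  rewrite -(horner_pair1 Q x 0) Qeval pe (horner_int_pair _ _).1 /=; congr (_.[_]).
  by rewrite /x mulrA ipXE mul1r addrC subrK.
have Q2 u : ev2 Q u = (map_poly intr f).[z + p%:R ^+ n * u].
  by rewrite -(horner_pair2 Q x u) Qeval pe (horner_int_pair _ _).2.
(* Induction on m: divide the coefficients by p^m within the Witt ring. The quotients form a
   polynomial residually zero at x; as x is residually transcendental, they are all residually zero,
   which yields one more factor p. *)
have coefs m : (m <= M)%N -> vg w (ev1 Q x) M%:R -> forall i, vg w (Q`_i).1 m%:R.
  move=> + zQ; elim: m => [|m IH] hm i; first exact: (iG (wittU_graph (hQ i))).1.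
  have {IH} IH := IH (ltnW hm).
  have /boolp.choice [r hr] : forall j, exists r, G r /\ vg w ((Q`_j).1 - p%:R ^+ m * r.1) m.+1%:R.
    move=> j; have [c [c0 wc]] := hQ j.
    have hmN : (m < N)%N by apply: leq_trans hm (leq_maxl _ _).
    have [r [wr hr]] := witt_divp c0 wc hmN (IH j).
    by exists r; split=> //; apply: witt_graph wr.
  pose R : {poly B} := \poly_(j < size Q) r j.
  have hR : polyP_in G R.
    by move=> j; rewrite coef_poly; case: ifP => _; [exact: (hr j).1|exact: (sr0 sG)].
  have hQR : vg w (ev1 Q x - p%:R ^+ m * ev1 R x) m.+1%:R.
    have e1 : ev1 Q x = \sum_(j < size Q) (Q`_j).1 * x ^+ j.
      rewrite /ev1 (horner_coef_wide _ (n := size Q)); last exact: size_poly.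
      by apply: eq_bigr => j _; rewrite coef_map.
    have e2 : ev1 R x = \sum_(j < size Q) (r j).1 * x ^+ j.
      rewrite /ev1 (horner_coef_wide _ (n := size Q)); last first.
        by apply: leq_trans (size_poly _ _) _; exact: size_poly.
      by apply: eq_bigr => j _; rewrite coef_map coef_poly ltn_ord.
    rewrite e1 e2 mulr_sumr -sumrB; apply: (vg_sum hw) => j _.
    by rewrite mulrA -mulrBl; apply: (vgMr hw (hr j).2); exact: (vgX hw).
  have zR : vgt w (ev1 R x) 0.
    apply: (vg_vgt (r := 1)) => //; apply: (vg_pXdiv hp extw (n := m)); rewrite natr1.
    by apply: (vg_cong hw (vgBC hw hQR)); apply: vg_le zQ; rewrite ler_nat.
  have [hi|hi] := ltnP i (size Q); last by rewrite nth_default //; left.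
  have := trans R hR zR i; rewrite coef_poly hi => /vgt_vg1 hri.
  by apply: (vg_cong hw (hr i).2); rewrite -natr1; apply: (vg_pXM hp extw).
rewrite -Q1; split.
  move=> zQ a ha; pose u := (a - z) / p%:R ^+ n.
  have pn0 : (p%:R : K) ^+ n != 0 by rewrite expf_neq0 // (natp_neq0 hp extv).
  have eu : p%:R ^+ n * u = a - z by rewrite /u mulrC divfK.
  have hu : vg v u 0 by apply: (vg_pXdiv hp extv (n := n)); rewrite eu addr0.
  have <- : z + p%:R ^+ n * u = a by rewrite eu addrC subrK.
  rewrite -Q2 /ev2 horner_coef; apply: (vg_sum hv) => i _.
  apply: (vgMr hv); last exact: (vgX hv).
  rewrite coef_map; apply/(wittU_val (hQ i) (leq_maxl _ _)).
  exact: coefs.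
(* In the other direction the maximum modulus principle bounds the coefficients in K, and
   [wittU_val] carries the bound over to w. *)
move=> hball; have hmax : forall i, vg v (map_poly snd Q)`_i M%:R.
  apply: (max_modulus extv) => u hu; rewrite -[_.[u]]/(ev2 Q u) Q2; apply: hball.
  by rewrite addrAC subrr add0r -[n%:R]addr0; apply: (vg_pXM hp extv).
rewrite /ev1 horner_coef; apply: (vg_sum hw) => i _.
apply: (vgMr hw); last exact: (vgX hw).
rewrite coef_map; apply/(wittU_val (hQ i) (leq_maxl _ _)).
by have := hmax i; rewrite coef_map.
Qed.
End Stuck.

Hypothesis complete : forall u, cauchy v u -> exists l, converges v u l.

Lemma digits_dichotomy :
  (exists n z, approx n z /\ forall z', approx n.+1 z' -> ~ vg v (z' - z) n%:R) \/
  (exists a, vg v a 0 /\ forall n, exists z, approx n z /\ vg v (a - z) n%:R).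
Proof.
have [h|h] := boolp.EM (exists n z, approx n z /\
   forall z', approx n.+1 z' -> ~ vg v (z' - z) n%:R); [by left|right].
(* Outside approximations the successor is a dummy; the sequence starts at [approx 0 0] and never
   leaves them. *)
have /boolp.choice [nxt hnxt] : forall s : nat * K, exists z',
    approx s.1 s.2 -> approx s.1.+1 z' /\ vg v (z' - s.2) s.1%:R.
  move=> [n z] /=; have [az|naz] := boolp.EM (approx n z); last by exists 0.
  apply: boolp.contrapT => hn; apply: h; exists n, z; split=> // z' az' hz'.
  by apply: hn; exists z'.
pose u := fix u n := if n is m.+1 then nxt (m, u m) else 0.
have hu n : approx n (u n).
  by elim: n => [|n IH]; [exact: approx0|exact: (hnxt (n, u n) IH).1].
have step n k : vg v (u (n + k)%N - u n) n%:R.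
  elim: k => [|k IH]; first by rewrite addn0 subrr; left.
  apply: (vg_trans hv) IH; rewrite addnS.
  by apply: (vg_le _ (hnxt (_, u _) (hu _)).2); rewrite ler_nat leq_addr.
have [a ha] : exists l, converges v u l.
  apply: complete => r; pose n := Num.bound `|r|.
  have rn : r <= n%:R by apply: ltW; apply: le_lt_trans (ler_norm _) (archi_boundP (normr_ge0 _)).
  exists n => i j hi hj; apply: (vg_le rn); rewrite -(subnKC hi) -(subnKC hj).
  by apply: (vg_trans hv (y := u n)) => //; apply: (vgBC hv).
have han n : vg v (a - u n) n%:R.
  have [N hN] := ha n%:R; apply: (vg_trans hv (y := u (n + N)%N)) => //.
  by apply: (vgBC hv); apply: hN; rewrite leq_addl.
exists a; split; last by move=> n; exists (u n).
by have := han 0%N; rewrite /= subr0.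
Qed.
End Digits.

(** * Unramified valuation rings and pairs *)

Definition unramified_valuation_ring (p : nat) (R : {poly rat} -> Prop) : Prop :=
  exists w : {poly rat} -> int,
  [/\ forall f g, f != 0 -> g != 0 -> w (f * g) = w f + w g,
      forall f g, f != 0 -> g != 0 -> f + g != 0 -> w f <= w (f + g) \/ w g <= w (f + g),
      forall c : rat, c != 0 -> (w c%:P)%:~R = padicv p c
    & forall f, R f <-> f = 0 \/ 0 <= w f].

Lemma isIntP z : isInt z <-> exists k : int, z = k%:~R.
Proof.
split=> [h|[k ->]]; last by rewrite /isInt denq_int.
by exists (numq z); rewrite -{1}[z]divq_num_den h divr1.
Qed.

Lemma isInt_numq z : isInt z -> z = (numq z)%:~R.
Proof. by move=> h; rewrite -{1}[z]divq_num_den h divr1. Qed.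

Lemma unramified_ring_of_val p R (u : {poly rat} -> rat) : is_val u ->
  (forall f, f != 0 -> isInt (u f)) -> (forall c, c != 0 -> u c%:P = padicv p c) ->
  (forall f, R f <-> vg u f 0) -> unramified_valuation_ring p R.
Proof.
move=> [uM uD] uI uc uR; exists (fun f => numq (u f)).
have e f : f != 0 -> u f = (numq (u f))%:~R by move=> /uI; apply: isInt_numq.
split.
- move=> f g f0 g0; apply: (@intr_inj rat).
  by rewrite rmorphD /= -!e ?mulf_neq0 // uM.
- move=> f g f0 g0 fg0; have h := uD f g f0 g0 fg0.
  by apply/orP; rewrite (e _ f0) (e _ g0) (e _ fg0) !ler_int in h.
- by move=> c c0; rewrite -e ?polyC_eq0 // uc.
move=> f; rewrite uR; have [->|f0] := eqVneq f 0; first by split; left.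
by rewrite /vg (e _ f0) ler0z numq_int.
Qed.

Lemma unramified_ring_val p R : prime p -> unramified_valuation_ring p R ->
  exists w : {poly rat} -> rat, [/\ extends_padic p w,
    forall f, f != 0 -> exists k : int, w f = k%:~R & forall f, R f <-> vg w f 0].
Proof.
move=> hp [w [wM wD wc wR]]; exists (fun f => (w f)%:~R); split.
- split; first split.
  + by move=> f g f0 g0; rewrite wM // rmorphD.
  + by move=> f g f0 g0 fg0; rewrite !ler_int; apply/orP; apply: wD.
  move=> n n0; have n1 : (n%:~R : rat) != 0 by rewrite intr_eq0.
  have e : (n%:~R : {poly rat}) = (n%:~R)%:P by rewrite rmorph_int.
  by rewrite e polyC_eq0 n1 wc // padicv_int.
- by move=> f _; exists (w f).
by move=> f; rewrite wR /vg ler0z.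
Qed.

Section Scale.
Variables (p : nat) (hp : prime p) (D : idomainType) (w : D -> rat).
Hypothesis ext : extends_padic p w.
(** Clearing denominators moves the threshold 0 to a natural number; this is why integer polynomials
    are compared at all natural thresholds. *)
Lemma vg_int_scale (a : int) x : a != 0 ->
  (vg w (a%:~R * x) (logn p (absz a))%:R <-> vg w x 0).
Proof.
move=> a0; have [a1 va] := ext.2 a a0; rewrite -va; split=> h.
  by apply: (vg_cancel (proj1 ext) a1 (r := w a%:~R)) => //; rewrite addr0.
by rewrite -[w _]addr0; apply: (vgM (proj1 ext)) h; right.
Qed.
End Scale.

(** * From a valuation to a pair *)

Section Pairs.
Variables (p : nat) (hp : prime p) (K : closedFieldType) (v : K -> rat) (HK : is_Cp p v).

Lemma Cp_extends : extends_padic p v.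
Proof.
case: HK => h1 [h2 [h3 _]]; split=> // n n0.
have [] := h3 n%:~R; first by rewrite intr_eq0.
by rewrite ratr_int padicv_int.
Qed.
Let extv := Cp_extends.
Let hv : is_val v := proj1 extv.

Lemma Cp_complete u : cauchy v u -> exists l, converges v u l.
Proof. by case: HK => _ [_ [_ [h _]]]; apply: h. Qed.

Lemma Cp_residue z : vg v z 0 -> exists m, (0 < m)%N /\ vgt v (z ^+ (p ^ m) - z) 0.
Proof. by apply: (residue_finite hp extv); case: HK => _ [_ [_ [_ h]]]. Qed.

Lemma int_poly_scale (g : {poly rat}) : exists (a : int) (F : {poly int}),
  [/\ a != 0, a%:~R * g = map_poly intr F
    & forall x : K, a%:~R * (map_poly ratr g).[x] = (map_poly intr F).[x]].
Proof.
have [phi ephi] := ratr_K_rmorphism extv.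
have [F [a a0 e]] := rat_poly_scale g.
have e1 : a%:~R * g = map_poly intr F.
  rewrite e -[a%:~R in LHS](rmorph_int polyC) mul_polyC scalerA mulfV ?scale1r //.
  by rewrite intr_eq0.
exists a, F; split=> // x; rewrite -(eq_map_poly ephi).
have -> : map_poly (intr : int -> K) F = map_poly phi (map_poly intr F).
  by rewrite -map_poly_comp; apply: eq_map_poly => n /=; rewrite rmorph_int.
by rewrite -e1 rmorphM /= rmorph_int hornerM -[a%:~R in RHS](rmorph_int polyC) hornerC.
Qed.

(** Rational approximations of the coefficients that are closer than the value of f(a) leave this
    value unchanged, whence the precision [v f.[a] + 1]; clearing denominators then gives an integer
    polynomial. *)
Lemma Qp_poly_val (a : K) (f : {poly K}) : vg v a 0 -> (forall i, inQp v f`_i) ->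
  f.[a] != 0 -> exists F : {poly int}, exists b : int,
    [/\ b != 0, (map_poly intr F).[a] != 0
      & v f.[a] = v (map_poly intr F).[a] - (logn p (absz b))%:R].
Proof.
move=> ha hf fa; set r := v f.[a] + 1.
have /boolp.choice [q hq] : forall i, exists q : rat, vg v (f`_i - ratr q) r.
  by move=> i; apply: hf.
pose g := \poly_(i < size f) q i.
have hfg : vg v (f.[a] - (map_poly ratr g).[a]) r.
  rewrite horner_coef (horner_coef_wide _ (n := size f)); last first.
    by apply: leq_trans (size_poly _ _) _; exact: size_poly.
  rewrite -sumrB; apply: (vg_sum hv) => i _; rewrite -mulrBl; apply: (vgMr hv).
    by rewrite coef_map_id0 ?coef_poly ?ltn_ord // /ratr mul0r.
  exact: (vgX hv).
have [b [F [b0 _ eF]]] := int_poly_scale g; exists F, b.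
have [b1 vb] := extv.2 b b0.
have [ga vga] : (map_poly ratr g).[a] != 0 /\ v (map_poly ratr g).[a] = v f.[a].
  have := @val_dom _ _ hv f.[a] ((map_poly ratr g).[a] - f.[a]) fa.
  rewrite [f.[a] + _]addrC subrK; apply; apply: (vg_vgt (r := r)); last exact: (vgBC hv).
  by rewrite /r ltrDl.
split=> //; first by rewrite -eF mulf_neq0.
by rewrite -eF (val_mul hv) // vb vga addrAC subrr add0r.
Qed.

Lemma unramified_of_int (a : K) : vg v a 0 ->
  (forall F : {poly int}, (map_poly intr F).[a] != 0 ->
     exists k : int, v (map_poly intr F).[a] = k%:~R) -> unramified v a.
Proof.
move=> ha hF z [y [[f [g [hf [hg [ga ey]]]]] [y0 <-]]].
have fa : f.[a] != 0 by apply: contraNneq y0 => f0; rewrite ey f0 mul0r.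
have val (h : {poly K}) : (forall i, inQp v h`_i) -> h.[a] != 0 -> exists k : int, v h.[a] = k%:~R.
  move=> hh h0; have [F [b [b0 F0 ->]]] := Qp_poly_val ha hh h0.
  by have [k ->] := hF F F0; exists (k - (logn p (absz b))%:Z); rewrite rmorphB.
have [k hk] := val f hf fa; have [l hl] := val g hg ga.
apply/isIntP; exists (k - l); rewrite rmorphB /= -hk -hl.
apply/eqP; rewrite eq_sym subr_eq; apply/eqP.
by rewrite -(val_mul hv) // ey divfK.
Qed.

Lemma unramified_obr a : vg v a 0 -> unramified v a -> inObr v a.
Proof.
move=> ha ua; split=> //; exists [:: 0] => z /ua hz; exists 0.
by rewrite mem_head subr0.
Qed.

Lemma algQ_Qpbar a : algQ a -> inQpbar v a.
Proof.
have [phi ephi] := ratr_K_rmorphism extv; case=> f [f0 rf].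
exists (map_poly ratr f); split.
  by rewrite -(eq_map_poly ephi) map_poly_eq0.
split=> // i n; exists f`_i; left; rewrite coef_map_id0 ?subrr // /ratr mul0r //.
Qed.

Lemma horner_int_polyX (F : {poly int}) :
  (map_poly (intr : int -> {poly rat}) F).['X] = map_poly intr F.
Proof.
have -> : map_poly (intr : int -> {poly rat}) F = map_poly polyC (map_poly intr F).
  rewrite -map_poly_comp; apply: eq_map_poly => n /=.
  by rewrite rmorph_int.
exact: comp_polyXr.
Qed.

Theorem unramified_ring_pair (R : {poly rat} -> Prop) : R 'X ->
  unramified_valuation_ring p R ->
  exists (a : K) (d : option nat), admissible v a d /\ inObr v a /\ unramified v a /\
     (forall f, R f <-> IntQ v (ball v a d) f).
Proof.
move=> RX hR; have [w [extw wint wR]] := unramified_ring_val hp hR.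
have [G [hG maxG]] := maximal_graph hp extw extv Cp_residue.
have wX : vg w 'X 0 by apply/wR.
pose ip : {poly rat} := (p%:R^-1)%:P.
have ipE : p%:R * ip = 1.
  rewrite -(rmorph_nat polyC) -polyCM mulfV // pnatr_eq0 -lt0n prime_gt0 //.
have [[n [z [az stuck]]]|[a [ha approxa]]] :=
  digits_dichotomy extw extv hG wX Cp_complete.
  have hz := approx_int hG az.
  have uz : unramified v z.
    by apply: unramified_of_int => // F; apply: (approx_unramified hp extw extv hG az).
  exists z, (Some n); split; first exact: algQ_Qpbar (approx_algebraic hp extv az).
  split; first exact: unramified_obr.
  split=> // f; rewrite wR; have [b [F [b0 e1 e2]]] := int_poly_scale f.
  rewrite -(vg_int_scale extw f b0) e1 -horner_int_polyX.
  rewrite (stuck_val hp extw extv Cp_residue wint ipE hG maxG az stuck).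
  by split=> h x /h; rewrite -e2; move/(vg_int_scale extv _ b0).
have aval F (n : nat) : vg w (map_poly intr F) n%:R <-> vg v (map_poly intr F).[a] n%:R.
  have [z [az hz]] := approxa n; rewrite -horner_int_polyX.
  exact: (approx_val hp extw extv hG wX F az hz ha).
have ua : unramified v a.
  apply: unramified_of_int => // F Fa.
  (* For n above the value of F(a), an approximation z of a modulo p^n satisfies v F(z) = v F(a),
     and the value at z is known to be an integer. *)
  set n := Num.bound `|v (map_poly intr F).[a]|.
  have hn : v (map_poly intr F).[a] < n%:R.
    exact: le_lt_trans (ler_norm _) (archi_boundP (normr_ge0 _)).
  have [z [az hz]] := approxa n.
  have h := vgBC hv (vg_hornerB hv F ha (approx_int hG az) hz).
  have [] := val_dom hv Fa (vg_vgt hn h).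
  rewrite addrC subrK => Fz <-; exact: (approx_unramified hp extw extv hG az Fz).
exists a, None; split.
  (* If F(a) = 0, then [aval] makes w F at least n for every n, in particular for |k| + 1 where k =
     w F. *)
  move=> alga; have [F [F0 _ /eqP Fa]] := algQ_primitive_root extv alga.
  have F1 : map_poly intr F != 0 :> {poly rat} by rewrite map_poly_eq0_id0 // intr_eq0 lead_coef_eq0.
  have [k hk] := wint _ F1.
  have /(vgE F1) := (aval F (absz k).+1).2 (or_introl Fa).
  rewrite hk => h; have {h} : (((absz k).+1)%:Z%:~R : rat) <= k%:~R by exact: h.
  by rewrite ler_int; lia.
split; first exact: unramified_obr.
split=> // f; rewrite wR; have [b [F [b0 e1 e2]]] := int_poly_scale f.
rewrite -(vg_int_scale extw f b0) e1 aval -e2 (vg_int_scale extv _ b0).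
by split=> [h x ->|h]; [|apply: h].
Qed.
End Pairs.

(** * Gauss valuations, and from a pair to a valuation *)

Section Gauss.
Variables (K : closedFieldType) (v : K -> rat) (hv : is_val v).

(** A relation, because the zero polynomial has no Gauss value; [gauss_val] selects a function. *)
Definition is_gauss (F : {poly K}) (r : rat) :=
  (forall i, vg v F`_i r) /\ exists i, F`_i != 0 /\ v F`_i = r.

Lemma gauss_exists F : F != 0 -> exists r, is_gauss F r.
Proof.
move=> F0; have [i [i0 hi]] := min_coef v F0.
by exists (v F`_i); split=> //; exists i.
Qed.

Lemma gauss_le F r s : is_gauss F r -> (forall i, vg v F`_i s) -> s <= r.
Proof. by move=> [_ [i [i0 <-]]] h; apply: vgE. Qed.

Lemma gauss_unique F r s : is_gauss F r -> is_gauss F s -> r = s.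
Proof.
move=> hr hs; apply/eqP; rewrite eq_le (gauss_le hr hs.1) andbT.
exact: gauss_le hs hr.1.
Qed.

Lemma gauss_first F r : is_gauss F r -> exists i, [/\ F`_i != 0, v F`_i = r &
  forall j, (j < i)%N -> vgt v F`_j r].
Proof.
move=> [h1 h2]; have [i [[i0 vi] mi]] := @classic_min (fun i => F`_i != 0 /\ v F`_i = r) h2.
exists i; split=> // j /mi hj; have [Fj0|Fj0] := eqVneq F`_j 0; first by left.
right; rewrite lt_neqAle (vgE Fj0 (h1 j)) andbT eq_sym.
by apply/eqP => e; apply: hj.
Qed.

(* The product of the first coefficients of minimal value dominates its coefficient
   of the product polynomial. *)
Lemma gaussM F H r s : is_gauss F r -> is_gauss H s -> is_gauss (F * H) (r + s).
Proof.
move=> hF hH; split.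
  move=> i; rewrite coefM; apply: (vg_sum hv) => j _.
  exact: (vgM hv (hF.1 j) (hH.1 _)).
have [i [i0 vi mi]] := gauss_first hF; have [j [j0 vj mj]] := gauss_first hH.
exists (i + j)%N; rewrite coefM.
have hi : (i < (i + j).+1)%N by rewrite ltnS leq_addr.
rewrite (bigD1 (Ordinal hi)) //= addKn -vi -vj -(val_mul hv i0 j0).
have ij0 : F`_i * H`_j != 0 by rewrite mulf_neq0.
apply: (val_dom hv ij0); apply: (vgt_sum hv) => k ki.
rewrite (val_mul hv i0 j0) vi vj.
have [hk|hk|hk] := ltngtP (k : nat) i.
- exact: (vgtM hv (mi _ hk) (hH.1 _)).
- rewrite mulrC addrC; apply: (vgtM hv) (hF.1 k); apply: mj.
  by have := ltn_ord k; lia.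
by case/eqP: ki; apply: val_inj.
Qed.

Lemma gauss_val : exists u : {poly K} -> rat, is_val u /\ forall F, F != 0 -> is_gauss F (u F).
Proof.
have /boolp.choice [u hu] : forall F, exists r, F != 0 -> is_gauss F r.
  move=> F; have [->|F0] := eqVneq F 0; first by exists 0; case/eqP.
  by have [r hr] := gauss_exists F0; exists r.
exists u; split=> //; split=> F H F0 H0.
  by apply: gauss_unique (hu _ (mulf_neq0 F0 H0)) (gaussM (hu _ F0) (hu _ H0)).
move=> s0; have hs := hu _ s0.
have [h|/ltW h] := leP (u F) (u H); apply/orP; [left|right]; apply: gauss_le hs _ => i;
  rewrite coefD; apply: (vgD hv).
- exact: (hu F F0).1.
- exact: vg_le h ((hu H H0).1 i).
- exact: vg_le h ((hu F F0).1 i).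
exact: (hu H H0).1.
Qed.
End Gauss.

Section Converse.
Variables (p : nat) (hp : prime p) (K : closedFieldType) (v : K -> rat) (HK : is_Cp p v).
Let extv := Cp_extends HK.
Let hv : is_val v := proj1 extv.

Lemma inQp_ratr (q : rat) : inQp v (ratr q).
Proof. by move=> n; exists q; left; rewrite subrr. Qed.

Lemma rat_value_unramified (a : K) (h : {poly rat}) : unramified v a ->
  (map_poly ratr h).[a] != 0 -> isInt (v (map_poly ratr h).[a]).
Proof.
move=> ua ha; apply: ua; exists (map_poly ratr h).[a]; split=> //.
exists (map_poly ratr h), 1; split; last split; last by rewrite hornerC oner_neq0 divr1.
  by move=> i; rewrite coef_map_id0 /ratr ?mul0r //; exact: inQp_ratr.
move=> i; have [phi ephi] := ratr_K_rmorphism extv.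
have -> : (1 : {poly K})`_i = ratr (1 : {poly rat})`_i.
  by rewrite -ephi !coef1 rmorph_nat.
exact: inQp_ratr.
Qed.

Theorem pair_unramified_ring (R : {poly rat} -> Prop) (a : K) (d : option nat) :
  admissible v a d -> vg v a 0 -> unramified v a ->
  (forall f, R f <-> IntQ v (ball v a d) f) -> unramified_valuation_ring p R.
Proof.
move=> adm ha ua hR; have [phi ephi] := ratr_K_rmorphism extv.
have em f : map_poly ratr f = map_poly phi f by rewrite (eq_map_poly ephi).
have vphi c : c != 0 -> v (phi c) = padicv p c.
  by move=> c0; case: HK => _ [_ [h _]]; rewrite ephi; have [] := h c c0.
case: d adm hR => [n _|/= na] hR; last first.
  have fa f : f != 0 -> (map_poly phi f).[a] != 0.
    by move=> f0; apply/eqP => /eqP fa; apply: na; exists f; rewrite em.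
  apply: (@unramified_ring_of_val p R (fun f => v (map_poly phi f).[a])).
  - split=> f g f0 g0; rewrite ?rmorphM ?rmorphD ?hornerM ?hornerD.
      by rewrite (val_mul hv) ?fa.
    by move=> /fa; rewrite rmorphD hornerD; apply: hv.2; apply: fa.
  - by move=> f f0; rewrite -em; apply: rat_value_unramified => //; rewrite em fa.
  - by move=> c c0; rewrite map_polyC hornerC vphi.
  move=> f; rewrite hR; split.
    move=> /(_ a erefl); rewrite em => -[h|h]; last by right.
    by left; apply/eqP; apply: contraTT isT => /fa; rewrite h eqxx.
  move=> h x /= ->; rewrite em; case: h => [->|h]; last by right.
  by left; rewrite rmorph0 horner0.
have [u [hu gu]] := gauss_val hv.
have pn0 : (p%:R : K) ^+ n != 0 by rewrite expf_neq0 // (natp_neq0 hp extv).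
(* L maps the integral elements of K onto the ball. *)
pose L : {poly K} := a%:P + (p%:R ^+ n)%:P * 'X.
have sL : size L = 2%N.
  by rewrite /L addrC size_MXaddC polyC_eq0 (negbTE pn0) size_polyC pn0.
pose T f := map_poly phi f \Po L.
have T0 f : f != 0 -> T f != 0.
  by move=> f0; rewrite comp_poly2_eq0 // map_poly_eq0.
have Ev f x : (T f).[x] = (map_poly phi f).[a + p%:R ^+ n * x].
  by rewrite horner_comp !hornerE.
(* The coefficients of f(a + p^n Y) lie in Q[a], where unramifiedness makes all values integers;
   hence their minimum is one. *)
have Tcoef f i : exists h : {poly rat}, (T f)`_i = (map_poly phi h).[a].
  pose P (c : K) := exists h : {poly rat}, c = (map_poly phi h).[a].
  have sP : subring_pred P.
    split; first by exists 1; rewrite rmorph1 hornerC.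
      by move=> _ _ [h1 ->] [h2 ->]; exists (h1 - h2); rewrite rmorphB hornerD hornerN.
    by move=> _ _ [h1 ->] [h2 ->]; exists (h1 * h2); rewrite rmorphM hornerM.
  have : polyP_in P (T f); last by apply.
  apply: sr_comp_poly => //.
    by move=> j; exists (f`_j)%:P; rewrite coef_map map_polyC hornerC.
  apply: srpD => //; first by apply: srpC => //; exists 'X; rewrite map_polyX hornerX.
  apply: srpM => //; last exact: srpX.
  by apply: srpC => //; apply: srX => //; apply: sr_nat.
apply: (@unramified_ring_of_val p R (fun f => u (T f))).
- split=> f g f0 g0.
    by rewrite /T rmorphM comp_polyM hu.1 ?T0.
  by move=> /T0; rewrite {1 3 5}/T rmorphD comp_polyD; apply: hu.2; apply: T0.
- move=> f f0; have [_ [i [i0 <-]]] := gu _ (T0 f f0).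
  have [h eh] := Tcoef f i; rewrite eh -em; apply: rat_value_unramified => //.
  by rewrite em -eh.
- move=> c c0; rewrite /T map_polyC comp_polyC -vphi //.
  have c1 : phi c != 0 by rewrite fmorph_eq0.
  have /gu h : (phi c)%:P != 0 by rewrite polyC_eq0.
  apply: gauss_unique h _; split.
    by move=> i; rewrite coefC; case: eqP => _; [right|left].
  by exists 0%N; rewrite coefC.
move=> f; rewrite hR; have [->|f0] := eqVneq f 0.
  by split=> _; [left|move=> x _; rewrite em rmorph0 horner0; left].
have Tf0 := T0 f f0; split=> h.
  right; apply: gauss_le (gu _ Tf0) _; apply: (max_modulus extv) => x hx.
  rewrite Ev -em; apply: h => /=; rewrite addrAC subrr add0r -[n%:R]addr0.
  exact: (vg_pXM hp extv).
move=> x hx; pose y := (x - a) / p%:R ^+ n.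
have ey : p%:R ^+ n * y = x - a by rewrite /y mulrC divfK.
have hy : vg v y 0 by apply: (vg_pXdiv hp extv (n := n)); rewrite ey addr0.
have <- : a + p%:R ^+ n * y = x by rewrite ey addrC subrK.
rewrite em -Ev; apply: (vg_horner hv) hy => i.
by apply: vg_le (vgE f0 h) _; apply: (gu _ Tf0).1.
Qed.
End Converse.

(** * Unique factorization *)

Section UFD.
Variables (R : {poly rat} -> Prop) (sR : subring_pred R).
Implicit Types (x y u : {poly rat}) (s t : seq {poly rat}).

Definition primeR x : Prop := [/\ R x, x != 0, ~ unitR R x &
  forall a b c, R a -> R b -> R c -> a * b = x * c ->
    exists2 c', R c' & a = x * c' \/ b = x * c'].

Lemma unitR1 : unitR R 1.
Proof. by split; [exact: sr1|exists 1; split; [exact: sr1|rewrite mulr1]]. Qed.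

Lemma unitRM u v : unitR R u -> unitR R v -> unitR R (u * v).
Proof.
move=> [hu [u' [hu' e]]] [hv [v' [hv' e']]]; split; first exact: srM.
exists (u' * v'); split; first exact: srM.
by rewrite mulrACA e e' mulr1.
Qed.

Lemma unitR_dvd x y : R x -> R y -> unitR R (x * y) -> unitR R x.
Proof.
move=> hx hy [hxy [z [hz e]]]; split=> //; exists (y * z).
by split; [exact: srM|rewrite mulrA].
Qed.

Lemma sr_prod s : (forall x, x \in s -> R x) -> R (\prod_(x <- s) x).
Proof.
move=> h; rewrite big_seq; apply: (big_ind R) => //; [exact: sr1|exact: srM].
Qed.

Lemma primeR_irred x : primeR x -> irredR R x.
Proof.
move=> [hx x0 nx px]; do 3!split=> //; move=> a b ha hb e.
have key c d : R c -> R d -> x = c * d -> (exists2 c', R c' & c = x * c') -> unitR R d.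
  move=> hc hd e' [c' hc' ec]; split=> //; exists c'; split=> //.
  by apply: (mulfI x0); rewrite mulr1 mulrCA -{1}[x * c']ec mulrC -e'.
have [|c' hc' [h|h]] := px a b 1 ha hb (sr1 sR); first by rewrite mulr1 e.
  by right; apply: (key a b) => //; exists c'.
by left; apply: (key b a) => //; [rewrite mulrC|exists c'].
Qed.

Lemma irredR_unit u x : unitR R u -> irredR R x -> irredR R (u * x).
Proof.
move=> [hu [u' [hu' eu]]] [hx [x0 [nx ix]]].
have u0 : u != 0 by apply: contra_eq_neq eu => ->; rewrite mul0r eq_sym oner_eq0.
split; first exact: srM.
split; first by rewrite mulf_neq0.
split=> [h|a b ha hb e].
  by apply: nx; apply: (unitR_dvd (y := u)) => //; rewrite mulrC.
have e' : x = u' * a * b by rewrite -mulrA -e mulrA [u' * u]mulrC eu mul1r.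
have [h|h] := ix _ b (srM sR hu' ha) hb e'; last by right.
by left; apply: (unitR_dvd (y := u')) => //; rewrite mulrC.
Qed.

Lemma irredR_product s : size s != 0%N -> (forall x, x \in s -> irredR R x) ->
  ~ unitR R (\prod_(x <- s) x).
Proof.
case: s => // x s _ h; rewrite big_cons => hu.
have [hx [_ [nx _]]] := h x (mem_head _ _).
apply: nx; apply: (unitR_dvd _ _ hu) => //; apply: sr_prod => y hy.
by have [] := h y; rewrite ?inE ?hy ?orbT.
Qed.

Lemma ord_seq_prod n (a : 'I_n -> {poly rat}) :
  \prod_(i < n) a i = \prod_(x <- [seq a i | i <- enum 'I_n]) x.
Proof. by rewrite big_map big_enum. Qed.

Section PrimeFactorization.
Hypothesis factor : forall x, R x -> x != 0 -> exists u s,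
  [/\ unitR R u, forall y, y \in s -> primeR y & x = u * \prod_(y <- s) y].

(** Split off a prime factor y of x: irreducibility makes the cofactor a unit, and primality passes
    to associates. *)
Lemma factor_irredR_prime x : irredR R x -> primeR x.
Proof.
move=> [hx [x0 [nx ix]]]; have [u [s [hu hs e]]] := factor hx x0.
case: s hs e => [|y s] hs e; first by case: nx; rewrite e big_nil mulr1.
have [hy y0 ny py] := hs y (mem_head _ _).
have hP : R (u * \prod_(z <- s) z).
  apply: srM => //; first by case: hu.
  by apply: sr_prod => z hz; have [] := hs z; rewrite ?inE ?hz ?orbT.
have e' : x = u * \prod_(z <- s) z * y by rewrite e big_cons mulrCA mulrC.
have [[_ [v [hv ev]]]|//] := ix _ _ hP hy e'.
split=> // a b c ha hb hc eab; set d := u * _ in hP ev.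
have ex : x = y * d by rewrite e big_cons mulrCA.
have [|c' hc' hab] := py a b (d * c) ha hb (srM sR hP hc); first by rewrite mulrA -ex.
exists (v * c'); first exact: srM.
by rewrite ex -mulrA [d * _]mulrA ev mul1r.
Qed.

Lemma primeR_dvd_prod x t c u : primeR x -> unitR R u -> R c ->
  (forall y, y \in t -> R y) -> u * \prod_(y <- t) y = x * c ->
  exists y c', [/\ y \in t, R c' & y = x * c'].
Proof.
move=> [hx x0 nx px] hu; elim: t c => [|y t IH] c hc ht.
  rewrite big_nil mulr1 => e; case: nx; apply: (unitR_dvd (y := c)) => //.
  by rewrite -e.
have ht' z : z \in t -> R z by move=> hz; apply: ht; rewrite inE hz orbT.
rewrite big_cons mulrCA => e.
have hP : R (u * \prod_(z <- t) z) by apply: srM => //; [case: hu|exact: sr_prod].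
have [c' hc' [h|h]] := px _ _ c (ht y (mem_head _ _)) hP hc e.
  by exists y, c'; rewrite mem_head.
have [z [d [hz hd ez]]] := IH c' hc' ht' h.
by exists z, d; rewrite inE hz orbT.
Qed.

(** The unit u collects what the matched factors leave behind: the prime x divides some y of t, say
    y = x c with c a unit, and c joins u for the remaining factors. *)
Lemma factor_unique s t u : unitR R u -> (forall x, x \in s -> irredR R x) ->
  (forall x, x \in t -> irredR R x) -> \prod_(x <- s) x = u * \prod_(x <- t) x ->
  exists t', [/\ perm_eq t' t, size t' = size s &
    forall i, (i < size s)%N -> assocR R (nth 0 s i) (nth 0 t' i)].
Proof.
elim: s t u => [|x s IH] t u hu hs ht.
  rewrite big_nil => e; exists [::]; split=> //.
  case: t ht e => // y t ht e; exfalso.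
  apply: (@irredR_product (y :: t)) => //; apply: (unitR_dvd (y := u)).
  - by apply: sr_prod => z /ht [].
  - by case: hu.
  by rewrite mulrC -e; exact: unitR1.
have hx := hs x (mem_head _ _); have px := factor_irredR_prime hx.
have hs' z : z \in s -> irredR R z by move=> hz; apply: hs; rewrite inE hz orbT.
have hP : R (\prod_(z <- s) z) by apply: sr_prod => z /hs' [].
rewrite big_cons => e.
have htR z : z \in t -> R z by move=> /ht [].
have [y [c [yt hc ey]]] := primeR_dvd_prod px hu hP htR (esym e).
have [_ x0 nx _] := px; have [_ [y0 [_ iy]]] := ht y yt.
have uc : unitR R c by have [] := iy x c (proj1 hx) hc ey.
have ept := perm_to_rem yt.
have [||||t' [pt st at']] := IH (rem y t) (u * c); first exact: unitRM.
- exact: hs'.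
- by move=> z /mem_rem /ht.
- apply: (mulfI x0); rewrite e (perm_big _ ept) big_cons /= ey; ring.
exists (y :: t'); split.
- by rewrite (perm_trans _ (_ : perm_eq (y :: rem y t) t)) ?perm_cons // perm_sym.
- by rewrite /= st.
move=> [_|i hi]; last exact: at'.
have [_ [d [hd ed]]] := uc; exists d; split.
  by split=> //; exists c; rewrite mulrC.
by rewrite /= ey mulrCA [d * c]mulrC ed mulr1.
Qed.

Lemma factor_UFD : is_UFD R.
Proof.
split.
  move=> x hx x0 nx; have [u [s [hu hs e]]] := factor hx x0.
  case: s hs e => [|y s] hs e; first by case: nx; rewrite e big_nil mulr1.
  (* A nonunit has at least one prime factor, and the first one absorbs the unit. *)
  pose t := (u * y) :: s; exists (size t), (fun i => nth 0 t i); split.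
    case=> [[|i]] /= hi.
      by apply: irredR_unit => //; apply: primeR_irred; apply: hs; rewrite mem_head.
    by apply: primeR_irred; apply: hs; rewrite inE mem_nth ?orbT.
  rewrite -(big_mkord xpredT (fun i => nth 0 t i)) -(big_nth 0 xpredT id) /t big_cons e.
  by rewrite big_cons mulrA.
move=> n m a b ha hb; rewrite !ord_seq_prod => e.
have [||t' [pt st at']] := factor_unique (u := 1) unitR1 _ _ (etrans e (esym (mul1r _))).
- by move=> x /mapP [i _ ->].
- by move=> x /mapP [i _ ->].
have enm : n = m.
  by have := perm_size pt; rewrite st (size_map a) (size_map b) !size_enum_ord.
split=> //; subst m.
have st' : size t' == n by rewrite st size_map size_enum_ord.
have sb : size [seq b i | i <- enum 'I_n] == n by rewrite size_map size_enum_ord.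
have /perm.tuple_permP [s es] : perm_eq (Tuple st') (Tuple sb) by [].
exists (perm.fun_of_perm.body s); split; first exact: injF_bij (@perm.perm_inj _ s).
move=> i; have := at' i; rewrite (size_map a) size_enum_ord => /(_ (ltn_ord i)).
rewrite (nth_map i) ?size_enum_ord // nth_ord_enum; congr assocR.
rewrite -[t']/(tval (Tuple st')) -tnth_nth.
have -> : Tuple st' = [tuple tnth (Tuple sb) (perm.fun_of_perm.body s i) | i < n].
  exact: val_inj.
rewrite tnth_mktuple (tnth_nth 0) /= (nth_map i) ?size_enum_ord // nth_ord_enum //.
Qed.
End PrimeFactorization.

Section FromUFD.
Hypothesis ufd : is_UFD R.

Lemma UFD_factor x : R x -> x != 0 -> ~ unitR R x ->
  exists s, (forall y, y \in s -> irredR R y) /\ x = \prod_(y <- s) y.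
Proof.
move=> hx x0 nx; have [n [a [ha ->]]] := ufd.1 x hx x0 nx.
exists [seq a i | i <- enum 'I_n]; split; last exact: ord_seq_prod.
by move=> y /mapP [i _ ->].
Qed.

Lemma UFD_unique s t : (forall y, y \in s -> irredR R y) -> (forall y, y \in t -> irredR R y) ->
  \prod_(x <- s) x = \prod_(x <- t) x ->
  size s = size t /\ forall x, x \in s -> exists2 y, y \in t & assocR R x y.
Proof.
move=> hs ht; rewrite (big_nth 0) (big_nth 0 _ _ (r := t)) !big_mkord => e.
have [||est [f [_ hf]]] := ufd.2 _ _ (fun i : 'I_(size s) => nth 0 s i)
    (fun i : 'I_(size t) => nth 0 t i) _ _ e.
- by move=> i; apply: hs; apply: mem_nth.
- by move=> i; apply: ht; apply: mem_nth.
split=> // x xs; have xi : (index x s < size s)%N by rewrite index_mem.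
exists (nth 0 t (f (Ordinal xi))); first exact: mem_nth.
by have := hf (Ordinal xi); rewrite /= nth_index.
Qed.

Lemma UFD_prime x : irredR R x -> primeR x.
Proof.
move=> irx; have [hx [x0 [nx _]]] := irx; split=> // a b c ha hb hc e.
have [a0|a0] := eqVneq a 0; first by exists 0; [exact: sr0|left; rewrite mulr0].
have [b0|b0] := eqVneq b 0; first by exists 0; [exact: sr0|right; rewrite mulr0].
have c0 : c != 0.
  by apply: contraNneq (mulf_neq0 a0 b0) => c0; rewrite e c0 mulr0.
have side a' b' : R b' -> unitR R a' -> a' * b' = x * c -> exists2 c', R c' & b' = x * c'.
  move=> hb' [ha' [d [hd ed]]] e'; exists (d * c); first exact: srM.
  by rewrite mulrCA -e' mulrA [d * a']mulrC ed mul1r.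
have [ua|na] := boolp.EM (unitR R a).
  by have [c' hc' h] := side a b hb ua e; exists c' => //; right.
have [ub|nb] := boolp.EM (unitR R b).
  have e' : b * a = x * c by rewrite mulrC.
  by have [c' hc' h] := side b a ha ub e'; exists c' => //; left.
have [sa [hsa ea]] := UFD_factor ha a0 na; have [sb [hsb eb]] := UFD_factor hb b0 nb.
(* A factorization of [x * c] containing an associate of x, to be compared with one of [a * b]; if c
   is a unit, it is absorbed into x. *)
have [sc [hsc ec]] : exists s, (forall y, y \in s -> irredR R y) /\
    x * c = \prod_(y <- s) y /\ exists2 y, y \in s & assocR R x y.
  have [uc|nc] := boolp.EM (unitR R c).
    exists [:: c * x]; split; last split.
    - by move=> y; rewrite inE => /eqP ->; apply: irredR_unit.
    - by rewrite big_seq1 mulrC.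
    have [_ [d [hd ed]]] := uc.
    exists (c * x); first by rewrite mem_head.
    exists d; split; first by split=> //; exists c; rewrite mulrC.
    by rewrite mulrA [d * c]mulrC ed mul1r.
  have [s [hs es]] := UFD_factor hc c0 nc; exists (x :: s); split; last split.
  - by move=> y; rewrite inE => /predU1P [->|/hs].
  - by rewrite big_cons es.
  by exists x; [rewrite mem_head|exists 1; split; [exact: unitR1|rewrite mul1r]].
case: ec => ec [y yc [u [hu exy]]].
have [||_ assoc] := @UFD_unique sc (sa ++ sb) hsc.
- by move=> z; rewrite mem_cat => /orP [/hsa|/hsb].
- by rewrite big_cat /= -ea -eb e ec.
have [z zab [u' [hu' ey]]] := assoc y yc.
have [hv [d [hd ed]]] := unitRM hu hu'.
have ez : z = x * d by rewrite exy ey mulrA mulrAC ed mul1r.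
have key s q : (forall y, y \in s -> irredR R y) -> q = \prod_(y <- s) y -> z \in s ->
    exists2 c', R c' & q = x * c'.
  move=> hs -> zs; exists (d * \prod_(y <- rem z s) y).
    by apply: srM => //; apply: sr_prod => q' /mem_rem /hs [].
  by rewrite (perm_big _ (perm_to_rem zs)) big_cons ez mulrA.
move: zab; rewrite mem_cat => /orP [zs|zs].
  by have [c' hc' h] := key sa a hsa ea zs; exists c' => //; left.
by have [c' hc' h] := key sb b hsb eb zs; exists c' => //; right.
Qed.
End FromUFD.
End UFD.

Lemma irreducible_factorization (F : fieldType) (f : {poly F}) : f != 0 ->
  exists (c : F) (s : seq {poly F}), [/\ c != 0,
    forall y, y \in s -> irreducible_poly y & f = c%:P * \prod_(y <- s) y].
Proof.
have [n] := ubnP (size f); elim: n f => // n IH f hn f0.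
have sf : (0 < size f)%N by rewrite size_poly_gt0.
have [/size_poly1P [c c0 ->]|s1] := boolp.EM (size f == 1%N).
  by exists c, [::]; split=> //; rewrite big_nil mulr1.
have [irr|nirr] := boolp.EM (irreducible_poly f).
  exists 1, [:: f]; split; [exact: oner_neq0|by move=> y; rewrite inE => /eqP ->|].
  by rewrite big_seq1 mul1r.
have [q [q1 qf nqf]] : exists q : {poly F}, [/\ size q != 1%N, q %| f & ~~ (q %= f)].
  apply: boolp.contrapT => h; apply: nirr; split; first by rewrite ltn_neqAle eq_sym sf andbT; exact/negP.
  move=> q q1 qf; apply: boolp.contrapT => /negP nqf; apply: h; by exists q.
have [g eg] := dvdpP _ _ qf.
have [g0 q0] : g != 0 /\ q != 0.
  by apply/andP; rewrite -negb_or -mulf_eq0 -eg.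
have sq : (0 < size q)%N by rewrite size_poly_gt0.
have sg : (0 < size g)%N by rewrite size_poly_gt0.
have sE : (size f = (size g + size q).-1)%N by rewrite eg size_mul.
have sg1 : size g != 1%N.
  apply: contra nqf => /size_poly1P [c c0 gc]; rewrite eg gc mul_polyC.
  by rewrite eqp_sym eqp_scale.
have [||c [s [c0 hs e1]]] := IH g => //; first by lia.
have [||d [t [d0 ht e2]]] := IH q => //; first by lia.
exists (c * d), (s ++ t); split; first by rewrite mulf_neq0.
  by move=> y; rewrite mem_cat => /orP [/hs|/ht].
by rewrite eg e1 e2 big_cat /= polyCM mulrACA.
Qed.

Lemma irreducible_dvd_mul (F : fieldType) (y a b : {poly F}) : irreducible_poly y ->
  y %| a * b -> (y %| a) || (y %| b).
Proof.
move=> irr h; apply/orP; have [ya|na] := boolP (y %| a); [by left|right].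
by rewrite -(Gauss_dvdpr _ (q := a)) // irreducible_poly_coprime.
Qed.

(** * Factoriality of Q[X] and of unramified valuation rings *)

Section Rings.
Variables (p : nat) (hp : prime p) (R : {poly rat} -> Prop).
Let p0 : (p%:R : rat) != 0. Proof. by rewrite pnatr_eq0 -lt0n prime_gt0. Qed.

Lemma full_UFD : (forall f, R f) -> is_UFD R.
Proof.
move=> hR; have sR : subring_pred R by split.
apply: factor_UFD => // x _ x0; have [c [s [c0 hs e]]] := irreducible_factorization x0.
exists c%:P, s; split=> //.
  by split=> //; exists c^-1%:P; split=> //; rewrite -polyCM mulfV.
move=> y /hs irr; split=> //; first exact: irredp_neq0.
  move=> [_ [w [_ e']]]; have := congr1 (fun f : {poly rat} => size f) e'.
  rewrite size_polyC oner_neq0 /= => /eqP; rewrite size_mul_eq1 => /andP [/eqP h _].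
  by have := irr.1; rewrite h.
move=> a b d _ _ _ e'.
have /orP [/dvdpP [q eq]|/dvdpP [q eq]] : (y %| a) || (y %| b).
- by apply: irreducible_dvd_mul => //; rewrite e' dvdp_mulr.
- by exists q => //; left; rewrite mulrC.
by exists q => //; right; rewrite mulrC.
Qed.

Lemma padicv_ge0 c : inZploc p c -> 0 <= padicv p c.
Proof. by move=> h; rewrite /padicv [logn p (absz (denq c))]lognE (negbTE h) !andbF subr0. Qed.

Lemma unramified_ring_UFD : unramified_valuation_ring p R -> is_UFD R.
Proof.
move=> [w [wM wD wc wR]].
have w1 : w 1 = 0 by have := wM 1 1 (oner_neq0 _) (oner_neq0 _); rewrite mulr1; lia.
have RE f : f != 0 -> R f <-> 0 <= w f.
  by move=> f0; rewrite wR; split=> [[/eqP|//]|]; [rewrite (negbTE f0)|right].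
have wN f : w (- f) = w f.
  have [->|f0] := eqVneq f 0; first by rewrite oppr0.
  have n1 : (-1 : {poly rat}) != 0 by rewrite oppr_eq0 oner_eq0.
  have h : w (-1) + w (-1) = 0 by rewrite -wM // mulrNN mulr1.
  by rewrite -mulN1r wM //; lia.
have sR : subring_pred R.
  split; first by apply/wR; right; rewrite w1.
    move=> f g /wR hf /wR hg; apply/wR.
    have [->|f0] := eqVneq f 0; first by rewrite sub0r wN; case: hg => [->|]; [left; rewrite oppr0|right].
    have [->|g0] := eqVneq g 0; first by rewrite subr0.
    have [->|fg0] := eqVneq (f - g) 0; first by left.
    case: hf hg => [/eqP|hf [/eqP|hg]]; rewrite ?(negbTE f0) ?(negbTE g0) //.
    have gN0 : - g != 0 by rewrite oppr_eq0.
    by right; case: (wD f (- g) f0 gN0 fg0) => [|]; [|rewrite wN]; apply: le_trans.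
  move=> f g /wR hf /wR hg; apply/wR.
  have [->|f0] := eqVneq f 0; first by rewrite mul0r; left.
  have [->|g0] := eqVneq g 0; first by rewrite mulr0; left.
  case: hf hg => [/eqP|hf [/eqP|hg]]; rewrite ?(negbTE f0) ?(negbTE g0) //.
  by right; rewrite wM //; lia.
have wge0 c : c != 0 -> inZploc p c -> 0 <= w c%:P.
  by move=> c0 /padicv_ge0; rewrite -wc // ler0z.
have punit (u : rat) : u != 0 -> inZploc p u -> inZploc p u^-1 ->
    unitR R u%:P /\ w u%:P = 0.
  move=> u0 hu hu'; have u0' : u^-1 != 0 by rewrite invr_eq0.
  have wu := wge0 u u0 hu; have wu' := wge0 _ u0' hu'.
  split; last first.
    have h (m n : int) : 0 = m + n -> 0 <= m -> 0 <= n -> m = 0 by lia.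
    apply: (h _ _ _ wu wu').
    by have := wM u%:P u^-1%:P; rewrite !polyC_eq0 -polyCM mulfV // w1 => /(_ u0 u0').
  split; first by apply/RE; rewrite ?polyC_eq0.
  exists u^-1%:P; split; first by apply/RE; rewrite ?polyC_eq0.
  by rewrite -polyCM mulfV.
have wp : w p%:R%:P = 1.
  by apply: (@intr_inj rat); rewrite wc // (padicv_int p p) absz_nat (pfactorK 1 hp).
have wpn (n : nat) : w (p%:R ^+ n)%:P = n.
  elim: n => [|n IH]; first by rewrite expr0.
  by rewrite exprS polyCM wM ?polyC_eq0 ?expf_neq0 // wp IH.
have wpk (k : int) : w (p%:R ^ k)%:P = k.
  case: k => n; first exact: wpn.
  have := wM (p%:R ^ (Negz n))%:P (p%:R ^+ n.+1)%:P.
  rewrite !polyC_eq0 expfz_neq0 // expf_neq0 // wpn => /(_ isT isT).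
  by rewrite -polyCM NegzE -exprnN mulVf ?expf_neq0 // w1; lia.
(* Scaling to value 0 ensures that dividing by [norm y] in Q[X] preserves values, so that the
   quotient of an element of R stays in R. *)
pose norm (y : {poly rat}) := (p%:R ^ (- w y))%:P * y.
have pk0 (k : int) : (p%:R ^ k)%:P != 0 :> {poly rat} by rewrite polyC_eq0 expfz_neq0.
have wnorm y : y != 0 -> norm y != 0 /\ w (norm y) = 0.
  by move=> y0; rewrite mulf_neq0 // wM // wpk addNr.
have norm_prod (s : seq {poly rat}) : (forall y, y \in s -> irreducible_poly y) ->
    exists d : rat, [/\ d != 0, \prod_(y <- s) y = d%:P * \prod_(y <- map norm s) y,
      \prod_(y <- map norm s) y != 0 & w (\prod_(y <- map norm s) y) = 0].
  elim: s => [|y s IH] hs; first by exists 1; rewrite !big_nil mulr1; split=> //; exact: oner_neq0.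
  have y0 : y != 0 by exact: irredp_neq0 (hs y (mem_head _ _)).
  have hs' z : z \in s -> irreducible_poly z.
    by move=> hz; have := hs z; rewrite inE hz orbT; apply.
  have [d [d0 e P0 wP]] := IH hs'.
  have [n0 wn] := wnorm y y0.
  exists (p%:R ^ (w y) * d); rewrite !big_cons e; split=> //.
  - by rewrite mulf_neq0 // expfz_neq0.
  - rewrite /norm polyCM.
    have e1 : (p%:R ^ w y)%:P * (p%:R ^ (- w y))%:P = 1 :> {poly rat}.
      by rewrite -polyCM -expfzDr // subrr expr0z.
    by rewrite -[LHS]mul1r -e1; ring.
  - by rewrite mulf_neq0.
  by rewrite wM // wn wP.
have constR (u : {poly rat}) : unitR R u -> exists2 c : rat, c != 0 & u = c%:P.
  move=> [_ [t [_ e]]]; have := congr1 (fun f : {poly rat} => size f) e.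
  rewrite size_polyC oner_neq0 /= => /eqP; rewrite size_mul_eq1 => /andP [/size_poly1P [c c0 ->] _].
  by exists c.
have prime_p : primeR R p%:R%:P.
  have pP0 : (p%:R%:P : {poly rat}) != 0 by rewrite polyC_eq0.
  split=> //; first by apply/RE; rewrite ?wp.
    move=> [_ [t [ht e]]]; have t0 : t != 0.
      by apply: contra_eq_neq e => ->; rewrite mulr0 eq_sym oner_neq0.
    by have := wM _ _ pP0 t0; rewrite e w1 wp; move/(RE _ t0): ht; lia.
  move=> a b c ha hb hc e.
  have [a0|a0] := eqVneq a 0; first by exists 0; [exact: sr0|left; rewrite mulr0].
  have [b0|b0] := eqVneq b 0; first by exists 0; [exact: sr0|right; rewrite mulr0].
  have c0 : c != 0 by apply: contraNneq (mulf_neq0 a0 b0) => c0; rewrite e c0 mulr0.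
  (* An element of R of value at least 1 is divisible by p in R, and [w a + w b = 1 + w c] forces
     this for a or b. *)
  have := wM a b a0 b0; rewrite e wM // wp => we.
  move/(RE _ a0): ha => ha; move/(RE _ b0): hb => hb; move/(RE _ c0): hc => hc.
  have divp f : f != 0 -> 1 <= w f -> exists2 c', R c' & f = p%:R%:P * c'.
    move=> f0 hf; exists ((p%:R ^ (-1))%:P * f).
      by apply/RE; rewrite ?mulf_neq0 // wM // wpk; lia.
    by rewrite mulrA -polyCM -[X in X * _ ^ _]expr1z -expfzDr // subrr expr0z mul1r.
  have [h|h] : 1 <= w a \/ 1 <= w b by lia.
    by have [c' hc' h'] := divp a a0 h; exists c' => //; left.
  by have [c' hc' h'] := divp b b0 h; exists c' => //; right.
have prime_norm y : irreducible_poly y -> primeR R (norm y).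
  move=> irr; have y0 := irredp_neq0 irr; have [n0 wn] := wnorm y y0.
  have eqn : norm y %= y by rewrite /norm mul_polyC eqp_scale // expfz_neq0.
  have irrn : irreducible_poly (norm y).
    split; first by rewrite (eqp_size eqn) irr.1.
    move=> q q1; rewrite (eqp_dvdr _ eqn) => /(irr.2 q q1) h.
    by apply: eqp_trans h _; rewrite eqp_sym.
  split=> //; first by apply/RE; rewrite ?wn.
    move=> /constR [c c0 ec]; have := irrn.1; rewrite ec size_polyC c0.
    by [].
  move=> a b c ha hb hc e.
  have side f : R f -> norm y %| f -> exists2 c', R c' & f = norm y * c'.
    move=> hf /dvdpP [q eq]; have [f0|f0] := eqVneq f 0.
      by exists 0; [exact: sr0|rewrite mulr0].
    exists q; last by rewrite mulrC.
    have q0 : q != 0 by apply: contraNneq f0 => q0; rewrite eq q0 mul0r.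
    by apply/RE => //; move/(RE _ f0): hf; rewrite eq wM // wn addr0.
  have /orP [h|h] : (norm y %| a) || (norm y %| b).
  - by apply: irreducible_dvd_mul => //; rewrite e dvdp_mulr.
  - by have [c' hc' h'] := side a ha h; exists c' => //; left.
  by have [c' hc' h'] := side b hb h; exists c' => //; right.
apply: factor_UFD => // x hx x0.
have [c [s [c0 hs e]]] := irreducible_factorization x0.
have [d [d0 ed P0 wP]] := norm_prod s hs.
have cd0 : c * d != 0 by rewrite mulf_neq0.
(* The normalized factors have value 0, so the exponent of p in the constant [c * d] is [w x]; it is
   nonnegative for x in R and gives the number of factors p. *)
have [k [u [eu u0 hu hu' _]]] := padic_dec hp cd0.
have [uu wu] := punit u u0 hu hu'.
have ex : x = (c * d)%:P * \prod_(y <- map norm s) y by rewrite e ed mulrA polyCM.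
have uP0 : u%:P != 0 :> {poly rat} by rewrite polyC_eq0.
have wk : w x = k.
  by rewrite ex wM ?polyC_eq0 // wP addr0 eu polyCM wM // wpk wu addr0.
move/(RE _ x0): hx; rewrite wk => k0.
exists u%:P, (nseq (absz k) p%:R%:P ++ map norm s); split=> //.
  move=> y; rewrite mem_cat => /orP [/nseqP [-> _]|/mapP [z zs ->]] //.
  exact: prime_norm (hs z zs).
rewrite ex big_cat /= big_nseq iter_mulr_1 -polyC_exp mulrA -polyCM eu.
by rewrite -{1}(gez0_abs k0) mulrC [u * _]mulrC mulrC.
Qed.
End Rings.

(** * From unique factorization to a valuation *)

Section FromUFD.
Variables (p : nat) (hp : prime p) (R : {poly rat} -> Prop) (sR : subring_pred R).
Hypothesis HZ : forall f, polyZp p f -> R f.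
Let p0 : (p%:R : rat) != 0. Proof. by rewrite pnatr_eq0 -lt0n prime_gt0. Qed.

Notation pk k := ((p%:R : rat) ^ k)%:P.

Lemma inZploc0 : inZploc p 0.
Proof. by rewrite /inZploc /= dvdn1; apply: contraTneq hp => ->. Qed.

Lemma inZploc_int (n : int) : inZploc p n%:~R.
Proof. by rewrite /inZploc denq_int dvdn1; apply: contraTneq hp => ->. Qed.

Lemma constZ c : inZploc p c -> R c%:P.
Proof. by move=> hc; apply: HZ => i; rewrite coefC; case: eqP => // _; exact: inZploc0. Qed.

Lemma intpolyR (F : {poly int}) : R (map_poly intr F).
Proof. by apply: HZ => i; rewrite coef_map; exact: inZploc_int. Qed.

Lemma pkD (i j : int) : pk (i + j) = pk i * pk j :> {poly rat}.
Proof. by rewrite -polyCM expfzDr. Qed.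

Lemma pkS (n : nat) : pk 1 * pk n%:Z = pk n.+1%:Z :> {poly rat}.
Proof. by rewrite -pkD. Qed.

Lemma pk_nat (n : nat) : R (pk n).
Proof. by rewrite -exprnP -natrX; apply: constZ; exact: (inZploc_int (p ^ n)%N). Qed.

Lemma pk_ge0 (k : int) : 0 <= k -> R (pk k).
Proof. by case: k => // n _; exact: pk_nat. Qed.

Lemma inv_p_full : R (pk (-1)) -> forall f, R f.
Proof.
move=> hp1; have hpk (k : int) : R (pk k).
  case: k => n; first exact: pk_nat.
  rewrite NegzE -[(- _)%R]mulN1r -exprz_exp -exprnP polyC_exp; exact: (srX sR _ hp1).
have hc c : R c%:P.
  have [->|c0] := eqVneq c 0; first by rewrite polyC0; exact: (sr0 sR).
  by have [k [u [-> _ hu _ _]]] := padic_dec hp c0; rewrite polyCM; apply: srM => //; apply: constZ.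
move=> f; rewrite -[f]coefK poly_def; apply: (sr_sum sR) => i _.
rewrite -mul_polyC; apply: srM => //; apply: srX => //.
by rewrite -(map_polyX intr); exact: intpolyR.
Qed.

Hypothesis nfull : ~ R (pk (-1)).

Lemma neg_pk (k : int) : k < 0 -> R (pk k) -> False.
Proof.
move=> k0 hk; apply: nfull; have -> : (-1 : int) = k + (- k - 1) by lia.
by rewrite pkD; apply: srM => //; apply: pk_ge0; lia.
Qed.

Lemma constR_padic c : c != 0 -> R c%:P -> 0 <= padicv p c.
Proof.
move=> c0 hc; have [k [u [e u0 hu hu' ->]]] := padic_dec hp c0.
rewrite ler0z leNgt; apply/negP => k0; apply: (neg_pk k0).
have -> : pk k = c%:P * u^-1%:P by rewrite -polyCM e mulfK.
by apply: srM => //; apply: constZ.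
Qed.

Lemma p_irred : irredR R (pk 1).
Proof.
have pP0 (k : int) : pk k != 0 :> {poly rat} by rewrite polyC_eq0 expfz_neq0.
split; first exact: pk_nat.
split=> //; split.
  move=> [_ [w [hw e]]]; apply: nfull; suff <- : w = pk (-1) by [].
  by apply: (mulfI (pP0 1)); rewrite e -pkD subrr expr0z.
move=> a b ha hb e.
have [a0 b0] : a != 0 /\ b != 0 by apply/andP; rewrite -negb_or -mulf_eq0 -e.
have sE : (size a + size b).-1 = 1%N by rewrite -size_mul // -e size_polyC expfz_neq0.
have sa : (0 < size a)%N by rewrite size_poly_gt0.
have sb : (0 < size b)%N by rewrite size_poly_gt0.
have [/size_poly1P [x x0 ea] /size_poly1P [y y0 eb]] : size a == 1%N /\ size b == 1%N.
  by split; apply/eqP; lia.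
have [i [u [ex u0 hu hu' hi]]] := padic_dec hp x0.
have [j [t [ey t0 ht ht' hj]]] := padic_dec hp y0.
have i0 : 0 <= i by have := constR_padic x0; rewrite -ea hi ler0z; apply.
have j0 : 0 <= j by have := constR_padic y0; rewrite -eb hj ler0z; apply.
have unit z : z != 0 -> inZploc p z -> inZploc p z^-1 -> unitR R z%:P.
  move=> z0 hz hz'; split; first exact: constZ.
  by exists z^-1%:P; split; [exact: constZ|rewrite -polyCM mulfV].
have [ei|ni] := eqVneq i 0; first by left; rewrite ea ex ei expr0z mul1r; exact: unit.
have [ej|nj] := eqVneq j 0; first by right; rewrite eb ey ej expr0z mul1r; exact: unit.
exfalso; apply: nfull.
(* Here p equals p^(i+j) u t with i and j at least 1; dividing by p^2 exhibits 1/p as an element of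
   R. *)
have -> : pk (-1) = pk (i + j - 2) * (u * t)%:P.
  apply: (mulfI (pP0 2)); rewrite mulrA -!pkD e ea eb ex ey.
  have -> : 2 + (i + j - 2) = i + j by lia.
  rewrite expfzDr // -!polyCM; congr _%:P; ring.
by apply: srM => //; [apply: pk_ge0; lia|rewrite polyCM; apply: srM => //; apply: constZ].
Qed.

Hypothesis ufd : is_UFD R.

Lemma p_prime : primeR R (pk 1).
Proof. exact: (UFD_prime sR ufd p_irred). Qed.

(* The exponent of p is bounded by the number of irreducible factors. *)
Lemma p_exponent_bounded f : R f -> f != 0 ->
  exists N : nat, forall n : nat, R (pk (- n%:Z) * f) -> (n <= N)%N.
Proof.
move=> hf f0; have [hpp _ npu _] := p_prime.
have split_f n : pk n%:Z * (pk (- n%:Z) * f) = f by rewrite mulrA -pkD subrr expr0z mul1r.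
have irrn n y : y \in nseq n (pk 1) -> irredR R y by move=> /nseqP [-> _]; exact: p_irred.
have prodn n : \prod_(y <- nseq n (pk 1)) y = pk n%:Z.
  by rewrite big_nseq iter_mulr_1 expr1z -exprnP polyC_exp.
have [fu|nfu] := boolp.EM (unitR R f).
  exists 0%N => -[//|n] hg; exfalso; apply: npu.
  apply: (unitR_dvd sR (y := pk n%:Z * (pk (- n.+1%:Z) * f))) => //.
    by apply: srM => //; exact: pk_nat.
  by rewrite [pk 1 * _]mulrA pkS split_f.
have [s [hs es]] := UFD_factor ufd hf f0 nfu; exists (size s) => n hg.
have g0 : pk (- n%:Z) * f != 0 by rewrite mulf_neq0 // polyC_eq0 expfz_neq0.
have [gu|ngu] := boolp.EM (unitR R (pk (- n%:Z) * f)).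
  case: n hg g0 gu => // n hg g0 gu.
  have [|||<- _] := @UFD_unique R ufd ((pk (- n.+1%:Z) * f * pk 1) :: nseq n (pk 1)) s.
  - move=> y; rewrite inE => /predU1P [->|/irrn //].
    exact: (irredR_unit sR gu p_irred).
  - by [].
  - by rewrite big_cons prodn -es -[LHS]mulrA pkS mulrC split_f.
  by rewrite /= size_nseq.
have [t [ht et]] := UFD_factor ufd hg g0 ngu.
have [|||<- _] := @UFD_unique R ufd (nseq n (pk 1) ++ t) s.
- by move=> y; rewrite mem_cat => /orP [/irrn|/ht].
- by [].
- by rewrite big_cat /= prodn -et -es split_f.
by rewrite size_cat size_nseq leq_addr.
Qed.

(** The p-part p^j of a common denominator brings f into R; the bound on exponents gives a largest
    admissible one for p^j f, which is then shifted back by j. *)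
Lemma p_order_exists f : f != 0 -> exists k : int,
  R (pk (- k) * f) /\ ~ R (pk (- k - 1) * f).
Proof.
move=> f0; have [F [a a0 e]] := rat_poly_scale f.
have a1 : (a%:~R : rat) != 0 by rewrite intr_eq0.
have [j [u [ea u0 hu hu' _]]] := padic_dec hp a1.
have hf0 : R (pk j * f).
  have -> : pk j * f = u^-1%:P * map_poly intr F.
    rewrite e -mul_polyC mulrA -polyCM ea; congr (_%:P * _).
    by field; rewrite u0 expfz_neq0.
  by apply: srM => //; [exact: constZ|exact: intpolyR].
have f1 : pk j * f != 0 by rewrite mulf_neq0 // polyC_eq0 expfz_neq0.
have [N hN] := p_exponent_bounded hf0 f1.
have [|n [hn mn]] := @classic_min (fun n => ~ R (pk (- n%:Z) * (pk j * f))).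
  by exists N.+1 => /hN; rewrite ltnn.
case: n hn mn => [|n] hn mn; first by case: hn; rewrite oppr0 expr0z mul1r.
exists (n%:Z - j); split.
  have := mn n (ltnSn n); rewrite mulrA -pkD => /boolp.contrapT.
  by have -> : - n%:Z + j = - (n%:Z - j) by lia.
by move: hn; rewrite mulrA -pkD; have -> : - n.+1%:Z + j = - (n%:Z - j) - 1 by lia.
Qed.

Lemma UFD_unramified_ring : unramified_valuation_ring p R.
Proof.
have /boolp.choice [w hw] : forall f, exists k : int, f != 0 ->
    R (pk (- k) * f) /\ ~ R (pk (- k - 1) * f).
  move=> f; have [->|f0] := eqVneq f 0; first by exists 0; case/eqP.
  by have [k hk] := p_order_exists f0; exists k.
have wE f (k : int) : f != 0 -> R (pk (- k) * f) <-> k <= w f.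
  move=> f0; have [h1 h2] := hw f f0; split=> h.
    rewrite leNgt; apply/negP => hk; apply: h2.
    have -> : - w f - 1 = (k - w f - 1) + - k by lia.
    by rewrite pkD -mulrA; apply: srM => //; apply: pk_ge0; lia.
  have -> : - k = (w f - k) + - w f by lia.
  by rewrite pkD -mulrA; apply: srM => //; apply: pk_ge0; lia.
have [_ _ _ pp] := p_prime.
exists w; split.
- move=> f g f0 g0; have fg0 := mulf_neq0 f0 g0.
  have [[hf nf] [hg ng]] := (hw f f0, hw g g0).
  have efg : pk (- (w f + w g)) * (f * g) = (pk (- w f) * f) * (pk (- w g) * g).
    by rewrite opprD pkD mulrACA.
  apply/eqP; rewrite eq_le; apply/andP; split; last first.
    by apply/(wE _ _ fg0); rewrite efg; apply: srM.
  rewrite leNgt; apply/negP => h.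
  (* A larger value would let p divide the product of f and g, each already divided by its maximal
     power of p; as p is prime it would divide one of them, against maximality. *)
  have hc : R (pk (- (w f + w g + 1)) * (f * g)) by apply/(wE _ _ fg0); rewrite lezD1.
  have [|c' hc' [e|e]] := pp _ _ _ hf hg hc.
  + by rewrite -efg [RHS]mulrA -pkD; congr (pk _ * _); move: (w f + w g) => m; lia.
  + apply: nf; rewrite addrC pkD -mulrA e mulrA -pkD addNr expr0z mul1r //.
  apply: ng; rewrite addrC pkD -mulrA e mulrA -pkD addNr expr0z mul1r //.
- move=> f g f0 g0 fg0; have [h|/ltW h] := leP (w f) (w g); [left|right];
    apply/(wE _ _ fg0); rewrite mulrDr; apply: srD => //; apply/wE => //.
- move=> c c0; have [k [u [e u0 hu hu' ->]]] := padic_dec hp c0; congr _%:~R.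
  have cP0 : c%:P != 0 :> {poly rat} by rewrite polyC_eq0.
  apply/eqP; rewrite eq_le; apply/andP; split; last first.
    apply/(wE _ _ cP0); rewrite e polyCM mulrA -pkD addNr expr0z mul1r; exact: constZ.
  rewrite leNgt; apply/negP => h; apply: nfull.
  have h1 : R (pk (- (k + 1)) * c%:P) by apply/(wE _ _ cP0); rewrite lezD1.
  have -> : pk (-1) = pk (- (k + 1)) * c%:P * u^-1%:P.
    rewrite e polyCM -!mulrA -[u%:P * _]polyCM mulfV // mulr1 -pkD.
    by congr (pk _); lia.
  by apply: srM => //; apply: constZ.
move=> f; have [->|f0] := eqVneq f 0; first by split=> _; [left|exact: sr0].
have := wE f 0 f0; rewrite oppr0 expr0z mul1r => ->.
by split=> [h|[/eqP|//]]; [right|rewrite (negbTE f0)].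
Qed.
End FromUFD.

(** * Discrete valuation rings of Q(X) *)

Lemma fraction_decomposition (D : idomainType) (x : {fraction D}) :
  exists n d : D, d != 0 /\ x = tofrac n / tofrac d.
Proof.
suff [n [d [d0 e]]] : exists n d : D, d != 0 /\ x * tofrac d = tofrac n.
  by exists n, d; split=> //; rewrite -e mulfK // tofrac_eq0.
elim/generic_quotient.quotW: x => x; exists (frac x).1, (frac x).2.
have d0 : (frac x).2 != 0 := denom_ratioP x.
split=> //; unlock tofrac; rewrite -[LHS]FracField.pi_mul /FracField.mulf.
rewrite !numden_Ratio ?oner_neq0 // mulr1.
apply/generic_quotient.eqmodP; rewrite /= FracField.equivfE.
by rewrite !numden_Ratio ?oner_neq0 // mulr1 mulrC.
Qed.

Section DVR.
Variables (p : nat) (hp : prime p) (R : {poly rat} -> Prop).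
Let p0 : (p%:R : rat) != 0. Proof. by rewrite pnatr_eq0 -lt0n prime_gt0. Qed.

Lemma unramified_ring_DVR : unramified_valuation_ring p R ->
  exists W : QX -> Prop, is_DVR W /\ (forall q : rat, W (ratF q) <-> inZploc p q) /\
    unramifiedW W /\ (forall f, R f <-> W (polyF f)).
Proof.
move=> [w [wM wD wc wR]].
(* The value is specified through all fractions representing x, so that it can be computed from any
   convenient one; at x = 0 the condition is empty. *)
have /boolp.choice [W hW] : forall x : QX, exists k : int, forall n d : {poly rat},
    n != 0 -> d != 0 -> x = tofrac n / tofrac d -> k = w n - w d.
  move=> x; have [a [b [b0 e]]] := fraction_decomposition x.
  exists (w a - w b) => n d n0 d0; rewrite e => /eqP.
  rewrite eqr_div ?tofrac_eq0 // -!tofracM tofrac_eq => /eqP e'.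
  have a0 : a != 0.
    by apply: contra_eq_neq e' => ->; rewrite mul0r eq_sym mulf_neq0.
  have := congr1 w e'; rewrite !wM //.
  by move: (w a) (w b) (w n) (w d) => i j k l; lia.
have W_poly f : f != 0 -> W (tofrac f) = w f.
  move=> f0; rewrite (hW _ f 1) ?oner_neq0 ?tofrac1 ?divr1 //.
  have := wM 1 1 (oner_neq0 _) (oner_neq0 _); rewrite mulr1.
  by move: (w 1) (w f) => i j; lia.
have dec x : x != 0 -> exists n d : {poly rat}, [/\ n != 0, d != 0, x = tofrac n / tofrac d & W x = w n - w d].
  move=> x0; have [n [d [d0 e]]] := fraction_decomposition x; exists n, d.
  have n0 : n != 0 by apply: contraNneq x0 => n0; rewrite e n0 tofrac0 mul0r.
  by split=> //; apply: hW.
have WM x y : x != 0 -> y != 0 -> W (x * y) = W x + W y.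
  move=> /dec [n [d [n0 d0 -> ->]]] /dec [m [e [m0 e0 -> ->]]].
  rewrite (hW _ (n * m) (d * e)) ?mulf_neq0 //; last by rewrite mulf_div -!tofracM.
  by rewrite !wM //; move: (w n) (w d) (w m) (w e) => i j k l; lia.
have WD x y : x != 0 -> y != 0 -> x + y != 0 -> W x <= W (x + y) \/ W y <= W (x + y).
  move=> /dec [n [d [n0 d0 ex ->]]] /dec [m [e [m0 e0 ey ->]]] xy0.
  have exy : x + y = tofrac (n * e + m * d) / tofrac (d * e).
    by rewrite ex ey addf_div ?tofrac_eq0 // -!tofracM -tofracD.
  have s0 : n * e + m * d != 0.
    by apply: contraNneq xy0 => s0; rewrite exy s0 tofrac0 mul0r.
  rewrite (hW _ _ _ s0 (mulf_neq0 d0 e0) exy).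
  have := wD _ _ (mulf_neq0 n0 e0) (mulf_neq0 m0 d0) s0; rewrite !wM //.
  move: (w n) (w d) (w m) (w e) (w (n * e + m * d)) => i j k l s.
  by case=> h; [left|right]; lia.
have W1 : W 1 = 0.
  have := WM 1 1 (oner_neq0 _) (oner_neq0 _); rewrite mulr1.
  by move: (W 1) => i; lia.
have Wrat (c : rat) : c != 0 -> (W (ratF c))%:~R = padicv p c.
  by move=> c0; rewrite W_poly ?polyC_eq0 // wc.
have Wpk (k : int) : W (ratF (p%:R ^ k)) = k.
  have wp : W (ratF p%:R) = 1.
    by apply: (@intr_inj rat); rewrite Wrat // (padicv_int p p) absz_nat (pfactorK 1 hp).
  have F0 : (ratF p%:R : QX) != 0 by rewrite tofrac_eq0 polyC_eq0.
  have wpn (n : nat) : W (ratF p%:R ^+ n) = n.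
    elim: n => [|n IH]; first by rewrite expr0.
    by rewrite exprS WM ?expf_neq0 // wp IH.
  have eX (n : nat) : ratF (p%:R ^+ n) = ratF p%:R ^+ n.
    by rewrite /ratF polyC_exp tofracXn.
  case: k => n; first by rewrite -exprnP eX wpn.
  have G0 : ratF (p%:R ^ (Negz n)) != 0 :> QX by rewrite tofrac_eq0 polyC_eq0 expfz_neq0.
  have := WM _ _ G0 (expf_neq0 n.+1 F0); rewrite wpn -eX /ratF -tofracM -polyCM.
  rewrite NegzE -exprnN mulVf ?expf_neq0 // tofrac1 W1.
  by move: (W _) => i; lia.
have unit_quotient x y : x != 0 -> y != 0 -> W x = W y ->
    unitW (fun x => x = 0 \/ 0 <= W x) (x / y).
  move=> x0 y0 exy; have z0 : x / y != 0 by exact: mulf_neq0 x0 (invr_neq0 y0).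
  move: (x / y) z0 (divfK y0 x) => z z0 ez.
  have Wz : W z = 0.
    have := WM _ _ z0 y0; rewrite ez exy.
    by move: (W z) (W y) => i j; lia.
  split; first by right; rewrite Wz.
  exists z^-1; split; last exact: mulfV.
  right; have := WM _ _ z0 (invr_neq0 z0); rewrite mulfV // W1 Wz add0r => <-.
  exact: lexx.
exists (fun x => x = 0 \/ 0 <= W x); split.
  exists W; split=> //; split=> //; split=> // k; exists (ratF (p%:R ^ k)); split; last exact: Wpk.
  by rewrite tofrac_eq0 polyC_eq0 expfz_neq0.
have ratP' (q : rat) : q != 0 -> 0 <= W (ratF q) <-> 0 <= padicv p q.
  by move=> q0; rewrite -Wrat // ler0z.
split.
  move=> q; have [->|q0] := eqVneq q 0.
    split=> _; last by left; rewrite /ratF polyC0 tofrac0.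
    exact: inZploc0.
  split; last first.
    by move=> h; right; apply/(ratP' _ q0); exact: padicv_ge0.
  case=> [/eqP|/(ratP' _ q0) h]; first by rewrite tofrac_eq0 polyC_eq0 (negbTE q0).
  have [k [u [e u0 hu hu' ek]]] := padic_dec hp q0.
  move: h; rewrite ek ler0z => k0; rewrite e.
  have [n en] : exists n : nat, k = n by exists (absz k); rewrite gez0_abs.
  rewrite en -exprnP; move: hu; rewrite /inZploc => hu.
  have -> : p%:R ^+ n * u = (((p ^ n)%N%:Z * numq u)%:~R) / (denq u)%:~R :> rat.
    by rewrite rmorphM /= -mulrA divq_num_den; congr (_ * _); rewrite -natrX.
  exact: inZploc_frac.
split.
  move=> x x0; exists (p%:R ^ W x); split; first by rewrite expfz_neq0.
  apply: unit_quotient x0 _ (esym (Wpk (W x))).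
  by rewrite tofrac_eq0 polyC_eq0 expfz_neq0.
move=> f; rewrite wR; have [->|f0] := eqVneq f 0.
  by split=> _; left => //; rewrite /polyF tofrac0.
split; case=> [/eqP|]; rewrite /polyF ?tofrac_eq0 ?(negbTE f0) //.
  by move=> h; right; rewrite W_poly.
by rewrite W_poly // => h; right.
Qed.

Lemma DVR_unramified_ring : (exists W : QX -> Prop, is_DVR W /\
    (forall q : rat, W (ratF q) <-> inZploc p q) /\
    unramifiedW W /\ (forall f, R f <-> W (polyF f))) ->
  unramified_valuation_ring p R.
Proof.
move=> [W [[w [[wM [wD wS]] wW]] [Wloc [Wunr WR]]]].
have w1 : w 1 = 0.
  have := wM 1 1 (oner_neq0 _) (oner_neq0 _); rewrite mulr1.
  by move: (w 1) => i; lia.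
have Wge x : x != 0 -> W x -> 0 <= w x.
  by move=> x0 /wW [/eqP|//]; rewrite (negbTE x0).
have unit_w u : unitW W u -> u != 0 /\ w u = 0.
  move=> [hu [t [ht e]]].
  have u0 : u != 0 by apply: contra_eq_neq e => ->; rewrite mul0r eq_sym oner_neq0.
  have t0 : t != 0 by apply: contra_eq_neq e => ->; rewrite mulr0 eq_sym oner_neq0.
  split=> //; have := wM u t u0 t0; rewrite e w1.
  have := Wge u u0 hu; have := Wge t t0 ht.
  by move: (w u) (w t) => i j; lia.
have ratF0 c : c != 0 -> ratF c != 0 :> QX by move=> c0; rewrite tofrac_eq0 polyC_eq0.
have ratFM c d : ratF (c * d) = ratF c * ratF d by rewrite /ratF polyCM tofracM.
have w_unit c : c != 0 -> inZploc p c -> inZploc p c^-1 -> w (ratF c) = 0.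
  move=> c0 hc hc'; apply: (unit_w _ _).2; split; first exact/Wloc.
  by exists (ratF c^-1); split; [exact/Wloc|rewrite -ratFM mulfV // /ratF tofrac1].
have wpk (k : int) : w (ratF (p%:R ^ k)) = k * w (ratF p%:R).
  have F0 := ratF0 _ p0.
  have wpn (n : nat) : w (ratF p%:R ^+ n) = n%:Z * w (ratF p%:R).
    elim: n => [|n IH]; first by rewrite expr0 w1 mul0r.
    rewrite exprS wM ?expf_neq0 // IH.
    by move: (w _) => i; lia.
  have eX (n : nat) : ratF (p%:R ^+ n) = ratF p%:R ^+ n.
    by rewrite /ratF polyC_exp tofracXn.
  case: k => n; first by rewrite -exprnP eX wpn.
  have G0 := ratF0 _ (expfz_neq0 (Negz n) p0).
  have := wM _ _ G0 (expf_neq0 n.+1 F0); rewrite wpn -eX -ratFM.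
  rewrite NegzE -exprnN mulVf ?expf_neq0 // /ratF tofrac1 w1.
  by move: (w _) (w _) => i j; lia.
have wrat c : c != 0 -> exists k : int, padicv p c = k%:~R /\ w (ratF c) = k * w (ratF p%:R).
  move=> c0; have [k [u [e u0 hu hu' ek]]] := padic_dec hp c0; exists k; split=> //.
  by rewrite e ratFM wM ?ratF0 ?expfz_neq0 // wpk (w_unit u) // addr0.
have wp : w (ratF p%:R) = 1.
  (* Unramifiedness yields a rational q with the value 1 of x. As every rational value is a multiple
     of [w (ratF p%:R)], which is nonnegative, that number divides 1 and equals 1. *)
  have [x [x0 wx]] := wS 1; have [q [q0 /unit_w [y0 wy]]] := Wunr x x0.
  have [k [_ ek]] := wrat q q0.
  have : w x = w (ratF q).
    by rewrite -[x in LHS](divfK (ratF0 q q0)) wM ?ratF0 // wy add0r.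
  rewrite wx ek; have := Wge _ (ratF0 _ p0) ((Wloc _).2 (inZploc_int hp p)).
  move: (w _) => m m0 /(congr1 absz) /esym/eqP; rewrite abszM muln_eq1 => /andP[_ /eqP h].
  by rewrite -(gez0_abs m0) h.
exists (fun f => w (polyF f)); split.
- by move=> f g f0 g0; rewrite /polyF tofracM wM ?tofrac_eq0.
- move=> f g f0 g0 fg0; rewrite /polyF tofracD; apply: wD; rewrite ?tofrac_eq0 //.
  by rewrite -tofracD tofrac_eq0.
- by move=> c c0; have [k [-> ek]] := wrat c c0; rewrite -[polyF _]/(ratF c) ek wp mulr1.
move=> f; rewrite WR wW; have [->|f0] := eqVneq f 0.
  by split=> _; left => //; rewrite /polyF tofrac0.
by split; case=> [/eqP|]; rewrite /polyF ?tofrac_eq0 ?(negbTE f0) //; right.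
Qed.
End DVR.

Unset Implicit Arguments.
Set Strict Implicit.
Set Printing Implicit Defensive.

Theorem mainTheorem13 (p : nat) (hp : prime p)
  (K : closedFieldType) (v : K -> rat) (HK : is_Cp p v)
  (R : {poly rat} -> Prop) (HR : is_subring R)
  (HZ : forall f, polyZp p f -> R f) :
  (is_UFD R <->
     ((forall f, R f) \/
      exists W : QX -> Prop,
        is_DVR W /\ (forall q : rat, W (ratF q) <-> inZploc p q) /\
        unramifiedW W /\ (forall f, R f <-> W (polyF f))))
  /\
  ((exists W : QX -> Prop,
        is_DVR W /\ (forall q : rat, W (ratF q) <-> inZploc p q) /\
        unramifiedW W /\ (forall f, R f <-> W (polyF f)))
   <->
   exists (a : K) (d : option nat),
     admissible v a d /\ inObr v a /\ unramified v a /\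
     (forall f, R f <-> IntQ v (ball v a d) f)).
Proof.
have sR : subring_pred R by case: HR => h1 [h2 h3]; split.
split; split.
- move=> ufd; have [hp1|np1] := boolp.EM (R ((p%:R : rat) ^ (-1))%:P).
    by left; exact: (inv_p_full hp sR HZ hp1).
  by right; apply: (unramified_ring_DVR hp); exact: (UFD_unramified_ring hp sR HZ np1 ufd).
- case=> [|/(DVR_unramified_ring hp)]; first exact: full_UFD.
  exact: unramified_ring_UFD.
- move=> /(DVR_unramified_ring hp); apply: (unramified_ring_pair hp HK).
  by rewrite -(map_polyX intr); exact: (intpolyR hp HZ).
move=> [a [d [adm [[ha _] [ua hR]]]]]; apply: (unramified_ring_DVR hp).
exact: (pair_unramified_ring hp HK adm ha ua hR).
Qed.
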